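(* Let $n$ be a natural number (positive integer), and let $(f_k)_{k\in\mathbb{N}}$ be a sequence of functions in $L^2(\mathbb{R}_+^n)$, each with $\|f_k\|_{L^2(\mathbb{R}_+^n)}=1$. The following statements are equivalent: (1) The fourth absolute moments of the stochastic integrals $I_n^S(f_k)$ converge to $2$: $\lim_{k\to\infty}\varphi(|I_n^S(f_k)|^4)=2$. (2) All nontrivial contractions of $f_k$ converge to $0$: for each $p=1,2,\dots,n-1$, $$\lim_{k\to\infty} f_k\stackrel{p}{\frown}f_k^*=0\quad\text{in } L^2(\mathbb{R}_+^{2n-2p}).$$
   Context: $\mathbb{R}_+=[0,\infty)$; $L^2$ spaces are complex-valued, with Lebesgue measure. A $W^*$-probability space $(\mathscr{A},\varphi)$ is a von Neumann algebra $\mathscr{A}$ with a weakly continuous, positive, faithful, unital tracial linear functional $\varphi$. The law of a self-adjoint $X\in\mathscr{A}$ is the unique Borel probability measure on $\mathbb{R}$ with $m$th moment $\varphi(X^m)$ for all $m\ge 0$. Unital subalgebras $\mathscr{A}_1,\dots,\mathscr{A}_r$ are freely independent if $\varphi(X_1\cdots X_m)=0$ whenever $\varphi(X_j)=0$ for all $j$, each $X_j$ belongs to one of the $\mathscr{A}_i$, and consecutive $X_j,X_{j+1}$ do not come from the same $\mathscr{A}_i$; elements are freely independent if the unital algebras they generate are. The semicircular law $S(0,t)$, $t>0$, is $\frac{1}{2\pi t}\sqrt{4t-x^2}\,dx$ on $|x|\le 2\sqrt t$. A free Brownian motion $S=(S_t)_{t\ge0}$ is a family of self-adjoint elements of a $W^*$-probability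 space $(\mathscr{A},\varphi)$ with $S_0=0$, $S_{t_2}-S_{t_1}$ of law $S(0,t_2-t_1)$ for $t_1<t_2$, and freely independent increments over successive intervals. Fix one. Wigner integral: for $f=\mathbf{1}_{[s_1,t_1]\times\cdots\times[s_n,t_n]}$ with pairwise disjoint intervals $[s_i,t_i]$, $I_n^S(f)=(S_{t_1}-S_{s_1})\cdots(S_{t_n}-S_{s_n})$; extend linearly, and then by the isometry $\varphi[I_n^S(g)^*I_n^S(f)]=\langle f,g\rangle_{L^2(\mathbb{R}_+^n)}$, to all of $L^2(\mathbb{R}_+^n)$. (Each $I_n^S(f)$ is a bounded operator.) Here $|X|^4=(XX^* )^2$, up to the trace. For $f\in L^2(\mathbb{R}_+^n)$ put $f^*(t_1,\dots,t_n)=\overline{f(t_n,\dots,t_1)}$. For $f\in L^2(\mathbb{R}_+^n)$, $g\in L^2(\mathbb{R}_+^m)$ and $0\le p\le\min\{n,m\}$, the $p$th (nested) contraction is the function in $L^2(\mathbb{R}_+^{n+m-2p})$ $$(f\stackrel{p}{\frown}g)(t_1,\dots,t_{n+m-2p})=\int_{\mathbb{R}_+^p}f(t_1,\dots,t_{n-p},s_1,\dots,s_p)\,g(s_p,\dots,s_1,t_{n-p+1},\dots,t_{n+m-2p})\,ds_1\cdots ds_p.$$ *)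

(* Defs.v *)
From HB Require Import structures.
From mathcomp Require Import all_boot all_order all_algebra.
From mathcomp Require Import complex.
From mathcomp Require Import all_classical all_reals all_analysis.

Set Implicit Arguments.
Unset Strict Implicit.
Unset Printing Implicit Defensive.

Import Order.TTheory GRing.Theory Num.Theory numFieldNormedType.Exports.

Local Open Scope classical_set_scope.
Local Open Scope ring_scope.
Local Open Scope complex_scope.

(** * Lebesgue measure on R^n, with R^n realised as [n.-tuple R] *)

Section lebesgue_cons.
Context {R : realType} (n : nat).
Variable mu : {sigma_finite_measure set (n.-tuple (measurableTypeR R)) -> \bar R}.

Definition tuple_cons (p : measurableTypeR R * n.-tuple (measurableTypeR R)) :
  n.+1.-tuple (measurableTypeR R) := [tuple of p.1 :: p.2].

Lemma measurable_tuple_cons : measurable_fun setT tuple_cons.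
Proof. exact: measurable_cons. Qed.

Definition lebesgue_cons : set (n.+1.-tuple (measurableTypeR R)) -> \bar R :=
  pushforward (@lebesgue_measure R \x mu)%E tuple_cons.

Let lebesgue_cons0 : lebesgue_cons set0 = 0%E.
Proof. by rewrite /lebesgue_cons /pushforward preimage_set0 measure0. Qed.

Let lebesgue_cons_ge0 A : (0 <= lebesgue_cons A)%E.
Proof. by rewrite /lebesgue_cons /pushforward; exact: measure_ge0. Qed.

Let measurable_preimage_cons A : measurable A -> measurable (tuple_cons @^-1` A).
Proof.
by move=> mA; rewrite -[X in measurable X]setTI; exact: measurable_tuple_cons.
Qed.

Let lebesgue_cons_sigma_additive : semi_sigma_additive lebesgue_cons.
Proof.
move=> F mF tF mUF; rewrite /lebesgue_cons /pushforward preimage_bigcup.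
apply: measure_semi_sigma_additive.
- by move=> k; exact: measurable_preimage_cons.
- apply/trivIsetP => /= i j _ _ ij; rewrite -preimage_setI.
  by move/trivIsetP : tF => /(_ _ _ _ _ ij) ->//; rewrite preimage_set0.
- by rewrite -preimage_bigcup; exact: measurable_preimage_cons.
Qed.

HB.instance Definition _ := isMeasure.Build _ _ _ lebesgue_cons
  lebesgue_cons0 lebesgue_cons_ge0 lebesgue_cons_sigma_additive.

Let lebesgue_cons_sigma_finite : sigma_finite setT lebesgue_cons.
Proof.
have /sigma_finiteP[F [TF ndF Foo]] := sigma_finiteT (@lebesgue_measure R).
have /sigma_finiteP[G [TG ndG Goo]] := sigma_finiteT mu.
pose u (t : n.+1.-tuple (measurableTypeR R)) :
  measurableTypeR R * n.-tuple (measurableTypeR R) := (thead t, [tuple of behead t]).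
have mu_ : measurable_fun setT u.
  by apply: measurable_fun_pair; [exact: measurable_tnth|exact: measurable_behead].
have uK p : u (tuple_cons p) = p.
  by case: p => x t; congr pair; exact: val_inj.
exists (fun k => u @^-1` (F k `*` G k)).
  rewrite -preimage_bigcup; apply/esym; rewrite -subTset => t _.
  have [i _ Fi] : (\bigcup_i F i) (u t).1 by rewrite -TF.
  have [j _ Gj] : (\bigcup_i G i) (u t).2 by rewrite -TG.
  exists (maxn i j) => //; split.
    by move: Fi; exact/subsetPset/ndF/leq_maxl.
  by move: Gj; exact/subsetPset/ndG/leq_maxr.
move=> k; have [mF Fk] := Foo k; have [mG Gk] := Goo k; split.
  by rewrite -[X in measurable X]setTI; apply: mu_ => //; exact: measurableX.
rewrite /lebesgue_cons /pushforward -comp_preimage.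
rewrite (_ : u \o tuple_cons = id); last by apply/funext => p /=; rewrite uK.
by rewrite preimage_id product_measure1E// lte_mul_pinfty// ge0_fin_numE.
Qed.

HB.instance Definition _ :=
  @Measure_isSigmaFinite.Build _ _ _ lebesgue_cons lebesgue_cons_sigma_finite.

End lebesgue_cons.

Fixpoint lebesgue_tuple (R : realType) (n : nat) :
    {sigma_finite_measure set (n.-tuple (measurableTypeR R)) -> \bar R} :=
  match n with
  | 0 => @dirac _ (0.-tuple (measurableTypeR R)) [tuple] R
  | m.+1 => lebesgue_cons (lebesgue_tuple R m)
  end.

(** * The spaces L^2(R_+^n) and nested contractions *)

Section L2.
Context {R : realType}.
Implicit Types n m p : nat.

Definition orthant n : set (n.-tuple (measurableTypeR R)) :=
  [set t | forall i, 0 <= tnth t i].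
Arguments orthant : clear implicits.

(* Elements of L^2(R_+^n) are represented by functions on R^n of which only the
   values on the orthant matter. *)
Definition L2norm n (f : n.-tuple R -> R[i]) : \bar R :=
  'N[lebesgue_tuple R n]_(2%:E)[(fun t => (Normc.normc (f t))%:E) \_ (orthant n)]%E.

Definition L2 n (f : n.-tuple R -> R[i]) : Prop :=
  [/\ measurable_fun (orthant n) (fun t => complex.Re (f t)),
      measurable_fun (orthant n) (fun t => complex.Im (f t)) &
      (L2norm f < +oo)%E].

Definition orthant_integral n (f : n.-tuple R -> R[i]) : R[i] :=
  (\int[lebesgue_tuple R n]_(t in orthant n) complex.Re (f t))
  +i* (\int[lebesgue_tuple R n]_(t in orthant n) complex.Im (f t)).

Definition adjoint_fun n (f : n.-tuple R -> R[i]) : n.-tuple R -> R[i] :=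
  fun t => (f [tuple of rev t])^*.

(* In zero-based terms, f is evaluated at t_0, ..., t_(n-p-1), s_0, ..., s_(p-1)
   and g at s_(p-1), ..., s_0, t_(n-p), ..., t_(n+m-2p-1). Where the integrand is
   not integrable (a null set of t for f and g in L^2) the value is
   irrelevant. *)
Definition nested_contraction n m p (f : n.-tuple R -> R[i]) (g : m.-tuple R -> R[i]) :
    (n + m - p.*2).-tuple R -> R[i] :=
  fun t => orthant_integral (fun s : p.-tuple R =>
    f [tuple nth 0 (take (n - p) t ++ s) i | i < n] *
    g [tuple nth 0 (rev s ++ drop (n - p) t) j | j < m]).

End L2.

Arguments nested_contraction {R n m} p f g t.

(** * Hilbert spaces and von Neumann algebras *)

Record hilbertSpace (R : realType) := HilbertSpace {
  hilbert_sort :> lmodType R[i];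
  hdot : {dot hilbert_sort for @conjc R};
  hilbert_complete : forall u : nat -> hilbert_sort,
    (forall e : R, 0 < e -> exists N, forall i j, (N <= i)%N -> (N <= j)%N ->
       complex.Re (hdot (u i - u j) (u i - u j)) < e) ->
    exists l, forall e : R, 0 < e -> exists N, forall i, (N <= i)%N ->
       complex.Re (hdot (u i - l) (u i - l)) < e }.

Section operators.
Context {R : realType} (H : hilbertSpace R).

Definition hnorm (x : H) : R := Num.sqrt (complex.Re (hdot H x x)).

Definition bounded_operator (T : H -> H) : Prop :=
  linear T /\ exists M : R, forall x, hnorm (T x) <= M * hnorm x.

Definition weak_operator_closure (B : set (H -> H)) : set (H -> H) :=
  [set T | forall (m : nat) (x y : 'I_m -> H) (e : R), 0 < e ->
     exists2 U, B U & forall i, Normc.normc (hdot H (T (x i) - U (x i)) (y i)) < e].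

Definition square_summable (x : nat -> H) : Prop :=
  cvgn (series (fun k => hnorm (x k) ^+ 2)).

(* T |-> \sum_k <T x_k, y_k> for square-summable x and y; these functionals
   generate the ultraweak topology. *)
Definition ultraweak_pairing (x y : nat -> H) (T : H -> H) : R[i]^o :=
  limn (series (fun k => hdot H (T (x k)) (y k) : R[i]^o)).

End operators.

(* A von Neumann algebra is a weak-operator closed unital *-algebra of bounded
   operators on a Hilbert space. The algebra is given as an [algType] identified
   with its image under the faithful map [vna_op]. *)
Record vonNeumannAlgebra (R : realType) := VonNeumannAlgebra {
  vna_sort :> algType R[i];
  star : vna_sort -> vna_sort;
  vna_space : hilbertSpace R;
  vna_op : vna_sort -> vna_space -> vna_space;
  vna_op_bounded : forall a, bounded_operator (vna_op a);
  vna_op_inj : injective vna_op;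
  vna_op_linear : forall c a b x,
    vna_op (c *: a + b) x = c *: vna_op a x + vna_op b x;
  vna_op1 : forall x, vna_op 1 x = x;
  vna_opM : forall a b x, vna_op (a * b) x = vna_op a (vna_op b x);
  vna_op_star : forall a x y,
    hdot vna_space (vna_op (star a) x) y = hdot vna_space x (vna_op a y);
  vna_closed : forall T, bounded_operator T ->
    weak_operator_closure (range vna_op) T -> range vna_op T }.

Arguments star {R v} a.

(* The weak topology on a von Neumann algebra is taken to be the ultraweak
   (weak-star) one; a functional continuous for the coarser weak operator
   topology is in particular ultraweakly continuous. *)
Definition weakly_continuous (R : realType) (A : vonNeumannAlgebra R)
    (phi : A -> R[i]) : Prop :=
  forall (a : A) (e : R), 0 < e ->
  exists (m : nat) (x y : 'I_m -> nat -> vna_space A) (d : R),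
    [/\ 0 < d, forall i, square_summable (x i) /\ square_summable (y i) &
      forall b : A,
        (forall i, Normc.normc
           (ultraweak_pairing (x i) (y i) (vna_op (b - a))) < d) ->
        Normc.normc (phi b - phi a) < e].

Record wstarProbabilitySpace (R : realType) := WstarProbabilitySpace {
  wps_sort :> vonNeumannAlgebra R;
  trace : {scalar wps_sort};
  trace_continuous : weakly_continuous trace;
  trace_ge0 : forall a, 0 <= trace (star a * a);
  trace_faithful : forall a, trace (star a * a) = 0 -> a = 0;
  trace1 : trace 1 = 1;
  trace_tracial : forall a b, trace (a * b) = trace (b * a) }.

(** * Laws, freeness, free Brownian motion *)

Definition semicircular_pdf (R : realType) (t x : R) : R :=
  if `|x| <= 2 * Num.sqrt t
  then (2 * pi * t)^-1 * Num.sqrt (4 * t - x ^+ 2) else 0.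

Definition semicircular (R : realType) (t : R) :
    set (measurableTypeR R) -> \bar R :=
  fun B => (\int[lebesgue_measure]_(x in B) (semicircular_pdf t x)%:E)%E.

Section free_probability.
Context {R : realType} (A : wstarProbabilitySpace R).

Definition has_law (X : A) (nu : set (measurableTypeR R) -> \bar R) : Prop :=
  exists P : probability (measurableTypeR R) R,
    (forall B, measurable B -> P B = nu B) /\
    forall m : nat,
      P.-integrable setT (fun x => (x ^+ m)%:E) /\
      trace A (X ^+ m) = (\int[P]_x (x ^+ m))%:C.

Definition unital_subalgebra (B : set A) : Prop :=
  [/\ B 1, forall (c : R[i]) a b, B a -> B b -> B (c *: a + b) &
      forall a b, B a -> B b -> B (a * b)].

Definition generated_subalgebra (X : A) : set A :=
  [set a | forall B, unital_subalgebra B -> B X -> B a].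

Definition freely_independent_algebras r (B : 'I_r -> set A) : Prop :=
  forall m (idx : 'I_m.+1 -> 'I_r) (X : 'I_m.+1 -> A),
    (forall j, B (idx j) (X j)) ->
    (forall j, trace A (X j) = 0) ->
    (forall j k : 'I_m.+1, k = j.+1 :> nat -> idx j != idx k) ->
    trace A (\prod_(j < m.+1) X j) = 0.

Definition freely_independent r (X : 'I_r -> A) : Prop :=
  freely_independent_algebras (fun i => generated_subalgebra (X i)).

(* Only the values of S on [0, +oo) matter. *)
Record free_brownian_motion (S : R -> A) : Prop := {
  fbm_selfadjoint : forall t, 0 <= t -> star (S t) = S t;
  fbm0 : S 0 = 0;
  fbm_law : forall t1 t2, 0 <= t1 -> t1 < t2 ->
    has_law (S t2 - S t1) (semicircular (t2 - t1));
  fbm_free : forall r (t : nat -> R), 0 <= t 0%N ->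
    (forall i, (i < r)%N -> t i < t i.+1) ->
    freely_independent (fun i : 'I_r => S (t i.+1) - S (t i)) }.

End free_probability.

(** * The Wigner integral *)

Section wigner_integral.
Context {R : realType} (n : nat).

(* A box [s_1, t_1] x ... x [s_n, t_n], stored as the tuple of the (s_i, t_i). *)
Implicit Type b : n.-tuple (R * R).

Definition box b : set (n.-tuple R) :=
  [set x | forall i, (tnth b i).1 <= tnth x i <= (tnth b i).2].

Definition off_diagonal b : Prop :=
  (forall i, 0 <= (tnth b i).1 /\ (tnth b i).1 < (tnth b i).2) /\
  (forall i j, i != j ->
    `[(tnth b i).1, (tnth b i).2] `&` `[(tnth b j).1, (tnth b j).2] = set0).

(* A list of (coefficient, box) pairs denotes a linear combination of indicators
   of boxes. *)
Implicit Type g : seq (R[i] * n.-tuple (R * R)).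

Definition step_fun g : n.-tuple R -> R[i] :=
  fun x => \sum_(cb <- g) cb.1 * \1_(box cb.2) x.

Context {A : wstarProbabilitySpace R}.
Variable S : R -> A.

Definition step_integral g : A :=
  \sum_(cb <- g) cb.1 *: \prod_(i < n) (S (tnth cb.2 i).2 - S (tnth cb.2 i).1).

(* X = I_n^S(f): the extension of [step_integral] by the isometry from
   L^2(R_+^n) to L^2(A, phi), so X is the limit of [step_integral (g k)] in the
   norm phi(Y^* Y)^(1/2) for step functions g k tending to f in L^2. By
   faithfulness of phi such an X is unique. *)
Definition is_wigner_integral (f : n.-tuple R -> R[i]) (X : A) : Prop :=
  exists g : nat -> seq (R[i] * n.-tuple (R * R)),
    [/\ forall k cb, cb \in g k -> off_diagonal cb.2,
        (fun k => L2norm (fun x => step_fun (g k) x - f x)) @ \oo --> 0%E &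
        (fun k => trace A (star (step_integral (g k) - X) *
                           (step_integral (g k) - X)) : R[i]^o) @ \oo
          --> (0 : R[i]^o)].

End wigner_integral.

(* Main.v *)
Require Import Defs.
From HB Require Import structures.
From mathcomp Require Import all_boot all_order all_algebra.
From mathcomp Require Import complex.
From mathcomp Require Import all_classical all_reals all_analysis.
From mathcomp Require Import measurable_realfun zify ring lra.

Set Implicit Arguments.
Unset Strict Implicit.
Unset Printing Implicit Defensive.

Import Order.TTheory GRing.Theory Num.Theory numFieldNormedType.Exports.

Local Open Scope classical_set_scope.
Local Open Scope ring_scope.
Local Open Scope complex_scope.

(** Why the theorem holds.  For [X] the Wigner integral of [f], the trace of
    [|X|^4] is a sum of squared norms,
    [[
      trace ((X * star X) ^+ 2) = \sum_(0 <= p <= n) || f p-contracted with f^* ||^2,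
    ]]
    because the product [X * star X] is the sum over [p] of the Wigner integrals
    of these contractions, which have different orders and so are orthogonal.
    For [p = 0] and [p = n] the term is [||f||^4 = 1].  The fourth moment is thus
    [2] plus a finite sum of nonnegative terms, and it tends to [2] exactly when
    each of these terms tends to [0].

    The formula ([wigner_fourth_moment]) is first proved for step functions.
    On a grid, the Wigner integral of a step function is a noncommutative
    polynomial in free semicircular increments, every monomial of which has
    distinct letters.  In [X_u * star (X_v)] the two innermost letters either
    differ, or their product [X_i ^+ 2] is its centred part plus the scalar
    [w_i]; iterating, the product becomes a sum over [p] of alternating words in
    the Chebyshev polynomials of degree one and two ([word_sum_reduced]).  Freeness
    makes distinct alternating words orthogonal ([cheb_prod_orthogonal]), which
    gives the formula with sums in place of integrals ([tnorm2_discrete]).  Of the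
    semicircular law only the first four moments enter, and these follow from its
    total mass by integrating exact derivatives ([semicircular_moments]).

    The passage to a general [f] has an analytic and an algebraic side.
    Contractions are continuous in [L^2] by Cauchy-Schwarz on fibres
    ([kernel2_ckernel_le], [kernel2_diff_le]), so the right-hand sides converge.
    The same estimate shows that the products [Y k * star (Y k)] of the
    approximations [Y k] of [X] form a Cauchy sequence for the trace norm.  As [Y k]
    tends to [X] in that norm, and right multiplication by a fixed element is
    bounded for it ([tnorm2_mulr_bound]), these products tend weakly to
    [X * star X], which is therefore also their norm limit
    ([tnorm2_cvg_mul_star]). *)

(** * Adjoints and the trace norm *)

Section hilbert.
Context {R : realType} (H : hilbertSpace R).
Implicit Types x y z : H.

Lemma hdot_linearl c x y z :
  hdot H (c *: x + y) z = c * hdot H x z + hdot H y z.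
Proof. by rewrite linearDl linearZl_LR. Qed.

Lemma hdotC x y : hdot H x y = conjc (hdot H y x).
Proof. by rewrite (hermC (hdot H)) mul1r. Qed.

Lemma hdot_linearr c x y z :
  hdot H z (c *: x + y) = conjc c * hdot H z x + hdot H z y.
Proof. by rewrite hdotC hdot_linearl rmorphD rmorphM /= -!hdotC. Qed.

Lemma hdot_ge0 x : 0 <= hdot H x x.
Proof.
have [->|x0] := eqVneq x 0; first by rewrite linear0l.
exact/ltW/(neq0_dnorm_gt0 (s := hdot H)).
Qed.

Lemma hdot_ext x y : (forall z, hdot H x z = hdot H y z) -> x = y.
Proof.
move=> xy; apply/eqP; rewrite -subr_eq0; apply/eqP.
have [//|/(neq0_dnorm_gt0 (s := hdot H))] := eqVneq (x - y) 0.
by rewrite linearBl /= xy subrr ltxx.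
Qed.

Lemma sqr_hnorm x : hnorm x ^+ 2 = complex.Re (hdot H x x).
Proof. by rewrite sqr_sqrtr//; have := hdot_ge0 x; rewrite lecE => /andP[]. Qed.

Lemma hnorm_ge0 x : 0 <= hnorm x.
Proof. exact: sqrtr_ge0. Qed.

Lemma hnormZ (r : R) x : 0 <= r -> hnorm (r%:C *: x) = r * hnorm x.
Proof.
move=> r0; apply/eqP; rewrite -(@eqrXn2 _ 2%N)// ?hnorm_ge0//; last first.
  by rewrite mulr_ge0 ?hnorm_ge0.
rewrite exprMn !sqr_hnorm.
have -> : hdot H (r%:C *: x) (r%:C *: x) = (r ^+ 2)%:C * hdot H x x.
  have := hdot_linearl r%:C x 0 (r%:C *: x).
  have := hdot_linearr r%:C x 0 x.
  rewrite !linear0l linear0r !addr0 => -> ->.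
  rewrite mulrA; congr (_ * _); apply/eqP; rewrite eq_complex /=.
  by apply/andP; split; apply/eqP; ring.
by case: (hdot H x x) => u v /=; rewrite mul0r subr0.
Qed.

Lemma normc_le_ReIm (z : R[i]) :
  Normc.normc z <= `|complex.Re z| + `|complex.Im z|.
Proof.
case: z => a b /=; rewrite -ler_sqr ?nnegrE ?sqrtr_ge0 ?addr_ge0//.
rewrite sqr_sqrtr ?addr_ge0 ?sqr_ge0// sqrrD !real_normK ?num_real//.
by rewrite lerD2r lerDl mulrn_wge0// mulr_ge0.
Qed.

(** Positivity of the square of [c *: x + y] for the four units [c]; the missing
    sharp constant is recovered by rescaling. *)
Lemma hdot_bound x y :
  Normc.normc (hdot H x y) <= hnorm x ^+ 2 + hnorm y ^+ 2.
Proof.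
have key c : c * conjc c = 1 ->
    - (complex.Re (c * hdot H x y)) * 2 <= hnorm x ^+ 2 + hnorm y ^+ 2.
  move=> c1; have := hdot_ge0 (c *: x + y).
  rewrite hdot_linearl !hdot_linearr (hdotC y x) !sqr_hnorm.
  rewrite mulrDr mulrA c1 mul1r lecE => /andP[_].
  case: (hdot H x x) => a1 b1; case: (hdot H y y) => a2 b2.
  case: (hdot H x y) => a3 b3; case: (c) => u v /= h.
  by rewrite -subr_ge0 (le_trans h)// le_eqVlt; apply/orP; left; apply/eqP; ring.
apply: le_trans (normc_le_ReIm _) _.
have c1 (u v : R) : u ^+ 2 + v ^+ 2 = 1 -> (u +i* v) * conjc (u +i* v) = 1.
  move=> uv; apply/eqP; rewrite eq_complex /= -[1 in X in X && _]uv.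
  by apply/andP; split; apply/eqP; ring.
have := key _ (c1 1 0 _); have := key _ (c1 (-1) 0 _).
have := key _ (c1 0 1 _); have := key _ (c1 0 (-1) _).
case: (hdot H x y) => a b /=.
rewrite !(sqrrN, expr1n, expr0n, addr0, add0r) /=.
rewrite !(mul0r, mul1r, mulN1r, sub0r, add0r, oppr0, subr0, mulNr, opprK).
move=> /(_ erefl) h1 /(_ erefl) h2 /(_ erefl) h3 /(_ erefl) h4.
have ha : `|a| * 2 <= hnorm x ^+ 2 + hnorm y ^+ 2.
  by case: (ger0P a) => _; lra.
have hb : `|b| * 2 <= hnorm x ^+ 2 + hnorm y ^+ 2.
  by case: (ger0P b) => _; lra.
lra.
Qed.

End hilbert.
Section complex_limits.
Context {R : realType}.
Implicit Types (u v : nat -> R[i]) (z w : R[i]).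
Local Notation normc := Normc.normc.

Lemma normcE z : `|z| = (normc z)%:C.
Proof. by []. Qed.

Lemma normc_ge0 z : 0 <= normc z.
Proof. by case: z => a b; exact: sqrtr_ge0. Qed.

Lemma normcB z w : normc (z - w) = normc (w - z).
Proof. by apply: complexI; rewrite -!normcE distrC. Qed.

Lemma ler_normcD z w : normc (z + w) <= normc z + normc w.
Proof. by have := ler_normD z w; rewrite !normcE -rmorphD lecR. Qed.

Lemma ler_normc_sum (u : nat -> R[i]) n :
  normc (\sum_(0 <= i < n) u i) <= \sum_(0 <= i < n) normc (u i).
Proof.
have := ler_norm_sum (index_iota 0 n) u xpredT.
by under [leRHS]eq_bigr do rewrite normcE; rewrite normcE -rmorph_sum lecR.
Qed.

Lemma Re_le_normc z : `|complex.Re z| <= normc z.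
Proof.
by case: z => a b /=; rewrite -sqrtr_sqr ler_wsqrtr// lerDl sqr_ge0.
Qed.

Lemma sqr_normcC z : (normc z ^+ 2)%:C = z * conjc z.
Proof.
case: z => a b; apply/eqP; rewrite eq_complex /= sqr_sqrtr ?addr_ge0 ?sqr_ge0//.
by apply/andP; split; apply/eqP; ring.
Qed.

(** The norm of the complex field takes complex values; this brings its limits
    back to the reals, where the order is total. *)
Lemma cvg_normcP u z : (u : nat -> R[i]^o) @ \oo --> (z : R[i]^o) <->
  (fun n => normc (u n - z)) @ \oo --> (0 : R).
Proof.
split => [/cvgrPdist_lt uz|/cvgrPdist_lt uz]; apply/cvgrPdist_lt => /= e e0.
  have /uz : 0 < e%:C by rewrite ltcR.
  apply: filterS => n.
  by rewrite normcE ltcR sub0r normrN ger0_norm ?normc_ge0// normcB.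
move: e e0 => [e e'] /=; rewrite ltcE /= => /andP[/eqP -> e0].
have := uz _ e0; apply: filterS => n.
by rewrite sub0r normrN ger0_norm ?normc_ge0// normcE normcB ltcR.
Qed.

End complex_limits.

Section von_neumann.
Context {R : realType} (A : vonNeumannAlgebra R).
Implicit Types (a b c : A) (M : R).
Local Notation normc := Normc.normc.

Lemma vna_eq a b :
  (forall x y, hdot _ (vna_op a x) y = hdot _ (vna_op b x) y) -> a = b.
Proof.
by move=> ab; apply: vna_op_inj; apply/funext => x; exact/hdot_ext/ab.
Qed.

Lemma starK : involutive (@star R A).
Proof.
by move=> a; apply: vna_eq => x y; rewrite vna_op_star hdotC vna_op_star -hdotC.
Qed.

Lemma star_linear (z : R[i]) a b : star (z *: a + b) = conjc z *: star a + star b.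
Proof.
apply: vna_eq => x y.
by rewrite vna_op_star !vna_op_linear hdot_linearr hdot_linearl -!vna_op_star.
Qed.

Lemma starM a b : star (a * b) = star b * star a.
Proof. by apply: vna_eq => x y; rewrite vna_opM !vna_op_star vna_opM. Qed.

Lemma star1 : star 1 = 1 :> A.
Proof. by apply: vna_eq => x y; rewrite vna_op_star !vna_op1. Qed.

Lemma star0 : star 0 = 0 :> A.
Proof.
have := star_linear 1 0 0; rewrite scaler0 addr0 conjc1 scale1r.
by move/eqP; rewrite -subr_eq0 opprD addrA subrr add0r oppr_eq0 => /eqP.
Qed.

Lemma starD a b : star (a + b) = star a + star b.
Proof. by rewrite -[a in LHS]scale1r star_linear conjc1 scale1r. Qed.

Lemma starZ (z : R[i]) a : star (z *: a) = conjc z *: star a.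
Proof. by rewrite -[z *: a]addr0 star_linear star0 addr0. Qed.

Lemma starN a : star (- a) = - star a.
Proof. by apply/eqP; rewrite -addr_eq0 -starD addNr star0. Qed.

Lemma starB a b : star (a - b) = star a - star b.
Proof. by rewrite starD starN. Qed.

Lemma star_sum (T : Type) (r : seq T) (P : pred T) (F : T -> A) :
  star (\sum_(i <- r | P i) F i) = \sum_(i <- r | P i) star (F i).
Proof. exact: (big_morph (@star R A) starD star0). Qed.

(** [M] bounds the operator norm of [a]; it is taken positive so that operators
    can be rescaled by its inverse. *)
Definition op_bound a M :=
  0 < M /\ forall x, hnorm (vna_op a x) <= M * hnorm x.

Lemma op_bound_ex a : exists M, op_bound a M.
Proof.
have [_ [M Ma]] := vna_op_bounded a; exists (`|M| + 1); split.
  by rewrite ltr_wpDl.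
move=> x; apply: le_trans (Ma x) _; apply: ler_wpM2r; first exact: sqrtr_ge0.
by rewrite (le_trans (ler_norm M))// lerDl.
Qed.

Lemma op_boundM a b M N : op_bound a M -> op_bound b N -> op_bound (a * b) (M * N).
Proof.
move=> [M0 Ma] [N0 Nb]; split; first exact: mulr_gt0.
move=> x; rewrite vna_opM (le_trans (Ma _))// -mulrA ler_wpM2l ?Nb// ltW//.
Qed.

Lemma op_boundX a M k : op_bound a M -> op_bound (a ^+ k) (M ^+ k).
Proof.
move=> Ma; elim: k => [|k IH]; last by rewrite !exprS; exact: op_boundM.
by split => // x; rewrite vna_op1 mul1r.
Qed.

(** [hdot_bound] applied to [M^-1 * a x] and [y], which makes the bound
    homogeneous in [M]. *)
Lemma hdot_op_bound a M x y : op_bound a M ->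
  normc (hdot _ (vna_op a x) y) <= M * (hnorm x ^+ 2 + hnorm y ^+ 2).
Proof.
move=> [M0 Ma]; set ax := vna_op a x.
have -> : hdot _ ax y = M%:C * hdot _ (M^-1%:C *: ax) y.
  have := hdot_linearl (M^-1%:C) ax 0 y; rewrite linear0l !addr0 => ->.
  by rewrite mulrA -rmorphM mulfV ?gt_eqF// rmorph1 mul1r.
rewrite Normc.normcM /= expr0n addr0 sqrtr_sqr gtr0_norm// ler_pM2l//.
rewrite (le_trans (hdot_bound _ _))// lerD2r hnormZ ?invr_ge0 ?(ltW M0)//.
rewrite ler_sqr ?nnegrE ?mulr_ge0 ?invr_ge0 ?hnorm_ge0 ?(ltW M0)//.
by rewrite ler_pdivrMl//; exact: Ma.
Qed.

Lemma op_boundZ a M (r : R) : 0 < r -> op_bound a M ->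
  op_bound (r%:C *: a) (r * M).
Proof.
move=> r0 [M0 Ma]; split; first exact: mulr_gt0.
have op0 x : vna_op (0 : A) x = 0.
  by apply: (addrI (vna_op 0 x)); rewrite addr0 -[in RHS](addr0 0) -[X in X + 0]scale1r vna_op_linear scale1r.
move=> x; rewrite -[_ *: a]addr0 vna_op_linear op0 addr0 hnormZ ?(ltW r0)//.
by rewrite -mulrA ler_pM2l.
Qed.

(** The series defining the functional is dominated by [M] times a fixed
    convergent series.  Should it diverge, its limit is the default value [0],
    which obeys the bound as well. *)
Lemma ultraweak_bound (x y : nat -> vna_space A) :
  square_summable x -> square_summable y ->
  exists C : R, forall a M, op_bound a M ->
    normc (ultraweak_pairing x y (vna_op a)) <= M * C.
Proof.
move=> sx sy.
pose C := limn (series (fun k => hnorm (x k) ^+ 2)) + limn (series (fun k => hnorm (y k) ^+ 2)).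
exists C => a M Ma; rewrite /ultraweak_pairing.
set u := fun k => _; have uC n : normc (series u n) <= M * C.
  rewrite (le_trans (ler_normc_sum _ _))//.
  apply: (@le_trans _ _ (\sum_(0 <= k < n) M * (hnorm (x k) ^+ 2 + hnorm (y k) ^+ 2))).
    by apply: ler_sum => k _; exact: hdot_op_bound.
  rewrite -mulr_sumr ler_pM2l ?(proj1 Ma)// big_split.
  by apply: lerD; apply: nondecreasing_cvgn_le => //;
     apply: nondecreasing_series => k _ _; exact: sqr_ge0.
have C0 : 0 <= M * C by apply: le_trans (uC 0%N); exact: normc_ge0.
have [ucv|udv] := pselect (cvgn (series u : nat -> R[i]^o)); last first.
  by rewrite (dvgP udv) Normc.normc0.
apply/ler_addgt0Pr => e e0.
have /cvg_normcP/cvgrPdist_lt/(_ _ e0)[n _ /(_ n (leqnn n))] := ucv.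
rewrite /= sub0r normrN ger0_norm ?normc_ge0// => /ltW h.
rewrite -[limn _](addrNK (series u n)) addrC.
rewrite (le_trans (ler_normcD _ _))// lerD//.
by rewrite normcB.
Qed.

End von_neumann.
Section trace.
Context {R : realType} (A : wstarProbabilitySpace R).
Implicit Types (a b c : A) (M : R).
Local Notation normc := Normc.normc.
Local Notation phi := (trace A).

(** An ultraweak neighbourhood of [0] on which the trace stays below [1] contains
    a small ball for the operator norm. *)
Lemma trace_bounded : exists2 C : R, 0 < C &
  forall a M, op_bound a M -> normc (phi a) <= C * M.
Proof.
have [m [x [y [d [d0 xy phid]]]]] := @trace_continuous R A 0 1 ltr01.
have Cex i : exists C : R, forall a M, op_bound a M ->
    normc (ultraweak_pairing (x i) (y i) (vna_op a)) <= M * C.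
  by have [sx sy] := xy i; exact: ultraweak_bound.
have {}[C HC] := choice Cex.
pose K := 1 + \sum_i `|C i|.
have K0 : 0 < K by rewrite ltr_pwDl// sumr_ge0.
have CK i : C i <= K.
  rewrite (le_trans (ler_norm _))// /K (bigD1 i)//= addrCA lerDl.
  by rewrite addr_ge0// sumr_ge0.
exists (2 * K / d); first by rewrite divr_gt0// mulr_gt0.
move=> a M Ma; have M0 := proj1 Ma.
pose r := d / (2 * K * M).
have r0 : 0 < r by rewrite divr_gt0// !mulr_gt0.
have /phid : forall i, normc (ultraweak_pairing (x i) (y i) (vna_op (r%:C *: a - 0))) < d.
  move=> i; rewrite subr0; have := HC i _ _ (op_boundZ r0 Ma).
  move=> /le_lt_trans; apply; rewrite (@le_lt_trans _ _ (r * M * K))//.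
    by rewrite ler_pM2l// mulr_gt0.
  rewrite /r (_ : d / (2 * K * M) * M * K = d / 2); first by rewrite ltr_pdivrMr// ltr_pMr// ltr1n.
  by field; rewrite !gt_eqF.
rewrite linear0 subr0 linearZ /= Normc.normcM /= expr0n addr0 sqrtr_sqr gtr0_norm//.
move=> /ltW; rewrite -ler_pdivlMl// => /le_trans; apply.
by rewrite mulr1 /r invf_div mulrAC.
Qed.

(** The squared norm of [L^2(A, trace)] and its real inner product. *)
Definition tnorm2 a : R := complex.Re (phi (star a * a)).
Definition tdot a b : R := complex.Re (phi (star a * b)).

Lemma trace_tnorm2 a : phi (star a * a) = (tnorm2 a)%:C.
Proof.
have := trace_ge0 a; rewrite lecE /tnorm2.
by case: (phi _) => u v /= /andP[/eqP ->].
Qed.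

Lemma tnorm2_ge0 a : 0 <= tnorm2 a.
Proof. by have := trace_ge0 a; rewrite lecE => /andP[]. Qed.

(** Only positivity is used: the traces of [star (a + 1) * (a + 1)] and of
    [star (a + i) * (a + i)] are real. *)
Lemma trace_star a : phi (star a) = conjc (phi a).
Proof.
have h1 := trace_tnorm2 (a + 1); have h2 := trace_tnorm2 (a + 'i%C *: 1).
move: h1 h2; rewrite !(starD, starZ, star1) !mulrDl !mulrDr !mul1r !mulr1.
rewrite -!scalerAr -!scalerAl !mulr1 !mul1r.
rewrite !linearD /= !linearZ /= trace_tnorm2 trace1.
case: (phi a) => u v; case: (phi (star a)) => u' v' /=.
move=> [_ h1] [_ h2]; apply/eqP; rewrite eq_complex /=.
by apply/andP; split; apply/eqP; lra.
Qed.

Lemma tdotC a b : tdot a b = tdot b a.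
Proof.
rewrite /tdot -[in RHS](starK a) -starM trace_star.
by case: (phi _).
Qed.

Lemma tdotDl a b c : tdot (a + b) c = tdot a c + tdot b c.
Proof. by rewrite /tdot starD mulrDl linearD raddfD. Qed.

Lemma tdotDr a b c : tdot a (b + c) = tdot a b + tdot a c.
Proof. by rewrite !(tdotC a) tdotDl. Qed.

Lemma tdotZl (r : R) a b : tdot (r%:C *: a) b = r * tdot a b.
Proof.
rewrite /tdot starZ -scalerAl linearZ /=; case: (phi _) => u v /=.
by rewrite oppr0 mul0r subr0.
Qed.

Lemma tdotZr (r : R) a b : tdot a (r%:C *: b) = r * tdot a b.
Proof. by rewrite !(tdotC a) tdotZl. Qed.

Lemma tnorm2D a b : tnorm2 (a + b) = tnorm2 a + 2 * tdot a b + tnorm2 b.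
Proof.
rewrite /tnorm2 -!/(tdot _ _) tdotDl !tdotDr (tdotC b a); ring.
Qed.

Lemma tnorm2N a : tnorm2 (- a) = tnorm2 a.
Proof. by rewrite /tnorm2 starN mulrNN. Qed.

Lemma tnorm2_star a : tnorm2 (star a) = tnorm2 a.
Proof. by rewrite /tnorm2 starK trace_tracial. Qed.

Lemma tnorm2D_le a b : tnorm2 (a + b) <= 2 * tnorm2 a + 2 * tnorm2 b.
Proof.
have := tnorm2_ge0 (a - b); rewrite tnorm2D tnorm2D tnorm2N.
have -> : tdot a (- b) = - tdot a b by rewrite /tdot mulrN !raddfN.
by move=> h; lra.
Qed.

Lemma tdot_cauchy_schwarz a b : tdot a b ^+ 2 <= tnorm2 a * tnorm2 b.
Proof.
have key r : 0 <= tnorm2 a + 2 * r * tdot a b + r ^+ 2 * tnorm2 b.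
  have := tnorm2_ge0 (a + r%:C *: b); rewrite tnorm2D tdotZr /tnorm2 -!/(tdot _ _).
  by rewrite tdotZl tdotZr -/(tdot _ _) mulrA (expr2 r) -[r * r * _]mulrA.
have [b0|b0] := eqVneq (tnorm2 b) 0.
  have [->|ab0] := eqVneq (tdot a b) 0; first by rewrite expr0n mulr_ge0// tnorm2_ge0.
  have := key (- (tnorm2 a + 1) / (2 * tdot a b)).
  rewrite b0 (_ : _ + _ = - 1); first by rewrite oppr_ge0 ler10.
  by field.
have {b0}b0 : 0 < tnorm2 b by rewrite lt_def b0 tnorm2_ge0.
have := key (- tdot a b / tnorm2 b).
rewrite (_ : _ + _ = tnorm2 a - tdot a b ^+ 2 / tnorm2 b).
  by rewrite subr_ge0 ler_pdivrMr.
by field; rewrite gt_eqF.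
Qed.

End trace.
Section trace_limit.
Context {R : realType} (A : wstarProbabilitySpace R).
Implicit Types (a b c X V : A) (M : R).
Local Notation normc := Normc.normc.
Local Notation phi := (trace A).

Lemma bernoulli_ineq (r : R) n : 1 <= r -> 1 + (r - 1) *+ n <= r ^+ n.
Proof.
move=> r1; elim: n => [|n IH]; first by rewrite mulr0n addr0.
rewrite exprS -[r in r * _](subrK 1) [_ - 1 + 1]addrC mulrDl mul1r mulrSr addrA lerD//.
by rewrite ler_peMr ?subr_ge0// exprn_ege1.
Qed.

(** With [c = b * star b], the numbers [h k = trace (V * c ^+ k * star V)] satisfy
    [h k ^+ 2 <= h 0 * h (2 * k)] by Cauchy-Schwarz.  If [h 1] exceeded [L * h 0],
    for [L] a bound of the operator norm of [c], then [h (2 ^ k)] would outgrow the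
    bound by [L ^+ (2 ^ k)] that comes from the continuity of the trace.  This
    avoids a square root of [L - c] in the algebra. *)
Lemma tnorm2_mulr_bound b :
  exists2 M, 0 <= M & forall V, tnorm2 (V * b) <= M * tnorm2 V.
Proof.
pose c := b * star b; have [L Lc] := op_bound_ex c; have L0 := proj1 Lc.
have cs k : star (c ^+ k) = c ^+ k.
  elim: k => [|k IH]; first exact: star1.
  by rewrite exprS starM IH /c starM starK -exprSr exprS.
have [C C0 phiC] := trace_bounded A.
exists L => [|V]; first exact: ltW.
pose h k := tdot (star V) (c ^+ k * star V).
have h0E : h 0%N = tnorm2 V by rewrite /h mul1r /tdot starK trace_tracial.
have h1E : h 1%N = tnorm2 (V * b).
  rewrite /h /tdot starK /c /tnorm2 starM expr1.
  rewrite [in LHS]trace_tracial [in RHS]mulrA [in RHS]trace_tracial.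
  by rewrite !mulrA.
have hsq k : h k ^+ 2 <= h 0%N * h (2 * k)%N.
  have := tdot_cauchy_schwarz (star V) (c ^+ k * star V).
  rewrite tnorm2_star -h0E.
  suff -> : tnorm2 (c ^+ k * star V) = h (2 * k)%N by [].
  by rewrite /tnorm2 /h /tdot starM cs !mulrA mul2n -addnn exprD !mulrA.
have h_ge0 : 0 <= h 0%N by rewrite h0E tnorm2_ge0.
have [MV BV] := op_bound_ex V; have [MV' BV'] := op_bound_ex (star V).
have hK k : h k <= C * (MV * MV') * L ^+ k.
  apply: (@le_trans _ _ (normc (phi (V * (c ^+ k * star V))))).
    by rewrite (le_trans _ (Re_le_normc _))// /h /tdot starK ler_norm.
  apply: le_trans (phiC _ _ (op_boundM BV (op_boundM (op_boundX k Lc) BV'))) _.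
  by rewrite le_eqVlt; apply/orP; left; apply/eqP; ring.
rewrite -h0E -h1E leNgt; apply/negP => hlt.
have h0 : 0 < h 0%N.
  rewrite lt_def h_ge0 andbT; apply/negP => /eqP h00.
  have := hsq 1%N; rewrite h00 mul0r leNgt exprn_gt0//.
  by rewrite (le_lt_trans _ hlt)// h00 mulr0.
pose r := h 1%N / (L * h 0%N).
have r1 : 1 < r by rewrite ltr_pdivlMr ?mulr_gt0// mul1r.
have hrk k : h 0%N * (L * r) ^+ (2 ^ k) <= h (2 ^ k)%N.
  elim: k => [|k IH].
    rewrite expn0 expr1 /r le_eqVlt; apply/orP; left; apply/eqP; field.
    by rewrite !gt_eqF.
  rewrite -(ler_pM2l h0) expnS (le_trans _ (hsq _))//.
  rewrite mulnC exprM mulrA -expr2 -exprMn ler_sqr ?nnegrE//.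
    by rewrite mulr_ge0// exprn_ge0// mulr_ge0// ltW// (lt_trans ltr01).
  by rewrite (le_trans _ IH)// mulr_ge0// exprn_ge0// mulr_ge0// ltW// (lt_trans ltr01).
pose K := C * (MV * MV') / h 0%N.
have rK k : r ^+ (2 ^ k) <= K.
  rewrite ler_pdivlMr// -(ler_pM2r (exprn_gt0 (2 ^ k) L0)).
  rewrite (le_trans _ (hK _))// (le_trans _ (hrk _))// (exprMn _ L r).
  by rewrite -mulrA mulrCA [X in h 0%N * X]mulrC.
have r10 : 0 < r - 1 by rewrite subr_gt0.
have := archi_boundP (_ : 0 <= `|K| / (r - 1)).
rewrite divr_ge0 ?(ltW r10)// => /(_ isT); rewrite ltr_pdivrMr//; apply/negP; rewrite -leNgt.
set m := Num.bound _.
apply: le_trans (ler_norm _); apply: le_trans (rK m).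
apply: le_trans (bernoulli_ineq _ (ltW r1)).
rewrite mulr_natl ler_wpDl// ler_wpMn2l ?(ltW r10)//.
by rewrite ltnW// ltn_expl.
Qed.

(** The norm limit of [Y k * star (Y k)] can only be [X * star X]: the
    convergence of [Y] makes these products converge weakly, and a weak limit
    of a Cauchy sequence is its norm limit. *)
Lemma tnorm2_cvg_mul_star (Y : nat -> A) X :
  (fun k => tnorm2 (Y k - X)) @ \oo --> (0 : R) ->
  (forall e, 0 < e -> exists N, forall j k, (N <= j)%N -> (N <= k)%N ->
     tnorm2 (Y j * star (Y j) - Y k * star (Y k)) <= e) ->
  (fun k => tnorm2 (Y k * star (Y k) - X * star X)) @ \oo --> (0 : R).
Proof.
move=> YX cauchy.
pose W k := Y k * star (Y k); pose W' := X * star X.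
have weak b : (fun k => tdot b (W k - W')) @ \oo --> (0 : R).
  have [M M0 HM] := tnorm2_mulr_bound (star b).
  pose t k := tnorm2 (Y k - X).
  pose B k := 2 * (M * (2 * t k + 2 * tnorm2 X) * t k) + 2 * (tnorm2 (star X * b) * t k).
  have B0 : B @ \oo --> (0 : R).
    have -> : (0 : R) = 2 * (M * (2 * 0 + 2 * tnorm2 X) * 0) + 2 * (tnorm2 (star X * b) * 0).
      by rewrite !mulr0 addr0.
    apply: cvgD.
      apply: cvgMr; apply: cvgM => //; apply: cvgMr; apply: cvgD; last exact: cvg_cst.
      exact: cvgMr.
    by apply: cvgMr; apply: cvgMr.
  have Bsq k : tdot b (W k - W') ^+ 2 <= B k.
    have -> : W k - W' = (Y k - X) * star (Y k) + X * star (Y k - X).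
      by rewrite starB mulrBl mulrBr addrA subrK.
    rewrite tdotDr.
    have -> : tdot b ((Y k - X) * star (Y k)) = tdot (b * Y k) (Y k - X).
      by rewrite /tdot starM mulrA trace_tracial mulrA.
    have -> : tdot b (X * star (Y k - X)) = tdot (star X * b) (star (Y k - X)).
      by rewrite /tdot starM starK mulrA.
    have c1 := tdot_cauchy_schwarz (b * Y k) (Y k - X).
    have c2 := tdot_cauchy_schwarz (star X * b) (star (Y k - X)).
    rewrite tnorm2_star -/(t k) in c2; rewrite -/(t k) in c1.
    have t0 : 0 <= t k := tnorm2_ge0 _.
    have c3 : tnorm2 (b * Y k) <= M * (2 * t k + 2 * tnorm2 X).
      rewrite -tnorm2_star starM (le_trans (HM _))// tnorm2_star ler_wpM2l//.
      by rewrite -{1}[Y k](subrK X) tnorm2D_le.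
    have := ler_wpM2r t0 c3 => /(le_trans c1) {c1 c3}.
    move: c2; rewrite /B; set u := tdot _ _; set v := tdot _ _ => c2 c1.
    have := sqr_ge0 (u - v); rewrite sqrrB sqrrD => h; lra.
  apply/cvgrPdist_lt => e e0.
  have /cvgrPdist_lt/(_ _ (exprn_gt0 2 e0)) := B0.
  apply: filterS => k; rewrite !sub0r !normrN => h.
  rewrite -ltr_sqr ?nnegrE// ?ltW//.
  by rewrite real_normK ?num_real// (le_lt_trans (Bsq k))// (le_lt_trans (ler_norm _)).
apply/cvgrPdist_lt => e e0.
have [N HN] := cauchy (e / 2) (divr_gt0 e0 (ltr0Sn _ 1)).
exists N => // k /= Nk; rewrite sub0r normrN ger0_norm ?tnorm2_ge0//.
rewrite (@le_lt_trans _ _ (e / 2))//; last by rewrite ltr_pdivrMr// ltr_pMr// ltr1n.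
apply/ler_addgt0Pr => d d0.
have /cvgrPdist_lt/(_ _ (divr_gt0 d0 (ltr0Sn _ 1)))[N' _ HN'] := weak (W k - W').
pose j := maxn N N'.
have := HN' j (leq_maxr _ _); rewrite /= sub0r normrN => /(le_lt_trans (ler_norm _)).
have := HN k j Nk (leq_maxl _ _); rewrite -/(W k) -/(W j) -/W'.
have := tnorm2_ge0 ((W k - W') - (W k - W j)).
have -> : tdot (W k - W') (W j - W') = tnorm2 (W k - W') - tdot (W k - W') (W k - W j).
  apply/eqP; rewrite eq_sym subr_eq -tdotDr.
  by rewrite [X in _ == tdot _ X]addrC subrKA.
rewrite tnorm2D tnorm2N (_ : tdot _ (- _) = - tdot (W k - W') (W k - W j)); last first.
  by rewrite /tdot mulrN !raddfN.
by lra.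
Qed.

End trace_limit.
(** * Low moments of the semicircular law *)

Section semicircular_moments.
Context {R : realType}.
Local Notation leb := (@lebesgue_measure R).
Local Notation normc := Normc.normc.

(** [p] is almost everywhere the Radon-Nikodym derivative of [P], since both have
    the same integrals over all measurable sets. *)
Lemma integral_density (P : probability (measurableTypeR R) R)
    (p : R -> R) (f : R -> \bar R) :
  (forall x, 0 <= p x) -> measurable_fun setT p ->
  (forall B, measurable B -> P B = (\int[leb]_(x in B) (p x)%:E)%E) ->
  P.-integrable setT f ->
  (\int[P]_x f x = \int[leb]_x (f x * (p x)%:E))%E.
Proof.
move=> p0 mp PE intf.
have intp : leb.-integrable setT (EFin \o p).
  apply/integrableP; split; first exact/measurable_EFinP.
  under eq_integral do rewrite /= ger0_norm//.
  by rewrite -PE// (le_lt_trans (probability_le1 _ _))// ltry.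
have dom : P `<< leb.
  apply/null_content_dominatesP => B mB B0.
  rewrite PE//; apply: null_set_integral => //.
  exact/measurable_funTS/measurable_EFinP.
rewrite -(Radon_Nikodym_change_of_variables dom)//=.
apply: ae_eq_integral => //.
- apply: emeasurable_funM; first exact: measurable_int intf.
  by apply: (measurable_int leb); apply: Radon_Nikodym_integrable; exact: dom.
- by apply: emeasurable_funM; [exact: measurable_int intf|exact/measurable_EFinP].
- apply: ae_eqe_mul2l => /=; apply: integral_ae_eq => //=.
  + apply: Radon_Nikodym_integrable. exact: dom.
  + exact/measurable_EFinP.
  + move=> E _ mE; rewrite -Radon_Nikodym_integral//=; exact: PE.
Qed.

Variable t : R.
Hypothesis t0 : 0 < t.
Let K : R := (2 * pi * t)^-1.
Let s : R := 2 * Num.sqrt t.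
Let q (x : R) : R := Num.sqrt (4 * t - x ^+ 2).

Let s0 : 0 < s. Proof. by rewrite mulr_gt0// sqrtr_gt0. Qed.
Let s2 : s ^+ 2 = 4 * t.
Proof. by rewrite /s exprMn sqr_sqrtr ?ltW// -natrX. Qed.

Let q_out x : ~~ (`|x| <= s) -> q x = 0.
Proof.
rewrite -ltNge => sx; rewrite /q ler0_sqrtr// subr_le0 -s2.
by rewrite -[leRHS]real_normK ?num_real// ltW// ltr_sqr ?nnegrE ?(ltW s0).
Qed.

(* [Num.sqrt] vanishes on negative numbers, so that one formula describes the
   density on the whole line. *)
Let pdfE x : semicircular_pdf t x = K * q x.
Proof.
by rewrite /semicircular_pdf -/s; case: ifPn => // /q_out ->; rewrite mulr0.
Qed.

Let q_continuous : continuous q.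
Proof.
move=> x; apply: continuous_comp; last exact: sqrt_continuous.
by apply: cvgB; [exact: cvg_cst|exact: exprn_continuous].
Qed.

Let pdf_ge0 x : 0 <= semicircular_pdf t x.
Proof.
rewrite pdfE mulr_ge0 ?sqrtr_ge0// invr_ge0 !mulr_ge0 ?pi_ge0// ltW//.
Qed.

Lemma measurable_semicircular_pdf : measurable_fun setT (semicircular_pdf t).
Proof.
rewrite (_ : semicircular_pdf t = fun x => K * q x); last exact/funext/pdfE.
apply: measurable_funM => //; exact: continuous_measurable_fun.
Qed.

(* The integrand is the derivative of [x ^+ k * (4 * t - x ^+ 2) ^ (3 / 2)],
   which vanishes at both ends of the support. *)
Let antiderivative_integral k :
  (\int[leb]_(x in `[(- s)%R, s]) (K * ((4 * t * k%:R * x ^+ k.-1 - k.+3%:R * x ^+ k.+1) * q x))%:E = 0)%E.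
Proof.
pose F (x : R) : R := K * (x ^+ k * (4 * t - x ^+ 2) * q x).
have dF x : -s < x < s -> is_derive x 1 F (K * ((4 * t * k%:R * x ^+ k.-1 - k.+3%:R * x ^+ k.+1) * q x)).
  move=> xs.
  have y0 : 0 < 4 * t - x ^+ 2.
    rewrite subr_gt0 -s2 -[ltLHS]real_normK ?num_real// ltr_sqr ?nnegrE ?(ltW s0)//.
    by rewrite ltr_norml.
  have dp : is_derive x 1 (fun x => 4 * t - x ^+ 2) (- (2 * x)).
    apply: is_derive_eq; rewrite /GRing.scale /= !mulr1; ring.
  have dq : is_derive x 1 q ((2 * q x)^-1 * (- (2 * x))).
    exact: (@is_derive1_comp _ _ (fun x => 4 * t - x ^+ 2) x _ _ (is_derive1_sqrt y0) dp).
  have q0 : q x != 0 by rewrite gt_eqF// sqrtr_gt0.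
  have qq : q x ^+ 2 = 4 * t - x ^+ 2 by rewrite sqr_sqrtr// ltW.
  have dX : is_derive x 1 (fun y : R => y ^+ k) (k%:R * x ^+ k.-1).
    have -> : (fun y : R => y ^+ k) = id ^+ k by rewrite exprfctE.
    apply: (is_derive_eq (@is_deriveX _ _ id k x 1 1 (is_derive_id x 1))).
    by rewrite /GRing.scale /= mulr1 mulr_natl.
  apply: (is_derive_eq (is_deriveZ K (is_deriveM (is_deriveM dX dp) dq))).
  rewrite /GRing.scale /=; congr (K * _).
  have -> : x ^+ k * (4 * t - x ^+ 2) * ((2 * q x)^-1 * - (2 * x)) = - (x ^+ k.+1 * q x).
    rewrite -qq [x ^+ k.+1]exprSr; move: (q x) q0 => z z0; field.
    by rewrite z0.
  have -> : (4 * t - x ^+ 2) * (k%:R * x ^+ k.-1) = 4 * t * k%:R * x ^+ k.-1 - k%:R * x ^+ k.+1.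
    case: (k) => [|j]; first by rewrite !mul0r !mulr0 mul0r subr0.
    by rewrite /= !exprS; ring.
  by rewrite exprSr; ring.
have cF : continuous F.
  move=> x; apply: cvgM; first exact: cvg_cst.
  apply: cvgM; last exact: q_continuous.
  apply: cvgM; first exact: exprn_continuous.
  by apply: cvgB; [exact: cvg_cst|exact: exprn_continuous].
have Fs : F s = 0 by rewrite /F s2 subrr mulr0 mul0r mulr0.
have FNs : F (- s) = 0 by rewrite /F sqrrN s2 subrr mulr0 mul0r mulr0.
rewrite (@continuous_FTC2 _ _ F) ?Fs ?FNs ?sube0//.
- by rewrite gtrN.
- apply: continuous_subspaceT => x; apply: cvgM; first exact: cvg_cst.
  apply: cvgM; last exact: q_continuous.
  apply: cvgB; (apply: cvgM; [exact: cvg_cst|exact: exprn_continuous]).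
- split.
  + by move=> x; rewrite in_itv /= => /dF [].
  + exact/cvg_at_right_filter/cF.
  + exact/cvg_at_left_filter/cF.
- by move=> x; rewrite in_itv /= derive1E => /dF [_ ->].
Qed.

(** The total mass of [P] being known, this determines all the moments without
    any integral of the density being computed. *)
Lemma semicircular_moment_rec (P : probability (measurableTypeR R) R) k :
  (forall B, measurable B -> P B = semicircular t B) ->
  (forall m, P.-integrable setT (fun x => (x ^+ m)%:E)) ->
  4 * t * k%:R * (\int[P]_x (x ^+ k.-1)) = k.+3%:R * (\int[P]_x (x ^+ k.+1)).
Proof.
move=> PE intP.
have intZ c m : P.-integrable setT (EFin \o (fun x : R => c * x ^+ m)).
  have := integrableZl measurableT c (intP m).
  by apply: eq_integrable => // x _; rewrite EFinM.
apply/eqP; rewrite -subr_eq0 -!RintegralZl//; [|exact: intP|exact: intP].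
rewrite -RintegralB//=; apply/eqP; rewrite /Rintegral.
rewrite (integral_density pdf_ge0 measurable_semicircular_pdf PE); last first.
  have := integrableB measurableT (intZ (4 * t * k%:R) k.-1) (intZ k.+3%:R k.+1).
  by apply: eq_integrable => // x _; rewrite /= EFinB.
rewrite -[RHS](congr1 fine (antiderivative_integral k)) [in RHS]integral_mkcond.
congr fine; apply: eq_integral => x _; rewrite patchE pdfE -EFinM.
case: ifPn => [_|]; first by congr EFin; ring.
rewrite notin_setE /= in_itv /= -ler_norml => /negP/q_out ->.
by rewrite !mulr0.
Qed.

Lemma semicircular_moments (A : wstarProbabilitySpace R) (X : A) :
  has_law X (semicircular t) ->
  [/\ trace A X = 0, trace A (X ^+ 2) = t%:C, trace A (X ^+ 3) = 0 &
      trace A (X ^+ 4) = (2 * t ^+ 2)%:C].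
Proof.
move=> [P [PE HP]]; have intP m := proj1 (HP m); have trP m := proj2 (HP m).
have rec k := semicircular_moment_rec k PE intP.
have m0 : \int[P]_x (x ^+ 0) = 1.
  rewrite /Rintegral (eq_integral (cst 1%E)) => [|x _]; last by rewrite expr0.
  rewrite integral_cst// mul1e.
  exact: (congr1 fine (probability_setT P)).
have := rec 0%N; have := rec 1%N; have := rec 2%N; have := rec 3%N.
rewrite /= m0 mulr0 mul0r mulr1 -[X in trace A X]expr1 !trP.
move: (\int[P]_x (x ^+ 1)) (\int[P]_x (x ^+ 2)) (\int[P]_x (x ^+ 3)) (\int[P]_x (x ^+ 4)).
move=> m1 m2 m3 m4 e4 e3 e2 e1.
have {}e1 : m1 = 0 by lra.
have {}e2 : m2 = t by lra.
have {}e3 : m3 = 0 by rewrite e1 in e3; lra.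
have {}e4 : m4 = 2 * t ^+ 2.
  by move: e4; rewrite e2 => e4; apply: (mulfI (_ : 6 != 0 :> R)) => //; rewrite -e4; ring.
by rewrite e1 e2 e3 e4.
Qed.

End semicircular_moments.
(** * Words in free semicircular elements *)

Section tuple_sums.
Context {N : nat} {V : nmodType}.
Implicit Types (F G : seq 'I_N -> V) (n : nat).

(** Words of length [n] are taken as sequences, not as tuples, so that they can be
    concatenated and split without casts. *)
Definition tsum n F : V := \sum_(t : n.-tuple 'I_N) F t.

Lemma tsum0 F : tsum 0 F = F [::].
Proof. by rewrite /tsum (big_pred1 [tuple])// => t; apply/esym/eqP/tuple0. Qed.

Lemma tsumS n F : tsum n.+1 F = \sum_i tsum n (fun s => F (i :: s)).
Proof.
rewrite /tsum pair_big /=.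
rewrite (reindex (fun p : 'I_N * n.-tuple 'I_N => [tuple of p.1 :: p.2]))//=.
exists (fun t : n.+1.-tuple 'I_N => (thead t, [tuple of behead t])).
  by move=> [i t] _; congr pair; exact: val_inj.
by move=> t _; rewrite -tuple_eta.
Qed.

Lemma eq_tsum n F G : (forall s, size s = n -> F s = G s) -> tsum n F = tsum n G.
Proof. by move=> FG; apply: eq_bigr => t _; rewrite FG// size_tuple. Qed.

Lemma tsum_rev n F : tsum n (F \o rev) = tsum n F.
Proof.
rewrite /tsum [RHS](reindex (fun t : n.-tuple 'I_N => [tuple of rev t]))//=.
by exists (fun t : n.-tuple 'I_N => [tuple of rev t]) => t _; apply: val_inj; rewrite /= revK.
Qed.

Lemma tsum_sum n (I : finType) (F : I -> seq 'I_N -> V) :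
  tsum n (fun s => \sum_i F i s) = \sum_i tsum n (F i).
Proof. exact: exchange_big. Qed.

Lemma tsumD n F G : tsum n (fun s => F s + G s) = tsum n F + tsum n G.
Proof. exact: big_split. Qed.

End tuple_sums.

Lemma raddf_tsum N (U V : nmodType) (f : {additive U -> V}) n (F : seq 'I_N -> U) :
  f (tsum n F) = tsum n (f \o F).
Proof. exact: raddf_sum. Qed.

Section free_words.
Context {R : realType} (A : wstarProbabilitySpace R).
Context {N : nat} (X : 'I_N -> A) (w : 'I_N -> R).
Hypothesis X_star : forall i, star (X i) = X i.
Hypothesis X_free : freely_independent X.
Hypothesis X_moments : forall i,
  [/\ trace A (X i) = 0, trace A (X i ^+ 2) = (w i)%:C,
      trace A (X i ^+ 3) = 0 & trace A (X i ^+ 4) = (2 * w i ^+ 2)%:C].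
Local Notation phi := (trace A).
Local Notation letter := ('I_N * bool)%type.

(** The definition of freeness, with the factors listed in a sequence. *)
Lemma trace_alternating (s : seq ('I_N * A)) :
  s != [::] ->
  {in s, forall a, generated_subalgebra (X a.1) a.2 /\ phi a.2 = 0} ->
  sorted (fun i j => i != j) (map fst s) ->
  phi (\prod_(a <- s) a.2) = 0.
Proof.
case: s => // x s _ Hs alt; rewrite (big_nth x) big_mkord.
have xs (j : 'I_(size s).+1) : nth x (x :: s) j \in x :: s by rewrite mem_nth.
apply: (X_free (idx := fun j => (nth x (x :: s) j).1)).
- by move=> j; exact: (proj1 (Hs _ (xs j))).
- by move=> j; exact: (proj2 (Hs _ (xs j))).
move=> j k kj; move: alt => /(sortedP x.1)/(_ j).
rewrite size_map /= -kj ltn_ord => /(_ isT).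
by rewrite -!(nth_map x x.1 fst (s := x :: s)) /= ?ltn_ord// kj.
Qed.

(** The Chebyshev polynomials of degree one and two, which are orthogonal for the
    semicircular law of variance [w i]. *)
Definition cheb (a : letter) : A :=
  if a.2 then X a.1 ^+ 2 - (w a.1)%:C *: 1 else X a.1.

Definition cheb_norm (a : letter) : R := w a.1 ^+ a.2.+1.

Definition cheb_prod (L : seq letter) : A := \prod_(a <- L) cheb a.

Lemma generated_subalgebra_unital (Y : A) : unital_subalgebra (generated_subalgebra Y).
Proof.
split; first by move=> B [].
  by move=> c a b Ba Bb B UB BY; case: (UB) => _ + _; apply; [exact: Ba|exact: Bb].
by move=> a b Ba Bb B UB BY; case: (UB) => _ _; apply; [exact: Ba|exact: Bb].
Qed.

Lemma cheb_generated a : generated_subalgebra (X a.1) (cheb a).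
Proof.
have [B1 BD BM] := generated_subalgebra_unital (X a.1).
have BX : generated_subalgebra (X a.1) (X a.1) by [].
rewrite /cheb; case: ifP => // _.
by rewrite addrC -scaleNr; apply: BD => //; rewrite expr2; exact: BM.
Qed.

Lemma star_cheb a : star (cheb a) = cheb a.
Proof.
rewrite /cheb; case: ifP => // _.
by rewrite starB starZ star1 expr2 starM X_star conjc_real.
Qed.

Lemma star_cheb_prod L : star (cheb_prod L) = cheb_prod (rev L).
Proof.
rewrite /cheb_prod; elim: L => [|a L IH]; first by rewrite !big_nil star1.
by rewrite big_cons starM IH rev_cons -cats1 big_cat big_seq1 star_cheb.
Qed.

Lemma trace_cheb a : phi (cheb a) = 0.
Proof.
case: a => i [] /=; rewrite /cheb /=; have [m1 m2 _ _] := X_moments i => //.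
by rewrite linearB linearZ /= trace1 m2 mulr1 subrr.
Qed.

Lemma trace_chebM i b c :
  phi (cheb (i, b) * cheb (i, c)) = if b == c then (cheb_norm (i, b))%:C else 0.
Proof.
have [m1 m2 m3 m4] := X_moments i; rewrite /cheb /cheb_norm /=.
case: b; case: c => /=.
- rewrite mulrBl !mulrBr -!scalerAl -!scalerAr !mul1r mulr1 -exprD.
  rewrite !linearB /= !linearZ /= trace1 m4 m2.
  by apply/eqP; rewrite eq_complex /=; apply/andP; split; apply/eqP; ring.
- by rewrite mulrBl -exprSr -scalerAl mul1r linearB linearZ /= m3 m1 mulr0 subr0.
- by rewrite mulrBr -exprS -scalerAr mulr1 linearB linearZ /= m3 m1 mulr0 subr0.
- by rewrite -expr2 m2.
Qed.

(** The heads of [L] and [L'] meet in the middle of the product.  If their indices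
    differ, the whole word is alternating and centred.  Otherwise the product of
    the two heads is a centred element of the same subalgebra, which leaves an
    alternating word again, plus its trace, which leaves the product of the two
    tails. *)
Lemma cheb_prod_orthogonal L L' :
  sorted (fun i j => i != j) (map fst L) ->
  sorted (fun i j => i != j) (map fst L') ->
  phi (cheb_prod (rev L) * cheb_prod L') =
  if L == L' then (\prod_(a <- L) cheb_norm a)%:C else 0.
Proof.
pose lift (a : letter) : 'I_N * A := (a.1, cheb a).
have lift_prod s : \prod_(a <- map lift s) a.2 = cheb_prod s by rewrite big_map.
have fst_lift s : map fst (map lift s) = map fst s by rewrite -map_comp.
have lift_in s : {in map lift s, forall a, generated_subalgebra (X a.1) a.2 /\ phi a.2 = 0}.
  by move=> _ /mapP[a _ ->] /=; split; [exact: cheb_generated|exact: trace_cheb].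
have alt0 s : s != [::] -> sorted (fun i j => i != j) (map fst s) -> phi (cheb_prod s) = 0.
  move=> s0 alts; rewrite -lift_prod; apply: trace_alternating => //.
    by case: (s) s0.
  by rewrite fst_lift.
have sym : (fun z : 'I_N => (fun i j => i != j)^~ z) = (fun i j => i != j).
  by apply/funext => i; apply/funext => j /=; rewrite eq_sym.
elim: L L' => [|x L IH] [|y L'] sL sL'.
- by rewrite /cheb_prod !big_nil mul1r trace1 eqxx rmorph1.
- by rewrite [cheb_prod (rev _)]big_nil mul1r alt0.
- rewrite [cheb_prod [::]]big_nil mulr1 alt0//; last by rewrite map_rev rev_sorted sym.
  by rewrite -size_eq0 size_rev.
have [xy|xy] := eqVneq x.1 y.1; last first.
  have -> : (x :: L == y :: L') = false.
    by apply/negbTE; apply: contraNneq xy => -[->].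
  rewrite -[_ * _](_ : cheb_prod (rev (x :: L) ++ y :: L') = _); last first.
    by rewrite /cheb_prod big_cat.
  rewrite alt0//; first by rewrite -size_eq0 size_cat /= addnS.
  rewrite map_cat /= sorted_cat_cons -/(map fst (y :: L')) map_rev /=.
  rewrite -[path _ _ _]/(sorted (fun i j => i != j) (map fst (y :: L'))) sL' andbT.
  by rewrite -rev_cons rev_sorted sym /= eq_sym xy.
have -> : cheb_prod (rev (x :: L)) * cheb_prod (y :: L') =
    cheb_prod (rev L) * cheb x * (cheb y * cheb_prod L').
  by rewrite rev_cons -cats1 /cheb_prod big_cat big_seq1 big_cons.
set c := phi (cheb x * cheb y); pose z := cheb x * cheb y - c *: 1.
have -> : cheb_prod (rev L) * cheb x * (cheb y * cheb_prod L') =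
    cheb_prod (rev L) * (z * cheb_prod L')
    + c *: (cheb_prod (rev L) * cheb_prod L').
  by rewrite /z mulrBl mulrBr -scalerAl mul1r -scalerAr subrK !mulrA.
rewrite linearD linearZ /=.
have -> : phi (cheb_prod (rev L) * (z * cheb_prod L')) = 0.
  have := @trace_alternating (map lift (rev L) ++ (x.1, z) :: map lift L').
  rewrite big_cat big_cons /= !lift_prod; apply.
  - by rewrite -size_eq0 size_cat /= addnS.
  - move=> a; rewrite mem_cat inE => /or3P[/lift_in//|/eqP ->|/lift_in//] /=.
    split; last by rewrite /z linearB linearZ /= trace1 mulr1 subrr.
    have [B1 BD BM] := generated_subalgebra_unital (X x.1).
    rewrite /z addrC -scaleNr; apply: BD => //.
    by apply: BM; [exact: cheb_generated|rewrite xy; exact: cheb_generated].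
  - rewrite map_cat /= !fst_lift sorted_cat_cons map_rev -rev_cons rev_sorted sym.
    by rewrite [X in X && _]sL xy.
rewrite add0r IH; [|exact: path_sorted sL|exact: path_sorted sL'].
rewrite /c; case: x y xy {sL sL' z c} => i b [j b'] /= <- {j}.
rewrite trace_chebM eqseq_cons xpair_eqE eqxx /= big_cons.
case: (b == b') => /=; last by rewrite mul0r.
by case: (L == L'); rewrite ?mulr0// rmorphM.
Qed.

Definition plain (a : seq 'I_N) : seq letter := [seq (i, false) | i <- a].

(** The alternating word of the reduced part of [X_u * star (X_v)], where the
    words [u] and [v] are read from the middle outwards. *)
Definition reduced (a b : seq 'I_N) : seq letter :=
  match a, b with
  | x :: a', y :: b' =>
      if x == y then rev (plain a') ++ (x, true) :: plain b'
      else rev (plain a) ++ plain b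
  | _, _ => rev (plain a) ++ plain b
  end.

Lemma plain_inj : injective plain.
Proof. by apply: inj_map => i j []. Qed.

Lemma map_fst_plain a : map fst (plain a) = a.
Proof. by rewrite -map_comp map_id. Qed.

Lemma size_reduced a b : size a = size b ->
  size (reduced a b) = ((size a).*2 - [&& (0 < size a)%N & ohead a == ohead b])%N.
Proof.
case: a b => [|x a] [|y b]//= [ab].
have -> : (Some x == Some y) = (x == y) by [].
case: eqP => _; rewrite size_cat size_rev /= !size_map ab -addnn/= ?subn1 ?subn0//.
Qed.

(** The parity of its length tells whether the middle of the word is a polynomial
    of degree two, that is, whether the two heads were equal. *)
Lemma reduced_inj a b a' b' : size a = size b -> size a' = size b' ->
  reduced a b = reduced a' b' -> (a, b) = (a', b').
Proof.
move=> ab ab' E; have := congr1 size E; rewrite !size_reduced//.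
have someE (u v : 'I_N) : (Some u == Some v) = (u == v) by [].
case: a b ab E => [|x a] [|y b]//= => [_ E|[ab] E]; case: a' b' ab' E => [|x' a'] [|y' b']//=.
- by move=> _ _; rewrite someE; case: eqP => _; lia.
- by move=> _ _; rewrite someE; case: eqP => _; lia.
move=> [ab'] E; rewrite !someE -!addnn.
case: eqP E => [<-|xy]; case: eqP => [<-|xy'] /= E s; try lia.
  have aa' : size a = size a' by lia.
  move/eqP: E; rewrite eqseq_cat ?size_rev ?size_map//.
  rewrite eqseq_cons xpair_eqE => /andP[/eqP/(can_inj revK)/plain_inj <-].
  by rewrite andbT => /andP[/eqP <- /eqP/plain_inj <-].
have aa' : size a = size a' by lia.
move/eqP: E; rewrite eqseq_cat; last by rewrite !size_rev /= !size_map aa'.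
move=> /andP[/eqP/(can_inj revK)].
by move=> /(@plain_inj (x :: a) (x' :: a')) -> /eqP/(@plain_inj (y :: b) (y' :: b')) ->.
Qed.

Lemma uniq_alternating (a : seq 'I_N) : uniq a -> sorted (fun i j => i != j) a.
Proof. by rewrite uniq_pairwise; exact: pairwise_sorted. Qed.

Lemma reduced_alternating a b : size a = size b -> uniq a -> uniq b ->
  sorted (fun i j => i != j) (map fst (reduced a b)).
Proof.
have sym : (fun z : 'I_N => (fun i j => i != j)^~ z) = (fun i j => i != j).
  by apply/funext => i; apply/funext => j /=; rewrite eq_sym.
case: a b => [|x a] [|y b]// _ /uniq_alternating ua /uniq_alternating ub.
rewrite /reduced; case: eqVneq ub => [<-|xy] ub.
  rewrite map_cat map_rev /= !map_fst_plain sorted_cat_cons -rev_cons.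
  by rewrite rev_sorted sym [X in X && _]ua.
rewrite map_cat map_rev !map_fst_plain sorted_cat_cons -rev_cons.
by rewrite rev_sorted sym /= eq_sym xy; apply/andP; split.
Qed.

Definition weight (a : seq 'I_N) : R := \prod_(i <- a) w i.

Lemma weight_cons i a : weight (i :: a) = w i * weight a.
Proof. exact: big_cons. Qed.

Lemma prod_cheb_norm_reduced a b : size a = size b ->
  \prod_(l <- reduced a b) cheb_norm l = weight a * weight b.
Proof.
have plainE c : \prod_(l <- plain c) cheb_norm l = weight c.
  by rewrite big_map; apply: eq_bigr => i _; rewrite /cheb_norm expr1.
have revplainE c : \prod_(l <- rev (plain c)) cheb_norm l = weight c.
  rewrite -plainE; apply: perm_big; exact: permEl (perm_rev _).
case: a b => [|x a] [|y b]// _; first by rewrite big_nil /weight !big_nil mulr1.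
rewrite /reduced; case: eqVneq => [<-|_]; last by rewrite big_cat revplainE plainE.
rewrite big_cat big_cons revplainE plainE !weight_cons /cheb_norm /= expr2.
by rewrite mulrACA mulrCA.
Qed.

(** As words are read from the middle outwards, the letters that meet in the
    product of two words are their heads. *)
Definition contract (K : seq 'I_N -> seq 'I_N -> R[i]) a b : R[i] :=
  \sum_x (w x)%:C * K (x :: a) (x :: b).

Definition word (a : seq 'I_N) : A := \prod_(i <- a) X i.

Definition word_sum n K : A :=
  tsum n (fun a => tsum n (fun b => K a b *: (word (rev a) * word b))).

Definition reduced_sum n K : A :=
  tsum n (fun a => tsum n (fun b => K a b *: cheb_prod (reduced a b))).

Lemma word_cat a b : word (a ++ b) = word a * word b.
Proof. exact: big_cat. Qed.

Lemma word_cons i a : word (i :: a) = X i * word a.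
Proof. exact: big_cons. Qed.

Lemma word_rev_cons i a : word (rev (i :: a)) = word (rev a) * X i.
Proof. by rewrite rev_cons -cats1 word_cat word_cons [word [::]]big_nil mulr1. Qed.

Lemma cheb_prod_cat L L' : cheb_prod (L ++ L') = cheb_prod L * cheb_prod L'.
Proof. exact: big_cat. Qed.

(** When the two innermost letters are equal, their product is its centred part
    plus its trace; the trace leaves the product of the shorter words. *)
Lemma word_mul x y a b :
  word (rev (x :: a)) * word (y :: b) =
  cheb_prod (reduced (x :: a) (y :: b))
  + (if x == y then (w x)%:C else 0) *: (word (rev a) * word b).
Proof.
have plainE c : cheb_prod (plain c) = word c by rewrite /cheb_prod big_map.
have revplainE c : cheb_prod (rev (plain c)) = word (rev c).
  by rewrite -plainE /plain map_rev.
rewrite /reduced; case: eqP => [<-|_]; last first.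
  by rewrite scale0r addr0 cheb_prod_cat revplainE plainE.
rewrite cheb_prod_cat [cheb_prod (_ :: _)]big_cons revplainE -/(cheb_prod _) plainE.
rewrite word_rev_cons word_cons /cheb /= mulrBl mulrBr -scalerAl mul1r -scalerAr subrK.
by rewrite expr2 !mulrA.
Qed.

Lemma word_sumS n K :
  word_sum n.+1 K = reduced_sum n.+1 K + word_sum n (contract K).
Proof.
rewrite /word_sum /reduced_sum !tsumS.
have -> : tsum n (fun a => tsum n (fun b => contract K a b *: (word (rev a) * word b))) =
   \sum_x tsum n (fun a => \sum_y tsum n (fun b =>
     K (x :: a) (y :: b) *: ((if x == y then (w x)%:C else 0) *: (word (rev a) * word b)))).
  rewrite -tsum_sum; apply: eq_tsum => a _.
  under [RHS]eq_bigr do rewrite -tsum_sum.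
  rewrite -tsum_sum; apply: eq_tsum => b _.
  rewrite /contract scaler_suml; apply: eq_bigr => x _.
  rewrite (bigD1 x)//= eqxx scalerA [X in _ + X]big1 ?addr0 1?mulrC// => y yx.
  by rewrite eq_sym (negbTE yx) scale0r scaler0.
rewrite -big_split; apply: eq_bigr => x _ /=.
rewrite -tsumD; apply: eq_tsum => a _.
rewrite !tsumS -big_split; apply: eq_bigr => y _ /=.
rewrite -tsumD; apply: eq_tsum => b _.
by rewrite word_mul scalerDr.
Qed.

Lemma word_sum_reduced n K :
  word_sum n K = \sum_(p < n.+1) reduced_sum (n - p) (iter p contract K).
Proof.
elim: n K => [|n IH] K.
  rewrite big_ord1 /word_sum /reduced_sum !tsum0 /= /cheb_prod /word !big_nil.
  by rewrite mul1r.
by rewrite big_ord_recl word_sumS IH; congr (_ + _); apply: eq_bigr => p _; rewrite -iterSr.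
Qed.

(** Step functions vanish near the diagonals, so their words have distinct
    letters; this is what makes the reduced words alternating. *)
Definition supported_on_uniq n (K : seq 'I_N -> seq 'I_N -> R[i]) :=
  forall a b, size a = n -> size b = n -> K a b != 0 -> uniq a && uniq b.

Lemma contract_supported n K :
  supported_on_uniq n.+1 K -> supported_on_uniq n (contract K).
Proof.
move=> sK a b an bn; apply: contraNT => nu; apply/eqP; apply: big1 => x _.
have [->|/sK] := eqVneq (K (x :: a) (x :: b)) 0; first by rewrite mulr0.
rewrite /= an bn => /(_ erefl erefl)/andP[/andP[_ ua] /andP[_ ub]].
by rewrite ua ub in nu.
Qed.

Lemma iter_contract_supported n p K : (p <= n)%N ->
  supported_on_uniq n K -> supported_on_uniq (n - p) (iter p contract K).
Proof.
elim: p => [|p IH] pn sK; first by rewrite subn0.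
rewrite iterS; apply: contract_supported.
by rewrite subnSK//; apply: IH => //; exact: ltnW.
Qed.

Lemma reduced_sum_orthogonal n m K K' :
  supported_on_uniq n K -> supported_on_uniq m K' ->
  phi (star (reduced_sum n K) * reduced_sum m K') =
  if n == m then tsum n (fun a => tsum n (fun b =>
    conjc (K a b) * K' a b * (weight a * weight b)%:C)) else 0.
Proof.
move=> sK sK'; rewrite /reduced_sum /tsum !star_sum mulr_suml linear_sum /=.
transitivity (\sum_(a : n.-tuple 'I_N) \sum_(b : n.-tuple 'I_N)
  \sum_(a' : m.-tuple 'I_N) \sum_(b' : m.-tuple 'I_N)
  if (tval a, tval b) == (tval a', tval b') then
    conjc (K a b) * K' a' b' * (weight a * weight b)%:C else 0).
  apply: eq_bigr => a _; rewrite star_sum mulr_suml linear_sum; apply: eq_bigr => b _.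
  rewrite /= mulr_sumr linear_sum; apply: eq_bigr => a' _.
  rewrite /= mulr_sumr linear_sum; apply: eq_bigr => b' _ /=.
  rewrite starZ -scalerAl -scalerAr !linearZ /= mulrA star_cheb_prod.
  have [->|/sK] := eqVneq (K a b) 0; first by rewrite conjc0 !mul0r if_same.
  rewrite !size_tuple => /(_ erefl erefl)/andP[ua ub].
  have [->|/sK'] := eqVneq (K' a' b') 0; first by rewrite !(mulr0, mul0r) if_same.
  rewrite !size_tuple => /(_ erefl erefl)/andP[ua' ub'].
  rewrite cheb_prod_orthogonal; [|by apply: reduced_alternating; rewrite ?size_tuple..].
  have -> : (reduced a b == reduced a' b') = ((tval a, tval b) == (tval a', tval b')).
    apply/eqP/eqP => [/reduced_inj|[-> ->]//]; apply; by rewrite !size_tuple.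
  by case: ifP => _; rewrite ?mulr0// prod_cheb_norm_reduced ?size_tuple.
case: eqVneq => [nm|nm]; last first.
  apply: big1 => a _; apply: big1 => b _; apply: big1 => a' _; apply: big1 => b' _.
  case: eqP => // -[/(congr1 size)]; rewrite !size_tuple => /eqP.
  by rewrite (negbTE nm).
case: m / nm K' sK' => K' sK'.
apply: eq_bigr => a _; apply: eq_bigr => b _.
rewrite (bigD1 a)//= (bigD1 b)//= eqxx !big1 ?addr0// => a' aa'.
  apply: big1 => b' _; case: eqP => // -[/val_inj E]; by rewrite E eqxx in aa'.
by case: eqP => // -[/val_inj E]; rewrite E eqxx in aa'.
Qed.

(** Each contraction strips one more letter from the middle, whence the reversed
    concatenation. *)
Lemma iter_contractE p K a b : iter p contract K a b =
  tsum p (fun s => (weight s)%:C * K (catrev s a) (catrev s b)).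
Proof.
elim: p a b => [|p IH] a b; first by rewrite tsum0 /weight big_nil mul1r.
rewrite iterS /contract tsumS; apply: eq_bigr => x _.
rewrite IH /tsum mulr_sumr; apply: eq_bigr => s _.
by rewrite weight_cons rmorphM -mulrA.
Qed.

(** The Wigner integral of the step function whose value on the cell of index [u]
    is [c u]. *)
Definition discrete_integral n (c : seq 'I_N -> R[i]) : A :=
  tsum n (fun u => c u *: word u).

Lemma star_word a : star (word a) = word (rev a).
Proof.
elim: a => [|i a IH]; first by rewrite /word !big_nil star1.
by rewrite word_cons starM IH word_rev_cons X_star.
Qed.

(** The terms of different [p] are orthogonal, because they are combinations of
    reduced words of different degrees. *)
Lemma tnorm2_discrete n (c d : seq 'I_N -> R[i]) :
  (forall u, size u = n -> c u != 0 -> uniq u) ->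
  (forall u, size u = n -> d u != 0 -> uniq u) ->
  tnorm2 (discrete_integral n c * star (discrete_integral n d)) =
  \sum_(p < n.+1) tsum (n - p) (fun u => tsum (n - p) (fun v =>
    Normc.normc (tsum p (fun s => (weight s)%:C * (c (u ++ s) * conjc (d (v ++ s))))) ^+ 2
    * (weight u * weight v))).
Proof.
move=> uc ud; pose K a b := c (rev a) * conjc (d (rev b)).
have sK : supported_on_uniq n K.
  move=> a b an bn; rewrite mulf_eq0 negb_or conjc_eq0 => /andP[].
  move=> /uc; rewrite size_rev rev_uniq => -> //.
  by move=> /ud; rewrite size_rev rev_uniq => -> //.
have sKp (p : 'I_n.+1) : supported_on_uniq (n - p) (iter p contract K).
  by apply: iter_contract_supported => //; exact: leq_ord.
have -> : discrete_integral n c * star (discrete_integral n d) = word_sum n K.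
  rewrite /discrete_integral /word_sum -(tsum_rev n (fun u => c u *: word u)).
  rewrite -(tsum_rev n (fun u => d u *: word u)) /tsum star_sum mulr_suml.
  apply: eq_bigr => a _; rewrite mulr_sumr; apply: eq_bigr => b _ /=.
  by rewrite starZ star_word revK -scalerAl -scalerAr scalerA.
apply: complexI; rewrite -trace_tnorm2 word_sum_reduced.
rewrite star_sum mulr_suml linear_sum rmorph_sum; apply: eq_bigr => p _ /=.
rewrite mulr_sumr linear_sum (bigD1 p)//= big1 ?addr0; last first.
  move=> q qp; rewrite reduced_sum_orthogonal; [|exact: sKp..].
  case: eqP => // pq; case/eqP: qp; apply: val_inj => /=.
  by have := ltn_ord p; have := ltn_ord q; lia.
rewrite reduced_sum_orthogonal; [|exact: sKp..].
rewrite eqxx -tsum_rev raddf_tsum; apply: eq_tsum => u _.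
rewrite /= -tsum_rev raddf_tsum; apply: eq_tsum => v _ /=.
rewrite iter_contractE.
have -> : tsum p (fun s => (weight s)%:C * K (catrev s (rev u)) (catrev s (rev v))) =
  tsum p (fun s => (weight s)%:C * (c (u ++ s) * conjc (d (v ++ s)))).
  by apply: eq_tsum => s _; rewrite /K !catrevE !rev_cat !revK.
have weight_rev a : weight (rev a) = weight a.
  by apply: perm_big; exact: permEl (perm_rev _).
rewrite !weight_rev [RHS]rmorphM; congr (_ * _).
by rewrite mulrC; exact/esym/sqr_normcC.
Qed.

End free_words.
(** * Lebesgue integration over tuples, through functions on sequences *)

Section tuple_integral.
Context {R : realType}.
Local Notation mR := (measurableTypeR R).
Local Notation leb := (@lebesgue_measure R).
Implicit Types (n m a b p : nat) (F G : seq R -> \bar R).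

(** A function on sequences stands for its restrictions to all the [R^n]; this
    spares the casts between [R^(a + b)] and [R^a * R^b]. *)
Definition mseq d (U : measurableType d) n (F : seq R -> U) :=
  measurable_fun [set: n.-tuple mR] (fun t => F t).

Definition tint n F : \bar R := (\int[lebesgue_tuple R n]_t F t)%E.

Lemma mseq_comp d (T : measurableType d) d' (U : measurableType d') m
    (F : seq R -> U) (g : T -> seq R) :
  (forall t, size (g t) = m) ->
  (forall i, (i < m)%N -> measurable_fun setT (fun t => nth 0 (g t) i : mR)) ->
  mseq m F -> measurable_fun setT (fun t => F (g t)).
Proof.
move=> sg mg mF; have sgP t : size (g t) == m by rewrite sg.
pose h t : m.-tuple mR := Tuple (sgP t).
apply: (measurableT_comp (f := fun t : m.-tuple mR => F t) mF (g := h)).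
apply/measurable_fun_tnthP => i /=.
by under eq_fun do rewrite (tnth_nth 0); exact: mg.
Qed.

Lemma measurable_nth n i : measurable_fun [set: n.-tuple mR] (fun t => nth 0 t i : mR).
Proof.
have [ni|ni] := leqP n i.
  by under eq_fun do rewrite nth_default ?size_tuple//; exact: measurable_cst.
have := @measurable_tnth _ mR n (Ordinal ni).
by under eq_fun do rewrite (tnth_nth 0).
Qed.

Lemma mseq_sel d (U : measurableType d) k (idx : seq nat) (F : seq R -> U) :
  mseq (size idx) F -> mseq k (fun s => F (map (nth 0 s) idx)).
Proof.
move=> mF; apply: mseq_comp mF => [t|i i_lt]; first by rewrite size_map.
by under eq_fun do rewrite (nth_map 0%N)//; exact: measurable_nth.
Qed.

Lemma eq_mseq d (U : measurableType d) n (F G : seq R -> U) :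
  (forall s, size s = n -> F s = G s) -> mseq n F -> mseq n G.
Proof.
by move=> FG mF; apply: eq_measurable_fun mF => t _; rewrite FG// size_tuple.
Qed.

Lemma measurable_cat a b d (U : measurableType d) (F : seq R -> U) :
  mseq (a + b) F ->
  measurable_fun setT (fun uv : (a.-tuple mR * b.-tuple mR)%type => F (uv.1 ++ uv.2)).
Proof.
move=> mF; apply: mseq_comp mF => [uv|i _]; first by rewrite size_cat !size_tuple.
rewrite (_ : (fun _ => _) = fun uv : (a.-tuple mR * b.-tuple mR)%type =>
    if (i < a)%N then nth 0 uv.1 i else nth 0 uv.2 (i - a)); last first.
  by apply/funext => uv; rewrite nth_cat size_tuple.
case: (i < a)%N.
  exact: (measurableT_comp (@measurable_nth a i)).
exact: (measurableT_comp (@measurable_nth b (i - a))).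
Qed.

Lemma measurable_consR n d (U : measurableType d) (F : seq R -> U) :
  mseq n.+1 F ->
  measurable_fun setT (fun uv : (mR * n.-tuple mR)%type => F (uv.1 :: uv.2)).
Proof.
move=> mF; apply: mseq_comp mF => [uv|[|i] _] /=; first by rewrite size_tuple.
  exact: measurable_fst.
by apply: (measurableT_comp (@measurable_nth n i)).
Qed.

Lemma mseq_cons n d (U : measurableType d) (F : seq R -> U) x :
  mseq n.+1 F -> mseq n (fun s => F (x :: s)).
Proof.
move=> mF; apply: mseq_comp mF => [t|[|i] _] /=; first by rewrite size_tuple.
  exact: measurable_cst.
exact: measurable_nth.
Qed.

Lemma mseq_catl a b d (U : measurableType d) (F : seq R -> U) u : size u = a ->
  mseq (a + b) F -> mseq b (fun s => F (u ++ s)).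
Proof.
move=> ua mF; apply: mseq_comp mF => [t|i _] /=; first by rewrite size_cat ua size_tuple.
under eq_fun do rewrite nth_cat.
by case: (i < size u)%N; [exact: measurable_cst|exact: measurable_nth].
Qed.

Lemma mseq_integral a b F : (forall s, (0 <= F s)%E) -> mseq (a + b) F ->
  mseq a (fun u => tint b (fun v => F (u ++ v))).
Proof.
move=> F0 mF; exact: (measurable_fun_fubini_tonelli_F (m2 := lebesgue_tuple R b)
  (fun uv : (a.-tuple mR * b.-tuple mR)%type => F (uv.1 ++ uv.2))
  (measurable_cat mF)).
Qed.

Lemma tint_ge0 n F : (forall s, (0 <= F s)%E) -> (0 <= tint n F)%E.
Proof. by move=> F0; apply: integral_ge0. Qed.

Lemma eq_tint n F G : (forall s, size s = n -> F s = G s) -> tint n F = tint n G.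
Proof. by move=> FG; apply: eq_integral => t _; rewrite FG// size_tuple. Qed.

Lemma tint0 F : mseq 0 F -> tint 0 F = F [::].
Proof. by move=> mF; rewrite /tint /= integral_dirac//= diracT mul1e. Qed.

Lemma tintS n F : (forall s, (0 <= F s)%E) -> mseq n.+1 F ->
  tint n.+1 F = (\int[leb]_x tint n (fun s => F (x :: s)))%E.
Proof.
move=> F0 mF; rewrite /tint /=.
have mc := @measurable_tuple_cons R n.
rewrite (@eq_measure_integral _ _ _ _
  (pushforward (leb \x lebesgue_tuple R n)%E (@tuple_cons R n)))//.
rewrite (ge0_integral_pushforward mc)//.
rewrite preimage_setT (fubini_tonelli1 (fun uv : (mR * n.-tuple mR)%type => F (uv.1 :: uv.2)))//.
exact: measurable_consR.
Qed.

Lemma tint_cat a b F : (forall s, (0 <= F s)%E) -> mseq (a + b) F ->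
  tint (a + b) F = tint a (fun u => tint b (fun v => F (u ++ v))).
Proof.
elim: a F => [|a IH] F F0 mF.
  by rewrite tint0//; apply: (mseq_integral (a := 0)).
rewrite addSn !tintS//; first last.
- exact: mseq_integral.
- by move=> s; exact: tint_ge0.
by apply: eq_integral => x _; rewrite IH//; exact: mseq_cons.
Qed.

Lemma mseq_rev d (U : measurableType d) n (F : seq R -> U) :
  mseq n F -> mseq n (fun s => F (rev s)).
Proof.
move=> mF; apply: mseq_comp mF => [t|i ni] /=; first by rewrite size_rev size_tuple.
by under eq_fun do rewrite nth_rev ?size_tuple//; exact: measurable_nth.
Qed.

(** By induction, the first variable of the reversed tuple being the last one of
    the tuple: Tonelli's theorem moves it across the others. *)
Lemma tint_rev n F : (forall s, (0 <= F s)%E) -> mseq n F ->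
  tint n (fun s => F (rev s)) = tint n F.
Proof.
elim: n F => [|n IH] F F0 mF.
  by rewrite !tint0//; exact: mseq_rev.
rewrite tintS//; last exact: mseq_rev.
have m1 : mseq (n + 1) F by rewrite addn1.
have mx x : mseq n (fun s => F (s ++ [:: x])).
  apply: mseq_comp m1 => [t|i _] /=; first by rewrite size_cat size_tuple.
  under eq_fun do rewrite nth_cat size_tuple.
  by case: (i < n)%N; [exact: measurable_nth|exact: measurable_cst].
transitivity (\int[leb]_x tint n (fun s => F (s ++ [:: x])))%E.
  apply: eq_integral => x _; rewrite -(IH (fun s => F (s ++ [:: x])))//.
  by apply: eq_tint => s _; rewrite rev_cons -cats1.
rewrite -[in RHS]addn1 tint_cat//.
rewrite /tint (fubini_tonelli (m1 := leb) (m2 := lebesgue_tuple R n)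
  (fun xs : (mR * n.-tuple mR)%type => F (xs.2 ++ [:: xs.1])))//; last first.
  apply: mseq_comp m1 => [t|i _] /=; first by rewrite size_cat size_tuple.
  rewrite (_ : (fun _ => _) = fun uv : (mR * n.-tuple mR)%type =>
      if (i < n)%N then nth 0 uv.2 i else nth 0 [:: uv.1] (i - n)); last first.
    by apply/funext => uv; rewrite nth_cat size_tuple.
  case: (i < n)%N; first exact: (measurableT_comp (@measurable_nth n i)).
  by case: (i - n)%N => [|[|k]] /=; [exact: measurable_fst|exact: measurable_cst..].
apply: eq_integral => t _; rewrite -/(tint 1 (fun v => F (t ++ v))) tintS//; last first.
  by apply: mseq_catl m1; rewrite size_tuple.
apply: eq_integral => x _; rewrite tint0//.
by apply: (@mseq_cons _ _ _ (fun s => F (t ++ s))); apply: mseq_catl m1; rewrite size_tuple.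
Qed.

Lemma le_tint n F G : (forall s, (0 <= F s)%E) -> mseq n F -> mseq n G ->
  (forall s, size s = n -> (F s <= G s)%E) -> (tint n F <= tint n G)%E.
Proof.
move=> F0 mF mG FG; apply: ge0_le_integral => //.
by move=> t _; rewrite FG// size_tuple.
Qed.

Lemma tintD n F G : (forall s, (0 <= F s)%E) -> (forall s, (0 <= G s)%E) ->
  mseq n F -> mseq n G ->
  tint n (fun s => F s + G s)%E = (tint n F + tint n G)%E.
Proof. by move=> F0 G0 mF mG; apply: ge0_integralD. Qed.

Lemma tintZl n (c : \bar R) F : (0 <= c)%E -> (forall s, (0 <= F s)%E) -> mseq n F ->
  tint n (fun s => c * F s)%E = (c * tint n F)%E.
Proof. by move=> c0 F0 mF; apply: ge0_integralZl. Qed.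

End tuple_integral.
(** * Contractions of square-integrable functions *)

Lemma poweR2 (R : realType) (x : \bar R) : (0 <= x)%E -> (x `^ 2 = x ^+ 2)%E.
Proof.
case: x => [r r0|_|//]; first by rewrite poweR_EFin powR_mulrn// EFin_expe.
by rewrite poweRyr// expe2 mulyy.
Qed.

Lemma Lnorm2_sqr d (T : measurableType d) (R : realType)
    (mu : {measure set T -> \bar R}) (f : T -> \bar R) :
  (Lnorm mu 2%:E f ^+ 2 = \int[mu]_x (`|f x| ^+ 2))%E.
Proof.
rewrite -poweR2 ?Lnorm_ge0// poweR_Lnorm//.
by apply: eq_integral => x _; rewrite poweR2.
Qed.

Section contractions.
Context {R : realType}.
Local Notation mR := (measurableTypeR R).
Local Notation leb := (@lebesgue_measure R).
Local Notation normc := Normc.normc.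
Implicit Types (n m a b p : nat) (F G H : seq R -> R[i]) (K : seq R -> seq R -> R[i]).

Lemma sqr_normcE (z : R[i]) : normc z ^+ 2 = complex.Re z ^+ 2 + complex.Im z ^+ 2.
Proof. by case: z => x y /=; rewrite sqr_sqrtr// addr_ge0// sqr_ge0. Qed.

Lemma mseq_muleC n (k : \bar R) (f : seq R -> \bar R) :
  mseq n f -> mseq n (fun s => k * f s)%E.
Proof. by move=> mf; exact: (measurable_funeM k mf). Qed.

Lemma mseq_adde n (f g : seq R -> \bar R) :
  mseq n f -> mseq n g -> mseq n (fun s => f s + g s)%E.
Proof. by move=> mf mg; exact: (emeasurable_funD mf mg). Qed.

Definition cmseq n F :=
  mseq n (fun s => complex.Re (F s) : mR) /\ mseq n (fun s => complex.Im (F s) : mR).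

Definition sqn F (s : seq R) : \bar R := (normc (F s) ^+ 2)%:E.

Definition norm2 n F : \bar R := tint n (sqn F).

Definition cint p F : R[i] :=
  (\int[lebesgue_tuple R p]_t complex.Re (F t))
  +i* (\int[lebesgue_tuple R p]_t complex.Im (F t)).

(** The kernel of the contraction of [F] with the adjoint of [H]; its second
    variable is listed in the order of the arguments of [H]. *)
Definition ckernel p F H (u v : seq R) : R[i] :=
  cint p (fun s => F (u ++ s) * conjc (H (v ++ s))).

Definition kernel2 a K : \bar R := tint a (fun u => tint a (fun v => sqn (K u) v)).

Definition cmkernel a K := cmseq (a + a) (fun t => K (take a t) (drop a t)).

Lemma sqn_ge0 F s : (0 <= sqn F s)%E.
Proof. by rewrite lee_fin sqr_ge0. Qed.

Lemma cmseqM n F G : cmseq n F -> cmseq n G -> cmseq n (fun s => F s * G s).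
Proof.
move=> [rF iF] [rG iG]; split.
  have : mseq n (fun s => complex.Re (F s) * complex.Re (G s) - complex.Im (F s) * complex.Im (G s) : mR).
    exact: measurable_funB (measurable_funM rF rG) (measurable_funM iF iG).
  by apply: eq_mseq => s _; case: (F s) => ? ?; case: (G s).
have : mseq n (fun s => complex.Re (F s) * complex.Im (G s) + complex.Im (F s) * complex.Re (G s) : mR).
  exact: measurable_funD (measurable_funM rF iG) (measurable_funM iF rG).
by apply: eq_mseq => s _; case: (F s) => ? ?; case: (G s).
Qed.

Lemma cmseqB n F G : cmseq n F -> cmseq n G -> cmseq n (fun s => F s - G s).
Proof.
move=> [rF iF] [rG iG]; split.
  have : mseq n (fun s => complex.Re (F s) - complex.Re (G s) : mR) by exact: measurable_funB.
  by apply: eq_mseq => s _; case: (F s) => ? ?; case: (G s).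
have : mseq n (fun s => complex.Im (F s) - complex.Im (G s) : mR) by exact: measurable_funB.
by apply: eq_mseq => s _; case: (F s) => ? ?; case: (G s).
Qed.

Lemma cmseq_conj n F : cmseq n F -> cmseq n (fun s => conjc (F s)).
Proof.
move=> [rF iF]; split.
  by apply: eq_mseq rF => s _; case: (F s).
have : mseq n (fun s => - complex.Im (F s) : mR) by exact: measurable_funN.
by apply: eq_mseq => s _; case: (F s).
Qed.

Lemma cmseq_sel k (idx : seq nat) F : cmseq (size idx) F ->
  cmseq k (fun s => F (map (nth 0 s) idx)).
Proof. by move=> [rF iF]; split; [exact: mseq_sel rF|exact: mseq_sel iF]. Qed.

Lemma eq_cmseq n F G : (forall s, size s = n -> F s = G s) -> cmseq n F -> cmseq n G.
Proof.
by move=> FG [rF iF]; split; [apply: eq_mseq rF|apply: eq_mseq iF] => s sn; rewrite FG.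
Qed.

Lemma cmseq_catl a b F u : size u = a -> cmseq (a + b) F -> cmseq b (fun s => F (u ++ s)).
Proof. by move=> ua [rF iF]; split; [exact: mseq_catl ua rF|exact: mseq_catl ua iF]. Qed.

Lemma mseq_sqn n F : cmseq n F -> mseq n (sqn F).
Proof.
move=> [rF iF]; have key : mseq n (fun s => normc (F s) ^+ 2 : mR).
  have : mseq n (fun s => complex.Re (F s) ^+ 2 + complex.Im (F s) ^+ 2 : mR).
    exact: measurable_funD (measurable_funX 2 rF) (measurable_funX 2 iF).
  by apply: eq_mseq => s _; rewrite sqr_normcE.
exact/measurable_EFinP.
Qed.

Lemma mseq_Rintegral a b (g : seq R -> mR) : mseq (a + b) g ->
  mseq a (fun u => \int[lebesgue_tuple R b]_t g (u ++ t) : mR).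
Proof.
move=> mg; rewrite /Rintegral.
apply: (measurableT_comp (@fine_measurable R setT measurableT)).
have mg' : mseq (a + b) (fun s => (g s)%:E) by apply/measurable_EFinP.
have mgN : mseq (a + b) (fun s => (- g s)%:E) by exact/measurable_EFinP/measurable_funN.
rewrite (_ : (fun _ => _) = fun t : a.-tuple mR =>
   (tint b (fun s => maxe (g (t ++ s))%:E 0) - tint b (fun s => maxe (- g (t ++ s))%:E 0))%E).
  apply: emeasurable_funB.
    apply: (mseq_integral (F := fun s => maxe (g s)%:E 0%E)).
      by move=> s; rewrite le_max lexx orbT.
    exact: measurable_maxe.
  apply: (mseq_integral (F := fun s => maxe (- g s)%:E 0%E)).
    by move=> s; rewrite le_max lexx orbT.
  exact: measurable_maxe.
apply/funext => t; rewrite integralE; congr (_ - _)%E.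
  by apply: eq_integral => s _; rewrite unlock.
by apply: eq_integral => s _; rewrite unlock.
Qed.

Lemma cmkernel_ckernel a p F H : cmseq (a + p) F -> cmseq (a + p) H ->
  cmkernel a (ckernel p F H).
Proof.
move=> mF mH.
pose g s := F (take a s ++ drop (a + a) s) * conjc (H (drop a (take (a + a) s) ++ drop (a + a) s)).
have mg : cmseq (a + a + p) g.
  apply: cmseqM.
    have := @cmseq_sel (a + a + p) (iota 0 a ++ iota (a + a) p) F.
    rewrite size_cat !size_iota => /(_ mF); apply: eq_cmseq => s ss.
    by rewrite map_cat !map_nth_iota ?drop0 ?ss ?leq_addr// ?[take p _]take_oversize ?size_drop ?ss//; lia.
  apply: cmseq_conj.
  have := @cmseq_sel (a + a + p) (iota a a ++ iota (a + a) p) H.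
  rewrite size_cat !size_iota => /(_ mH); apply: eq_cmseq => s ss.
  rewrite map_cat !map_nth_iota ?ss; try lia.
  by rewrite -take_drop ?[take p _]take_oversize ?size_drop ?ss//; lia.
have gE (t s : seq R) : size t = (a + a)%N ->
    g (t ++ s) = F (take a t ++ s) * conjc (H (drop a t ++ s)).
  move=> ta; have le_a : (a <= size t)%N by rewrite ta leq_addr.
  by rewrite /g (takel_cat _ le_a) -ta drop_size_cat// take_size_cat.
split.
  have := mseq_Rintegral mg.1; apply: eq_mseq => t ta.
  by rewrite /=; apply: eq_Rintegral => s _; rewrite gE.
have := mseq_Rintegral mg.2; apply: eq_mseq => t ta.
by rewrite /=; apply: eq_Rintegral => s _; rewrite gE.
Qed.

Lemma abse_Rintegral n (g : seq R -> mR) : mseq n g ->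
  (`|(\int[lebesgue_tuple R n]_t g t)%:E| <= \int[lebesgue_tuple R n]_t (`|g t|)%:E)%E.
Proof.
move=> mg; have mg' : mseq n (fun s => (g s)%:E) by exact/measurable_EFinP.
have := le_abse_integral (lebesgue_tuple R n) measurableT mg'.
apply: le_trans; rewrite /Rintegral.
by case: (integral _ _ _) => [r| |] /=; rewrite ?lexx ?leey.
Qed.

(** The factor [2] is the price for bounding the real and the imaginary part of
    the integral separately. *)
Lemma cauchy_schwarz_cint p F H : cmseq p F -> cmseq p H ->
  ((normc (cint p (fun s => F s * conjc (H s))) ^+ 2)%:E
   <= 2%:E * (norm2 p F * norm2 p H))%E.
Proof.
move=> mF mH; pose G s := F s * conjc (H s).
have mG : cmseq p G by apply: cmseqM => //; exact: cmseq_conj.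
have mn F' : cmseq p F' -> mseq p (fun s => normc (F' s) : mR).
  move=> [rF iF]; have : mseq p (fun s => Num.sqrt (complex.Re (F' s) ^+ 2 + complex.Im (F' s) ^+ 2) : mR).
    apply: (measurableT_comp (f := @Num.sqrt R)); last first.
      exact: measurable_funD (measurable_funX 2 rF) (measurable_funX 2 iF).
    by apply: continuous_measurable_fun; exact: sqrt_continuous.
  by apply: eq_mseq => s _; case: (F' s).
pose I := (\int[lebesgue_tuple R p]_t (normc (G t))%:E)%E.
have I0 : (0 <= I)%E by apply: integral_ge0 => t _; rewrite lee_fin normc_ge0.
have sqI (g : seq R -> mR) : mseq p g -> (forall s, `|g s| <= normc (G s)) ->
    (((\int[lebesgue_tuple R p]_t g t) ^+ 2)%:E <= I * I)%E.
  move=> mg gG.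
  have := abse_Rintegral mg; set r := \int[_]_t _ => h.
  have {h} : (`|r%:E| <= I)%E.
    apply: le_trans h _; apply: ge0_le_integral => //.
    - exact/measurable_EFinP/measurableT_comp.
    - by apply/measurable_EFinP; exact: mn.
    - by move=> t _; rewrite lee_fin.
  move=> h; have : (`|r%:E| * `|r%:E| <= I * I)%E by apply: lee_pmul.
  by rewrite -abseM -EFinM -expr2 gee0_abs// lee_fin sqr_ge0.
have le2 : ((normc (cint p G) ^+ 2)%:E <= 2%:E * (I * I))%E.
  rewrite sqr_normcE EFinD mule_natl mule2n /=; apply: leeD.
    by apply: (sqI (fun s => complex.Re (G s)) mG.1) => s; exact: Re_le_normc.
  apply: (sqI (fun s => complex.Im (G s)) mG.2) => s; case: (G s) => x y /=.
  by rewrite -[leLHS]sqrtr_sqr ler_wsqrtr// lerDr sqr_ge0.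
apply: le_trans le2 _; rewrite lee_pmul2l//.
have h2 : 2^-1 + 2^-1 = 1 :> R by rewrite [RHS]splitr !div1r.
have := @hoelder _ _ _ (lebesgue_tuple R p) (fun t => normc (F t)) (fun t => normc (H t))
  2 2 (mn _ mF) (mn _ mH) (ltr0Sn _ 1) (ltr0Sn _ 1) h2.
rewrite Lnorm1.
set NF := Lnorm _ _ _; set NH := Lnorm _ _ _ => h.
have Nsq F' : cmseq p F' ->
    (Lnorm (lebesgue_tuple R p) 2%:E (fun t : p.-tuple mR => (normc (F' t))%:E) ^+ 2 = norm2 p F')%E.
  move=> mF'; rewrite Lnorm2_sqr; apply: eq_integral => t _.
  by rewrite /= ger0_norm ?normc_ge0// -EFin_expe.
rewrite -(Nsq F)// -(Nsq H)//.
have -> : (NF ^+ 2 * NH ^+ 2 = (NF * NH) * (NF * NH))%E.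
  by rewrite !expe2 muleACA.
suff IN : (I <= NF * NH)%E by exact: lee_pmul.
apply: le_trans h; apply: ge0_le_integral => //.
- by move=> t _; rewrite lee_fin normc_ge0.
- by apply/measurable_EFinP; exact: mn.
- apply/measurable_EFinP; apply: measurableT_comp => //.
  exact: measurable_funM (mn _ mF) (mn _ mH).
- move=> t _; rewrite lee_fin /G Normc.normcM ger0_norm ?mulr_ge0 ?normc_ge0//.
  by rewrite (_ : normc (conjc (H t)) = normc (H t))//; case: (H t) => x y /=; rewrite sqrrN.
Qed.

Lemma ae_mono n (P Q : n.-tuple mR -> Prop) : (forall t, P t -> Q t) ->
  {ae lebesgue_tuple R n, forall t, P t} -> {ae lebesgue_tuple R n, forall t, Q t}.
Proof.
move=> PQ [N [mN N0 PN]]; exists N; split => // t /= nQ; apply: PN => /= Pt.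
exact/nQ/PQ.
Qed.

Lemma ae_mono2 n (P Q S : n.-tuple mR -> Prop) : (forall t, P t -> Q t -> S t) ->
  {ae lebesgue_tuple R n, forall t, P t} -> {ae lebesgue_tuple R n, forall t, Q t} ->
  {ae lebesgue_tuple R n, forall t, S t}.
Proof.
move=> PQS [N [mN N0 PN]] [M [mM M0 QM]]; exists (N `|` M); split.
- exact: measurableU.
- by apply/null_set_setU.
move=> t /= nS; have [Pt|nP] := pselect (P t); last by left; exact: PN.
by right; apply: QM => /= Qt; apply: nS; exact: PQS.
Qed.

Lemma cmkernel_section a K u : size u = a -> cmkernel a K -> cmseq a (K u).
Proof.
move=> ua mK; apply: eq_cmseq (cmseq_catl ua mK) => v _.
by rewrite -ua take_size_cat// drop_size_cat.
Qed.

Lemma sqn_kernel_cat a K u v : size u = a ->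
  sqn (fun t => K (take a t) (drop a t)) (u ++ v) = sqn (K u) v.
Proof. by move=> ua; rewrite /sqn -ua take_size_cat// drop_size_cat. Qed.

Lemma mseq_kernel a K : cmkernel a K -> mseq a (fun u => tint a (sqn (K u))).
Proof.
move=> /mseq_sqn mK; have := mseq_integral (fun s => sqn_ge0 _ s) mK.
by apply: eq_mseq => u ua; apply: eq_tint => v _; rewrite sqn_kernel_cat.
Qed.

Lemma kernel2E a K : cmkernel a K ->
  kernel2 a K = norm2 (a + a) (fun t => K (take a t) (drop a t)).
Proof.
move=> /mseq_sqn mK; rewrite /norm2 (tint_cat (sqn_ge0 _) mK).
by apply: eq_tint => u ua; apply: eq_tint => v _; rewrite sqn_kernel_cat.
Qed.

Lemma norm2_ge0 n F : (0 <= norm2 n F)%E.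
Proof. by apply: tint_ge0 => s; exact: sqn_ge0. Qed.

Lemma kernel2_ge0 a K : (0 <= kernel2 a K)%E.
Proof. by apply: tint_ge0 => s; exact: norm2_ge0. Qed.

Lemma norm2_cat a p F : cmseq (a + p) F ->
  norm2 (a + p) F = tint a (fun u => norm2 p (fun s => F (u ++ s))).
Proof. by move=> /mseq_sqn mF; apply: tint_cat => // s; exact: sqn_ge0. Qed.

Lemma mseq_fiber a p F : cmseq (a + p) F ->
  mseq a (fun u => norm2 p (fun s => F (u ++ s))).
Proof. by move=> /mseq_sqn; exact: (mseq_integral (sqn_ge0 F)). Qed.

(** Cauchy-Schwarz on the fibres over [u] and [v], then integration over both. *)
Lemma kernel2_ckernel_le a p F H : cmseq (a + p) F -> cmseq (a + p) H ->
  (kernel2 a (ckernel p F H) <= 2%:E * (norm2 (a + p) F * norm2 (a + p) H))%E.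
Proof.
move=> mF mH; have mK := cmkernel_ckernel mF mH.
pose A u := norm2 p (fun s => F (u ++ s)); pose B v := norm2 p (fun s => H (v ++ s)).
have A0 u : (0 <= A u)%E := norm2_ge0 _ _; have B0 u : (0 <= B u)%E := norm2_ge0 _ _.
have mA : mseq a A := mseq_fiber mF; have mB : mseq a B := mseq_fiber mH.
apply: (@le_trans _ _ (tint a (fun u => 2%:E * (norm2 (a + p) H * A u)))%E).
  apply: le_tint.
  - by move=> u; exact: norm2_ge0.
  - exact: mseq_kernel.
  - exact: (mseq_muleC _ (mseq_muleC _ mA)).
  move=> u ua.
  have -> : (2%:E * (norm2 (a + p) H * A u) = tint a (fun v => 2%:E * A u * B v))%E.
    by rewrite tintZl ?mule_ge0// (norm2_cat mH) -muleA (muleC (A u)).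
  apply: le_tint.
  - by move=> v; exact: sqn_ge0.
  - by apply: mseq_sqn; exact: cmkernel_section mK.
  - exact: mseq_muleC.
  move=> v va; rewrite /sqn /ckernel -muleA.
  exact: cauchy_schwarz_cint (cmseq_catl ua mF) (cmseq_catl va mH).
rewrite tintZl//; first last.
- exact: mseq_muleC.
- by move=> u; rewrite mule_ge0 ?norm2_ge0.
by rewrite tintZl ?norm2_ge0// muleA (norm2_cat mF) -/(A _) -muleA [X in (_ <= _ * X)%E]muleC.
Qed.

(** The free parameter makes up for Minkowski's inequality: letting [e] tend to
    [0] after the second term gives the continuity of the norm. *)
Lemma sqr_normcD_le (e : R) (z w : R[i]) : 0 < e ->
  normc (z + w) ^+ 2 <= (1 + e) * normc z ^+ 2 + (1 + e^-1) * normc w ^+ 2.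
Proof.
move=> e0; rewrite !sqr_normcE; case: z => a b; case: w => c d /=.
have key x y : (x + y) ^+ 2 <= (1 + e) * x ^+ 2 + (1 + e^-1) * y ^+ 2.
  rewrite -subr_ge0.
  have -> : (1 + e) * x ^+ 2 + (1 + e^-1) * y ^+ 2 - (x + y) ^+ 2 = e * (x - y / e) ^+ 2.
    by field; rewrite gt_eqF.
  by rewrite mulr_ge0 ?sqr_ge0// ltW.
by have := key a c; have := key b d; lra.
Qed.

Lemma norm2_le (e : R) n F G : 0 < e -> cmseq n F -> cmseq n G ->
  (norm2 n F <= (1 + e)%:E * norm2 n G + (1 + e^-1)%:E * norm2 n (fun s => F s - G s)%R)%E.
Proof.
move=> e0 mF mG; have mD := cmseqB mF mG.
have e1 : 0 <= 1 + e by rewrite addr_ge0// ltW.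
have e2 : 0 <= 1 + e^-1 by rewrite addr_ge0// invr_ge0 ltW.
rewrite /norm2 -!tintZl ?lee_fin//; try exact: sqn_ge0; try exact: mseq_sqn.
rewrite -tintD; first last.
- by apply: mseq_muleC; exact: mseq_sqn.
- by apply: mseq_muleC; exact: mseq_sqn.
- by move=> s; rewrite mule_ge0 ?sqn_ge0.
- by move=> s; rewrite mule_ge0 ?sqn_ge0.
apply: le_tint.
- exact: sqn_ge0.
- exact: mseq_sqn.
- by apply: mseq_adde; apply: mseq_muleC; exact: mseq_sqn.
move=> s _; rewrite /sqn -!EFinM -EFinD lee_fin -{1}[F s](subrK (G s)) addrC.
exact: sqr_normcD_le.
Qed.

Lemma cmkernelB a K K' : cmkernel a K -> cmkernel a K' ->
  cmkernel a (fun u v => K u v - K' u v).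
Proof. exact: cmseqB. Qed.

Lemma kernel2_le (e : R) a K K' : 0 < e -> cmkernel a K -> cmkernel a K' ->
  (kernel2 a K <= (1 + e)%:E * kernel2 a K'
                  + (1 + e^-1)%:E * kernel2 a (fun u v => K u v - K' u v)%R)%E.
Proof.
move=> e0 mK mK'; rewrite !kernel2E//; last exact: cmkernelB.
exact: norm2_le.
Qed.

Lemma le_tint_ae n (B : seq R -> Prop) (F G : seq R -> \bar R) :
  (forall s, (0 <= F s)%E) -> (forall s, (0 <= G s)%E) -> mseq n F -> mseq n G ->
  {ae lebesgue_tuple R n, forall t, B (tval t)} ->
  (forall s, size s = n -> B s -> (F s <= G s)%E) -> (tint n F <= tint n G)%E.
Proof.
move=> F0 G0 mF mG aeB FG; apply: ae_ge0_le_integral => //.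
by apply: ae_mono aeB => t Bt _; apply: FG; rewrite ?size_tuple.
Qed.

Lemma ae_fiber_finite a p F : cmseq (a + p) F -> (norm2 (a + p) F < +oo)%E ->
  {ae lebesgue_tuple R a, forall t, (norm2 p (fun s => F (tval t ++ s)) < +oo)%E}.
Proof.
move=> mF Foo.
have /integrable_ae : (lebesgue_tuple R a).-integrable setT
    (fun t : a.-tuple mR => norm2 p (fun s => F (t ++ s))).
  apply/integrableP; split; first exact: mseq_fiber.
  rewrite (eq_integral (fun t : a.-tuple mR => norm2 p (fun s => F (t ++ s)))).
    by rewrite norm2_cat in Foo.
  by move=> t _; rewrite gee0_abs// norm2_ge0.
move=> /(_ measurableT); apply: ae_mono => t /(_ I).
by rewrite ge0_fin_numE// norm2_ge0.
Qed.

Definition cintegrable p F :=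
  (lebesgue_tuple R p).-integrable setT (fun t : p.-tuple mR => (complex.Re (F t))%:E) /\
  (lebesgue_tuple R p).-integrable setT (fun t : p.-tuple mR => (complex.Im (F t))%:E).

Lemma cintegrable_mul p F H : cmseq p F -> cmseq p H ->
  (norm2 p F < +oo)%E -> (norm2 p H < +oo)%E ->
  cintegrable p (fun s => F s * conjc (H s)).
Proof.
move=> mF mH Foo Hoo.
have mFH : cmseq p (fun s => F s * conjc (H s)) by apply: cmseqM => //; exact: cmseq_conj.
have key (g : seq R -> mR) : mseq p g ->
    (forall s, `|g s| <= normc (F s * conjc (H s))) ->
    (lebesgue_tuple R p).-integrable setT (fun t : p.-tuple mR => (g t)%:E).
  move=> mg gle; apply/integrableP; split; first exact/measurable_EFinP.
  apply: (@le_lt_trans _ _ (tint p (fun s => sqn F s + sqn H s)%E)).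
    apply: ge0_le_integral => //.
    - by apply: measurableT_comp => //; exact/measurable_EFinP.
    - exact: (mseq_adde (mseq_sqn mF) (mseq_sqn mH)).
    move=> t _; rewrite /sqn -EFinD lee_fin (le_trans (gle _))// Normc.normcM.
    rewrite (_ : normc (conjc (H t)) = normc (H t)); last first.
      by case: (H t) => x y /=; rewrite sqrrN.
    have := sqr_ge0 (normc (F t) - normc (H t)); rewrite sqrrB.
    have := normc_ge0 (F t); have := normc_ge0 (H t).
    move: (normc (F t)) (normc (H t)) => x y x0 y0 h; nra.
  rewrite (tintD (sqn_ge0 F) (sqn_ge0 H) (mseq_sqn mF) (mseq_sqn mH)).
  exact: lte_add_pinfty.
split.
  by apply: (key (fun s => complex.Re (F s * conjc (H s))) mFH.1) => s; exact: Re_le_normc.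
apply: (key (fun s => complex.Im (F s * conjc (H s))) mFH.2) => s.
case: (F s * _) => x y /=.
by rewrite -[leLHS]sqrtr_sqr ler_wsqrtr// lerDr sqr_ge0.
Qed.

Lemma cintB p F G : cintegrable p F -> cintegrable p G ->
  cint p (fun s => F s - G s) = cint p F - cint p G.
Proof.
move=> [rF iF] [rG iG]; apply/eqP; rewrite eq_complex /=; apply/andP; split.
  rewrite -RintegralB//; apply/eqP; apply: eq_Rintegral => t _.
  by case: (F t) => ? ?; case: (G t).
rewrite -RintegralB//; apply/eqP; apply: eq_Rintegral => t _.
by case: (F t) => ? ?; case: (G t).
Qed.

(** The contractions of [F] and of [G] differ by the contractions of [F] with
    [F - G] and of [F - G] with [G].  This holds only where the integrals converge,
    that is for almost every [u] and [v]: those over which the fibres of [F] and [G]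
    are square integrable. *)
Lemma kernel2_diff_le a p F G : cmseq (a + p) F -> cmseq (a + p) G ->
  (norm2 (a + p) F < +oo)%E -> (norm2 (a + p) G < +oo)%E ->
  (kernel2 a (fun u v => ckernel p F F u v - ckernel p G G u v)%R <=
   4%:E * (norm2 (a + p) F + norm2 (a + p) G) * norm2 (a + p) (fun s => F s - G s)%R)%E.
Proof.
move=> mF mG Foo Goo; have mD := cmseqB mF mG.
pose D s := F s - G s; pose K u v := ckernel p F F u v - ckernel p G G u v.
have mK : cmkernel a K by apply: cmkernelB; exact: cmkernel_ckernel.
pose K1 := ckernel p F D; pose K2 := ckernel p D G.
have mK1 : cmkernel a K1 by exact: cmkernel_ckernel.
have mK2 : cmkernel a K2 by exact: cmkernel_ckernel.
pose good u := ((norm2 p (fun s => F (u ++ s)) < +oo) /\ (norm2 p (fun s => G (u ++ s)) < +oo))%E.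
have aegood : {ae lebesgue_tuple R a, forall t, good (tval t)}.
  have := ae_fiber_finite mF Foo; have := ae_fiber_finite mG Goo.
  by apply: ae_mono2 => t ? ?; split.
have KE u v : size u = a -> size v = a -> good u -> good v -> K u v = K1 u v + K2 u v.
  move=> ua va [Fu Gu] [Fv Gv].
  have mFu := cmseq_catl ua mF; have mGu := cmseq_catl ua mG.
  have mFv := cmseq_catl va mF; have mGv := cmseq_catl va mG.
  have iFF := cintegrable_mul mFu mFv Fu Fv; have iFG := cintegrable_mul mFu mGv Fu Gv.
  have iGG := cintegrable_mul mGu mGv Gu Gv.
  have -> : K1 u v = ckernel p F F u v - ckernel p F G u v.
    rewrite -cintB//; congr cint; apply/funext => s.
    by rewrite /D rmorphB mulrBr.
  have -> : K2 u v = ckernel p F G u v - ckernel p G G u v.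
    rewrite -cintB//; congr cint; apply/funext => s.
    by rewrite /D mulrBl.
  by rewrite addrA subrK.
have c2 : (0 <= 2%:E :> \bar R)%E by rewrite lee_fin.
apply: (@le_trans _ _ (2%:E * kernel2 a K1 + 2%:E * kernel2 a K2)%E); last first.
  have h1 := kernel2_ckernel_le mF mD; have h2 := kernel2_ckernel_le mD mG.
  apply: le_trans (leeD (lee_wpmul2l c2 h1) (lee_wpmul2l c2 h2)) _.
  move: (norm2_ge0 (a + p) F) (norm2_ge0 (a + p) G).
  move: (norm2 _ F) (norm2 _ G) (norm2 _ D) => x y z x0 y0.
  rewrite (muleC z) !muleA -!EFinM -ge0_muleDl ?mule_ge0 ?lee_fin//.
  by rewrite -ge0_muleDr// (_ : 2 * 2 = 4)// -natrM.
have mJ L : cmkernel a L -> mseq a (fun u => 2%:E * norm2 a (L u))%E.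
  by move=> mL; exact: mseq_muleC (mseq_kernel mL).
have n0 (L : seq R -> seq R -> R[i]) u : (0 <= 2%:E * norm2 a (L u))%E by exact: mule_ge0 (norm2_ge0 _ _).
have kZ L : cmkernel a L -> (2%:E * kernel2 a L = tint a (fun u => 2%:E * norm2 a (L u)))%E.
  by move=> mL; exact: esym (tintZl c2 (fun u => norm2_ge0 a (L u)) (mseq_kernel mL)).
have kE := etrans (f_equal2 adde (kZ _ mK1) (kZ _ mK2))
  (esym (tintD (n0 K1) (n0 K2) (mJ _ mK1) (mJ _ mK2))).
apply: le_trans (eq_ind _ (fun z => (z <= _)%E) (lexx _) _ kE).
apply: (le_tint_ae (B := good) (fun u => norm2_ge0 a (K u))
  (fun u => adde_ge0 (n0 K1 u) (n0 K2 u)) (mseq_kernel mK)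
  (mseq_adde (mJ _ mK1) (mJ _ mK2)) aegood) => u ua gu.
have mLu L : cmkernel a L -> mseq a (sqn (L u)).
  by move=> mL; exact: mseq_sqn (cmkernel_section ua mL).
have m2 L : cmkernel a L -> mseq a (fun v => 2%:E * sqn (L u) v)%E.
  by move=> mL; exact: mseq_muleC (mLu _ mL).
have s0 (L : seq R -> seq R -> R[i]) v : (0 <= 2%:E * sqn (L u) v)%E by exact: mule_ge0 (sqn_ge0 _ _).
have nZ L : cmkernel a L -> (2%:E * norm2 a (L u) = tint a (fun v => 2%:E * sqn (L u) v))%E.
  by move=> mL; exact: esym (tintZl c2 (sqn_ge0 (L u)) (mLu _ mL)).
have nE := etrans (f_equal2 adde (nZ _ mK1) (nZ _ mK2))
  (esym (tintD (s0 K1) (s0 K2) (m2 _ mK1) (m2 _ mK2))).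
apply: le_trans (eq_ind _ (fun z => (z <= _)%E) (lexx _) _ nE).
apply: (le_tint_ae (B := good) (sqn_ge0 (K u))
  (fun v => adde_ge0 (s0 K1 v) (s0 K2 v)) (mLu _ mK)
  (mseq_adde (m2 _ mK1) (m2 _ mK2)) aegood) => v va gv.
rewrite /sqn -!EFinM -EFinD lee_fin (KE _ _ ua va gu gv).
by have := sqr_normcD_le (K1 u v) (K2 u v) ltr01; rewrite invr1.
Qed.

End contractions.
(** * Step functions on a grid *)

Section grid.
Context {R : realType} (tau : nat -> R) (N : nat).
Local Notation mR := (measurableTypeR R).
Local Notation leb := (@lebesgue_measure R).
Local Notation normc := Normc.normc.
Hypothesis tau_lt : forall i, (i < N)%N -> tau i < tau i.+1.

Lemma grid_mono i j : (i <= N)%N -> (j <= N)%N -> (tau i < tau j) = (i < j)%N.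
Proof.
have lt_tau a b : (a < b)%N -> (b <= N)%N -> tau a < tau b.
  elim: b => // b IH; rewrite ltnS leq_eqVlt => /predU1P[->|ab] bN; first exact: tau_lt.
  by rewrite (lt_trans (IH ab (ltnW bN)))// tau_lt.
move=> iN jN; case: (ltngtP i j) => [ij|ji|->]; last by rewrite ltxx.
  exact: lt_tau.
by apply/negbTE; rewrite -leNgt ltW// lt_tau.
Qed.

Lemma grid_le i j : (i <= N)%N -> (j <= N)%N -> (tau i <= tau j) = (i <= j)%N.
Proof. by move=> iN jN; rewrite leNgt grid_mono// -leqNgt. Qed.

Definition gridpoint (x : R) := exists2 i, (i <= N)%N & x = tau i.

Definition cell (x : R) : option 'I_N := [pick k : 'I_N | tau k <= x < tau k.+1].

Lemma cellP (x : R) (k : 'I_N) : cell x = Some k <-> tau k <= x < tau k.+1.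
Proof.
rewrite /cell; case: pickP => [j /andP[jx xj]|none]; split => //.
- by move=> [<-]; rewrite jx.
- move=> /andP[kx xk]; congr Some; apply: val_inj; apply/eqP; rewrite eqn_leq.
  have jN := ltn_ord j; have kN := ltn_ord k.
  have := le_lt_trans jx xk; rewrite grid_mono ?(ltnW jN)// ltnS => ->.
  by have := le_lt_trans kx xj; rewrite grid_mono ?(ltnW kN)// ltnS => ->.
- by move=> h; have := none k; rewrite h.
Qed.

Lemma cell_None_right (x : R) i j : cell x = None -> (i <= j)%N -> (j <= N)%N ->
  tau i <= x -> tau j <= x.
Proof.
move=> xN; elim: j => [|j IH]; first by rewrite leqn0 => /eqP ->.
rewrite leq_eqVlt => /predU1P[->//|ij] jN ix; rewrite leNgt; apply/negP => xj.
have : cell x = Some (Ordinal jN) by apply/cellP; rewrite IH// ltnW.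
by rewrite xN.
Qed.

(** This is what turns a step function with vertices on the grid into a function
    of the cells of the coordinates. *)
Lemma between_gridpoints (a b x : R) : gridpoint a -> gridpoint b ->
  (a <= x < b) = (if cell x is Some k then a <= tau k < b else false).
Proof.
move=> [i iN ->] [j jN ->]; case cx : (cell x) => [k|].
  have /andP[kx xk] := (cellP x k).1 cx; have kN := ltn_ord k.
  rewrite grid_le ?(ltnW kN)// grid_mono ?(ltnW kN)//; apply/andP/andP => -[h1 h2].
    have := le_lt_trans h1 xk; rewrite grid_mono// ltnS => ->.
    by have := le_lt_trans kx h2; rewrite grid_mono ?(ltnW kN)// ltnS => ->.
  split; first by rewrite (le_trans _ kx)// grid_le// ltnW.
  by rewrite (lt_le_trans xk)// grid_le.
apply/negbTE/negP => /andP[ix xj]; have := le_lt_trans ix xj.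
rewrite grid_mono// => /ltnW ij.
by have := cell_None_right cx ij jN ix; rewrite leNgt xj.
Qed.

Definition grid_weight (k : 'I_N) : R := tau k.+1 - tau k.

Lemma measurable_cell (o : option 'I_N) : measurable [set x : mR | cell x = o].
Proof.
have mS k : measurable [set x : mR | cell x = Some k].
  rewrite (_ : mkset _ = `[tau k, tau k.+1[%classic); first exact: measurable_itv.
  by apply/seteqP; split => x /=; rewrite in_itv /= => /cellP.
case: o => [k|]; first exact: mS.
rewrite (_ : mkset _ = ~` \bigcup_(k in [set: 'I_N]) [set x : mR | cell x = Some k]).
  apply: measurableC; apply: fin_bigcup_measurable => //; exact: finite_finset.
apply/seteqP; split => x /= cx; first by move=> [k _ /=]; rewrite cx.
by case E : (cell x) => [k|//]; case: cx; exists k.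
Qed.

(** There are finitely many tuples of cells, and each is the value on a
    measurable set. *)
Lemma mseq_cell d (U : measurableType d) n (F : seq (option 'I_N) -> U) :
  mseq n (fun s => F (map cell s)).
Proof.
move=> _ Y mY; rewrite setTI.
rewrite (_ : _ @^-1` _ = \bigcup_(o in [set o : n.-tuple (option 'I_N) | Y (F o)])
    \bigcap_(i in [set: 'I_n]) [set t : n.-tuple mR | cell (tnth t i) = tnth o i]).
  apply: fin_bigcup_measurable => [|o _]; first exact: finite_finset.
  apply: fin_bigcap_measurable => [|i _]; first exact: finite_finset.
  have := @measurable_tnth _ mR n i measurableT _ (measurable_cell (tnth o i)).
  by rewrite setTI.
apply/seteqP; split => t /=.
  move=> Yt; exists (map_tuple cell t) => // i _ /=; by rewrite tnth_map.
move=> [c Yc /= ct]; rewrite (_ : map cell t = c)//.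
rewrite -[LHS]/(tval (map_tuple cell t)); congr tval.
by apply: eq_from_tnth => i; rewrite tnth_map ct.
Qed.

Lemma integral_cell (F : option 'I_N -> \bar R) :
  (forall o, (0 <= F o)%E) -> F None = 0%E ->
  (\int[leb]_x F (cell x) = \sum_k (grid_weight k)%:E * F (Some k))%E.
Proof.
move=> F0 FN.
have FE x : F (cell x) = (\sum_(k < N) F (Some k) * (\1_[set y : mR | cell y = Some k] x)%:E)%E.
  case cx : (cell x) => [j|].
    rewrite (bigD1 j)//= indicE mem_set ?mule1// big1 ?adde0// => k kj.
    rewrite indicE memNset ?mule0//= cx => -[jk]; by rewrite jk eqxx in kj.
  by rewrite big1 ?FN// => k _; rewrite indicE memNset ?mule0//= cx.
under eq_integral do rewrite FE.
have mi k : measurable_fun setT (fun x : mR => (\1_[set y : mR | cell y = Some k] x)%:E : \bar R).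
  apply/measurable_EFinP; apply: measurable_indic; exact: measurable_cell.
rewrite ge0_integral_sum//; first last.
- by move=> k x _; rewrite mule_ge0// lee_fin.
- by move=> k; exact: measurable_funeM.
apply: eq_bigr => k _; rewrite ge0_integralZl//.
rewrite integral_indic//; last exact: measurable_cell.
rewrite setIT muleC (_ : mkset _ = `[tau k, tau k.+1[%classic).
  by rewrite /= lebesgue_measure_itv /= lte_fin tau_lt// -EFinB.
by apply/seteqP; split => x /=; rewrite in_itv /= => /cellP.
Qed.

Lemma tint_cell n (F : seq (option 'I_N) -> \bar R) :
  (forall o, (0 <= F o)%E) -> (forall o, None \in o -> F o = 0%E) ->
  tint n (fun s => F (map cell s)) =
  tsum n (fun j => (weight grid_weight j)%:E * F (map Some j))%E.
Proof.
elim: n F => [|n IH] F F0 FN.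
  by rewrite tint0 ?tsum0 /weight ?big_nil ?mul1e//; exact: (mseq_cell F).
rewrite tintS//; last exact: (mseq_cell F).
pose G o := tsum n (fun j => (weight grid_weight j)%:E * F (o :: map Some j))%E.
have wt0 j : (0 <= weight grid_weight j).
  by apply: prodr_ge0 => k _; rewrite subr_ge0 ltW// tau_lt.
rewrite (eq_integral (fun x : mR => G (cell x))) => [|x _]; last first.
  by rewrite /= (IH (fun o => F (cell x :: o)))// => o oN; rewrite FN// inE oN orbT.
rewrite integral_cell; first last.
- by rewrite /G /tsum big1// => j _; rewrite FN ?mule0// inE eqxx.
- by move=> o; apply: sume_ge0 => j _; rewrite mule_ge0 ?lee_fin.
rewrite tsumS; apply: eq_bigr => k _.
rewrite /G /tsum ge0_sume_distrr; last by move=> j _; rewrite mule_ge0 ?lee_fin.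
by apply: eq_bigr => j _; rewrite weight_cons EFinM muleA.
Qed.

Lemma Rintegral_cell n (F : seq (option 'I_N) -> R) :
  (forall o, None \in o -> F o = 0) ->
  \int[lebesgue_tuple R n]_t F (map cell (tval t)) =
  tsum n (fun j => weight grid_weight j * F (map Some j)).
Proof.
move=> FN; pose F1 o := maxe (F o)%:E 0%E; pose F2 o := maxe (- F o)%:E 0%E.
have EE : (\int[lebesgue_tuple R n]_t (F (map cell (tval t)))%:E =
    tint n (fun s => F1 (map cell s)) - tint n (fun s => F2 (map cell s)))%E.
  by rewrite integralE; congr (_ - _)%E; apply: eq_integral => t _; rewrite unlock.
rewrite /Rintegral EE !tint_cell; first last.
- by move=> o oN; rewrite /F1 FN// maxxx.
- by move=> o; rewrite le_max lexx orbT.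
- by move=> o oN; rewrite /F2 FN// oppr0 maxxx.
- by move=> o; rewrite le_max lexx orbT.
rewrite /tsum; under eq_bigr do rewrite /F1 -EFin_max -EFinM.
under [X in (_ - X)%E]eq_bigr do rewrite /F2 -EFin_max -EFinM.
rewrite !sumEFin -EFinB /= -sumrB; apply: eq_bigr => j _.
rewrite -mulrBr; congr (_ * _).
by case: (ltgtP (F (map Some j)) 0) => h; rewrite ?oppr_gt0 ?oppr_lt0 /Num.max; case: ltP; case: ltP; lra.
Qed.

Lemma cint_cell p (F : seq (option 'I_N) -> R[i]) :
  (forall o, None \in o -> F o = 0) ->
  cint p (fun s => F (map cell s)) =
  tsum p (fun j => (weight grid_weight j)%:C * F (map Some j)).
Proof.
move=> FN; apply/eqP; rewrite eq_complex /cint /=.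
rewrite (@Rintegral_cell p (fun o => complex.Re (F o))); last by move=> o /FN ->.
rewrite (@Rintegral_cell p (fun o => complex.Im (F o))); last by move=> o /FN ->.
rewrite /tsum !raddf_sum /=; apply/andP; split; apply/eqP; apply: eq_bigr => j _.
  by case: (F _) => x y /=; rewrite mul0r subr0.
by case: (F _) => x y /=; rewrite mul0r addr0.
Qed.

Section boxes.
Context {n : nat}.
Implicit Types (b : n.-tuple (R * R)) (g h : seq (R[i] * n.-tuple (R * R))).

Definition on_grid g := forall cb, cb \in g ->
  forall i, gridpoint (tnth cb.2 i).1 /\ gridpoint (tnth cb.2 i).2.

Definition cell_in_box b (o : seq (option 'I_N)) : bool :=
  (size o == n) && [forall i : 'I_n,
    if nth None o i is Some k then (tnth b i).1 <= tau k < (tnth b i).2 else false].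

(** A word containing [None], the index of the points outside all cells, has
    coefficient [0] ([cell_coef_None]). *)
Definition cell_coef g (o : seq (option 'I_N)) : R[i] :=
  \sum_(cb <- g) cb.1 * (cell_in_box cb.2 o)%:R.

Lemma cell_coef_None g o : None \in o -> cell_coef g o = 0.
Proof.
move=> /(nthP None)[i io oi]; rewrite /cell_coef big1// => cb _.
rewrite /cell_in_box; case: eqP => [on|]; last by rewrite mulr0.
case: forallP => [/(_ (Ordinal (eq_rect _ (fun m => i < m)%N io _ on)))|]; last by rewrite mulr0.
by rewrite /= oi.
Qed.

(** If two coordinates shared a cell, the left end of this cell would lie in two
    of the disjoint intervals that span the box. *)
Lemma uniq_cell_coef g u : (forall cb, cb \in g -> off_diagonal cb.2) ->
  cell_coef g (map Some u) != 0 -> uniq u.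
Proof.
move=> offg; apply: contraNT => nu; rewrite /cell_coef big_seq big1// => cb cbg.
rewrite /cell_in_box size_map; case: eqP => [un|]; last by rewrite mulr0.
case: forallP => [all_in|]; last by rewrite mulr0.
exfalso; case: (u) nu un all_in => // k0 u' nu un all_in.
have /(uniqPn k0)[i [j [ij ju uij]]] := nu.
have jn : (j < n)%N by rewrite -un.
have lt_in : (i < n)%N := ltn_trans ij jn.
have := all_in (Ordinal jn); have := all_in (Ordinal lt_in).
rewrite !(nth_map k0) ?un//= -uij => /andP[i1 i2] /andP[j1 j2].
have [_ /(_ (Ordinal lt_in) (Ordinal jn))] := offg _ cbg.
rewrite -val_eqE /= (ltn_eqF ij) => /(_ isT) disj.
suff : (set0 : set R) (tau (nth k0 (k0 :: u') i)) by [].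
rewrite -disj; split => /=; rewrite in_itv /=.
  by rewrite i1 ltW.
by rewrite j1 ltW.
Qed.

End boxes.
End grid.

(** Half-open boxes are cut by a grid into disjoint cells, which closed boxes are
    not; the two kinds of step functions differ on a null set only. *)
Definition half_open_step {R : realType} {n : nat}
    (g : seq (R[i] * n.-tuple (R * R))) (s : seq R) : R[i] :=
  \sum_(cb <- g) cb.1 *
    ((size s == n) && [forall i : 'I_n, (tnth cb.2 i).1 <= nth 0 s i < (tnth cb.2 i).2])%:R.

Section step_on_grid.
Context {R : realType} (tau : nat -> R) (N n : nat).
Hypothesis tau_lt : forall i, (i < N)%N -> tau i < tau i.+1.
Implicit Types (g h : seq (R[i] * n.-tuple (R * R))).
Local Notation wt := (@grid_weight R tau N).
Local Notation cell := (cell tau N).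
Local Notation cell_coef := (@cell_coef R tau N n).

Lemma half_open_stepE g : on_grid tau N g ->
  forall s, half_open_step g s = cell_coef g (map cell s).
Proof.
move=> gg s; rewrite /half_open_step /cell_coef big_seq [RHS]big_seq.
apply: eq_bigr => cb cbg; congr (_ * _%:R); congr nat_of_bool.
rewrite /cell_in_box size_map; case: eqP => //= sn.
apply: eq_forallb => i; have [g1 g2] := gg _ cbg i.
by rewrite (between_gridpoints tau_lt _ g1 g2) (nth_map 0) ?sn.
Qed.

Lemma cmseq_half_open_step m g : on_grid tau N g -> cmseq m (half_open_step g).
Proof.
move=> gg; split.
  have : mseq m (fun s => complex.Re (cell_coef g (map cell s)) : measurableTypeR R).
    exact: (mseq_cell tau_lt (fun o => complex.Re (cell_coef g o) : measurableTypeR R)).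
  by apply: eq_mseq => s _; rewrite half_open_stepE.
have : mseq m (fun s => complex.Im (cell_coef g (map cell s)) : measurableTypeR R).
    exact: (mseq_cell tau_lt (fun o => complex.Im (cell_coef g o) : measurableTypeR R)).
by apply: eq_mseq => s _; rewrite half_open_stepE.
Qed.

(** The kernel of the contraction is itself a function of cells, so all the
    integrals turn into sums over words. *)
Lemma kernel2_half_open_step g h p : on_grid tau N g -> on_grid tau N h ->
  kernel2 (n - p) (ckernel p (half_open_step g) (half_open_step h)) =
  (tsum (n - p) (fun u => tsum (n - p) (fun v =>
    Normc.normc (tsum p (fun s => (weight wt s)%:C *
      (cell_coef g (map Some (u ++ s)) * conjc (cell_coef h (map Some (v ++ s)))))) ^+ 2
    * (weight wt u * weight wt v))))%:E.
Proof.
move=> gg gh.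
pose K o o' := tsum p (fun s => (weight wt s)%:C *
  (cell_coef g (o ++ map Some s) * conjc (cell_coef h (o' ++ map Some s)))).
have KN o o' : None \in o \/ None \in o' -> K o o' = 0.
  move=> oN; rewrite /K /tsum big1// => s _; case: oN => oN.
    by rewrite (@cell_coef_None _ _ _ _ g) ?mul0r ?mulr0// mem_cat oN.
  by rewrite (@cell_coef_None _ _ _ _ h) ?conjc0 ?mulr0// mem_cat oN.
have KE u v : ckernel p (half_open_step g) (half_open_step h) u v = K (map cell u) (map cell v).
  pose F o := cell_coef g (map cell u ++ o) * conjc (cell_coef h (map cell v ++ o)).
  have := @cint_cell _ _ _ tau_lt p F; rewrite /K /F => <-.
    rewrite /ckernel; congr cint; apply/funext => s.
    by rewrite !half_open_stepE// !map_cat.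
  by move=> o oN; rewrite cell_coef_None ?mul0r// mem_cat oN orbT.
pose Q o o' := ((Normc.normc (K o o') ^+ 2)%:E : \bar R).
have Q0 o o' : (0 <= Q o o')%E by rewrite lee_fin sqr_ge0.
have QN o o' : None \in o \/ None \in o' -> Q o o' = 0%E.
  by move=> /KN KN0; rewrite /Q KN0 Normc.normc0 expr0n.
transitivity (tint (n - p) (fun u => tint (n - p) (fun v => Q (map cell u) (map cell v)))).
  by apply: eq_tint => u _; apply: eq_tint => v _; rewrite /sqn KE.
pose Q1 o := tsum (n - p) (fun v => (weight wt v)%:E * Q o (map Some v))%E.
have w0 v : (0 <= weight wt v) by apply: prodr_ge0 => k _; rewrite subr_ge0 ltW// tau_lt.
transitivity (tint (n - p) (fun u => Q1 (map cell u))).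
  apply: eq_tint => u _; rewrite (@tint_cell R tau N tau_lt (n - p) (Q (map cell u)))// => o oN.
  by apply: QN; right.
rewrite (@tint_cell R tau N tau_lt (n - p) Q1)//; first last.
- by move=> o oN; rewrite /Q1 /tsum big1// => v _; rewrite QN ?mule0//; left.
- by move=> o; apply: sume_ge0 => v _; apply: mule_ge0 (Q0 _ _); rewrite lee_fin w0.
rewrite /tsum -sumEFin; apply: eq_bigr => u _.
rewrite /Q1 /tsum -sumEFin ge0_sume_distrr; last first.
  by move=> v _; apply: mule_ge0 (Q0 _ _); rewrite lee_fin w0.
apply: eq_bigr => v _; rewrite /Q -!EFinM; congr EFin.
rewrite (_ : K _ _ = tsum p (fun s => (weight wt s)%:C *
  (cell_coef g (map Some (u ++ s)) * conjc (cell_coef h (map Some (v ++ s)))))).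
  by rewrite /tsum; ring.
by apply: eq_tsum => s _; rewrite !map_cat.
Qed.

Context {A : wstarProbabilitySpace R} (S : R -> A).
Hypothesis S_fbm : free_brownian_motion S.
Hypothesis tau0 : 0 <= tau 0%N.
Let X (k : 'I_N) : A := S (tau k.+1) - S (tau k).

Lemma increment_cells a b : gridpoint tau N a -> gridpoint tau N b -> a < b ->
  S b - S a = \sum_(k : 'I_N | a <= tau k < b) X k.
Proof.
move=> [i iN ->] [j jN ->]; rewrite (grid_mono tau_lt)// => ij.
rewrite -(telescope_sumr (fun k => S (tau k))) 1?ltnW//.
rewrite (big_nat_widen _ _ N)// (big_nat_widenl i 0)// big_mkord.
apply: eq_bigl => k; have kN := ltnW (ltn_ord k).
by rewrite (grid_le tau_lt)// (grid_mono tau_lt)// andbC.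
Qed.

(** Each increment over a side of a box is the sum of the increments over the
    cells of this side, and the product of these sums is expanded. *)
Lemma step_integral_discrete g : on_grid tau N g ->
  (forall cb, cb \in g -> off_diagonal cb.2) ->
  step_integral S g = discrete_integral X n (fun u => cell_coef g (map Some u)).
Proof.
move=> gg offg; rewrite /discrete_integral /tsum.
transitivity (\sum_(cb <- g) \sum_(u : n.-tuple 'I_N)
   (cb.1 * (@cell_in_box R tau N n cb.2 (map Some u))%:R) *: word X u); last first.
  rewrite exchange_big; apply: eq_bigr => u _.
  by rewrite /cell_coef scaler_suml.
rewrite /step_integral big_seq [RHS]big_seq; apply: eq_bigr => cb cbg.
pose Q (i : 'I_n) (k : 'I_N) := (tnth cb.2 i).1 <= tau k < (tnth cb.2 i).2.
have -> : \prod_(i < n) (S (tnth cb.2 i).2 - S (tnth cb.2 i).1) =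
    \prod_(i < n) \sum_(k | Q i k) X k.
  apply: eq_bigr => i _; have [g1 g2] := gg _ cbg i; apply: increment_cells => //.
  by have [/(_ i)[]] := offg _ cbg.
rewrite bigA_distr_big_dep scaler_sumr.
pose T (f : {ffun 'I_n -> 'I_N}) : n.-tuple 'I_N := [tuple f i | i < n].
rewrite [RHS](reindex T)/=; last first.
  exists (fun t : n.-tuple 'I_N => [ffun i => tnth t i]) => f _.
    by apply/ffunP => i; rewrite ffunE tnth_mktuple.
  by apply: eq_from_tnth => i; rewrite tnth_mktuple ffunE.
rewrite big_mkcond; apply: eq_bigr => f _.
have -> : (f \in family Q) = @cell_in_box R tau N n cb.2 (map Some (T f)).
  rewrite /cell_in_box size_map size_tuple eqxx; apply: eq_forallb => i.
  rewrite (nth_map (f i)) ?size_tuple// -tnth_nth tnth_mktuple.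
  by [].
case: ifP => _; last by rewrite mulr0 scale0r.
rewrite mulr1; congr (_ *: _).
transitivity (\prod_(i < n) X (tnth (T f) i)); last by rewrite /word [RHS](big_tuple _ _ (T f)).
by apply: eq_bigr => i _; rewrite tnth_mktuple.
Qed.

Lemma tnorm2_step_integral g h : on_grid tau N g -> on_grid tau N h ->
  (forall cb, cb \in g -> off_diagonal cb.2) ->
  (forall cb, cb \in h -> off_diagonal cb.2) ->
  ((tnorm2 (step_integral S g * star (step_integral S h)))%:E =
   \sum_(p < n.+1) kernel2 (n - p) (ckernel p (half_open_step g) (half_open_step h)))%E.
Proof.
move=> gg gh offg offh.
have tau_ge0 k : (k <= N)%N -> 0 <= tau k.
  by move=> kN; rewrite (le_trans tau0)// (grid_le tau_lt).
rewrite !step_integral_discrete// (tnorm2_discrete (w := wt)).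
- rewrite -sumEFin; by apply: eq_bigr => p _; rewrite kernel2_half_open_step.
- move=> k; have kN := ltn_ord k.
  by rewrite /X starB !(fbm_selfadjoint S_fbm)// tau_ge0// ltnW.
- exact: (fbm_free S_fbm).
- move=> k; apply: semicircular_moments; first by rewrite subr_gt0 tau_lt.
  by apply: (fbm_law S_fbm); [apply: tau_ge0; exact: ltnW|exact: tau_lt].
- by move=> u _; exact: uniq_cell_coef.
- by move=> u _; exact: uniq_cell_coef.
Qed.

End step_on_grid.
(** * Functions on the orthant *)

Section orthant_extension.
Context {R : realType}.
Local Notation mR := (measurableTypeR R).
Local Notation leb := (@lebesgue_measure R).
Local Notation normc := Normc.normc.

Lemma grid_exists (pts : seq R) : {in pts, forall x, 0 <= x} ->
  exists tau : nat -> R, exists N : nat,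
    [/\ 0 <= tau 0%N, forall i, (i < N)%N -> tau i < tau i.+1 &
        {in pts, forall x, gridpoint tau N x}].
Proof.
move=> pts0; pose s := sort <=%R (undup pts).
have sP x : (x \in s) = (x \in pts) by rewrite mem_sort mem_undup.
exists (nth 0 s), (size s).-1; split.
- have [s0|s0] := posnP (size s); first by rewrite nth_default// s0.
  by apply: pts0; rewrite -sP mem_nth.
- move=> i iN; have ss : sorted <%R s by rewrite sort_lt_sorted undup_uniq.
  by have /sortedP := ss; apply; rewrite -ltn_predRL.
- move=> x; rewrite -sP => xs; exists (index x s); last by rewrite nth_index.
  by rewrite -ltnS prednK ?index_mem// (leq_ltn_trans _ (_ : index x s < size s)%N)// index_mem.
Qed.

(** Extension by [0] outside the orthant, so that all integrals are over the whole
    space. *)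
Definition extend n (f : n.-tuple R -> R[i]) (s : seq R) : R[i] :=
  if all (>= 0) s then f [tuple nth 0 s i | i < n] else 0.

Lemma mktuple_nth n (t : n.-tuple R) : [tuple nth 0 t i | i < n] = t.
Proof. by apply: eq_from_tnth => i; rewrite tnth_mktuple -tnth_nth. Qed.

Lemma orthantP n (t : n.-tuple R) : reflect (@orthant R n t) (all (>= 0) t).
Proof.
apply: (iffP allP) => [h i|h x /tnthP[i ->]]; last exact: h.
by apply: h; exact: mem_tnth.
Qed.

Lemma extend_tuple n (f : n.-tuple R -> R[i]) (t : n.-tuple R) :
  extend f t = if t \in @orthant R n then f t else 0.
Proof.
rewrite /extend mktuple_nth; case: (orthantP t) => ot; first by rewrite mem_set.
by rewrite memNset.
Qed.

Lemma measurable_orthant n : measurable (@orthant R n).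
Proof.
rewrite (_ : @orthant R n = \bigcap_(i in [set: 'I_n]) [set t | 0 <= tnth t i]).
  apply: fin_bigcap_measurable => [|i _]; first exact: finite_finset.
  have := @measurable_tnth _ mR n i measurableT `[0%R, +oo[%classic (measurable_itv _).
  rewrite setTI; congr (measurable _); apply/seteqP.
  by split => t /=; rewrite in_itv/= andbT.
by apply/seteqP; split => t /= h i; [move=> _; exact: h|exact: (h i I)].
Qed.

Lemma cmseq_extend n (f : n.-tuple R -> R[i]) :
  measurable_fun (@orthant R n) (fun t => complex.Re (f t)) ->
  measurable_fun (@orthant R n) (fun t => complex.Im (f t)) -> cmseq n (extend f).
Proof.
move=> rf imf; split.
  have := (measurable_restrictT _ (@measurable_orthant n)).1 rf.
  apply: eq_measurable_fun => t _; rewrite extend_tuple patchE.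
  by case: ifP.
have := (measurable_restrictT _ (@measurable_orthant n)).1 imf.
apply: eq_measurable_fun => t _; rewrite extend_tuple patchE.
by case: ifP.
Qed.

Lemma L2_cmseq_extend n (f : n.-tuple R -> R[i]) : L2 f -> cmseq n (extend f).
Proof. by case=> ? ? _; exact: cmseq_extend. Qed.

Lemma tval_mktuple_nth n (s : seq R) : size s = n -> tval [tuple nth 0 s i | i < n] = s.
Proof.
move=> sn; apply: (@eq_from_nth _ 0) => [|i]; rewrite size_tuple// => ni.
by rewrite -(tnth_nth 0 _ (Ordinal ni)) tnth_mktuple.
Qed.

Lemma sqr_L2norm n (f : n.-tuple R -> R[i]) : (L2norm f ^+ 2 = norm2 n (extend f))%E.
Proof.
rewrite /L2norm Lnorm2_sqr; apply: eq_integral => t _.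
rewrite patchE /sqn extend_tuple; case: ifP => _.
  by rewrite /= ger0_norm ?normc_ge0// EFin_expe.
by rewrite Normc.normc0 expr0n abse0 expe2 mule0.
Qed.

Lemma ereal_cvg0P (u : nat -> \bar R) : (forall k, (0 <= u k)%E) ->
  u @ \oo --> 0%E <-> (forall e : R, 0 < e -> \forall k \near \oo, (u k < e%:E)%E).
Proof.
move=> u0; split => [/fine_cvgP[ufin /cvgrPdist_lt uc] e e0|h].
  apply: filterS2 ufin (uc _ e0) => k ufk /=.
  by rewrite sub0r normrN ger0_norm ?fine_ge0// => ue; rewrite -(fineK ufk) lte_fin.
apply/fine_cvgP; split.
  by apply: filterS (h 1 ltr01) => k uk; rewrite ge0_fin_numE// (lt_trans uk)// ltry.
apply/cvgrPdist_lt => e e0; apply: filterS (h e e0) => k uk.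
rewrite sub0r normrN ger0_norm ?fine_ge0//.
by rewrite -lte_fin fineK// ge0_fin_numE// (lt_trans uk)// ltry.
Qed.

Lemma ereal_cvg0_sqr (u : nat -> \bar R) : (forall k, (0 <= u k)%E) ->
  u @ \oo --> 0%E <-> (fun k => u k ^+ 2)%E @ \oo --> 0%E.
Proof.
move=> u0; have u20 k : (0 <= u k ^+ 2)%E by rewrite expe2 mule_ge0.
have key k (e : R) : 0 < e -> (u k ^+ 2 < (e ^+ 2)%:E)%E = (u k < e%:E)%E.
  move=> e0; have := u0 k; case: (u k) => [r| |]// r0.
    by rewrite -EFin_expe !lte_fin ltr_sqr ?nnegrE// ltW.
split => /(ereal_cvg0P _) h; apply/ereal_cvg0P => // e e0.
  have s0 : 0 < Num.sqrt e by rewrite sqrtr_gt0.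
  apply: filterS (h u0 _ s0) => k; rewrite -key// sqr_sqrtr// ltW//.
by apply: filterS (h u20 _ (exprn_gt0 2 e0)) => k; rewrite key.
Qed.

(** By Tonelli's theorem and induction on the dimension, as a finite set of reals
    is null. *)
Lemma ae_avoid n (pts : seq R) :
  {ae lebesgue_tuple R n, forall t, ~~ has (mem pts) (tval t)}.
Proof.
pose B m : set (m.-tuple mR) := \bigcup_(i in [set: 'I_m]) ((fun t => tnth t i) @^-1` [set` pts]).
have mpts : measurable ([set` pts] : set mR).
  apply: countable_measurable => [x|]; first exact: measurable_set1.
  exact: finite_set_countable (finite_seq pts).
have mB m : measurable (B m).
  apply: fin_bigcup_measurable => [|i _]; first exact: finite_finset.
  by have := @measurable_tnth _ mR m i measurableT _ mpts; rewrite setTI.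
have BE m (t : m.-tuple mR) : (t \in B m) = has (mem pts) t.
  apply/idP/hasP => [|[x /tnthP[i ->] xp]]; last by rewrite inE; exists i.
  by rewrite inE => -[i _ /= ti]; exists (tnth t i) => //; exact: mem_tnth.
pose D (s : seq R) : \bar R := ((has (mem pts) s)%:R)%:E.
have mD m : mseq m D.
  have : measurable_fun setT (fun t : m.-tuple mR => (\1_(B m) t : R)%:E).
    by apply/measurable_EFinP; apply: measurable_indic; exact: mB.
  by apply: eq_measurable_fun => t _; rewrite /= indicE BE.
have D0 s : (0 <= D s)%E by rewrite lee_fin.
have JD0 m : tint m D = 0%E.
  elim: m => [|m IH]; first by rewrite tint0.
  apply/eqP; rewrite eq_le tint_ge0// andbT tintS//.
  have mG : measurable_fun setT (fun x : mR => tint m (fun s => D (x :: s))).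
    have := mseq_integral (a := 1) (b := m) D0 (mD _).
    move=> h.
    have c1 : measurable_fun setT (fun x : mR => [tuple x] : 1.-tuple mR).
      apply/measurable_fun_tnthP => i.
      by rewrite (_ : _ \o _ = id)//; apply/funext => x /=; rewrite (tnth_nth 0) /= (ord1 i).
    exact: (measurableT_comp h c1).
  rewrite -[leRHS](integral0 leb setT); apply: ae_ge0_le_integral => //.
  - by move=> x _; exact: tint_ge0.
  exists [set` pts]; split => //; first exact: countable_lebesgue_measure0 (finite_set_countable (finite_seq pts)).
  move=> x /= nle; apply/negP => xp; apply: nle => _.
  rewrite (@eq_tint _ m _ D) ?IH// => s _.
  by rewrite /D /= (negbTE (introN idP xp)).
exists (B n); split; [exact: mB| |by move=> t /= /negP; rewrite negbK -BE inE].
rewrite -(setIT (B n)) -integral_indic; [|exact: measurableT|exact: mB].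
rewrite -[RHS](JD0 n) /tint.
by apply: eq_integral => t _; rewrite indicE BE.
Qed.

(** At a point none of whose coordinates is in [pts], closed and half-open boxes
    agree. *)
Lemma L2_step n (g : seq (R[i] * n.-tuple (R * R))) (f : n.-tuple R -> R[i])
    (pts : seq R) :
  (forall cb, cb \in g -> off_diagonal cb.2) ->
  (forall cb, cb \in g -> forall i, (tnth cb.2 i).1 \in pts /\ (tnth cb.2 i).2 \in pts) ->
  cmseq n (half_open_step g) -> L2 f ->
  norm2 n (fun s => half_open_step g s - extend f s) =
  (L2norm (fun x => step_fun g x - f x)%R ^+ 2)%E.
Proof.
move=> offg gpts mg fL2; rewrite sqr_L2norm; have mf := L2_cmseq_extend fL2.
pose D s := half_open_step g s - extend f s.
pose D' s := extend (fun x => step_fun g x - f x) s.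
have DD (t : n.-tuple R) : ~~ has (mem pts) t -> D t = D' t.
  move=> tp; rewrite /D /D' !extend_tuple /half_open_step size_tuple eqxx /=.
  have tpts i : tnth t i \notin pts by apply: contra tp => tip; apply/hasP; exists (tnth t i) => //; exact: mem_tnth.
  case: ifP => [_|ot]; last first.
    rewrite subr0 big_seq big1// => cb cbg.
    case: forallP => [h|_]; last by rewrite mulr0.
    exfalso; move/negP: ot; apply; rewrite inE => i; have := h i.
    rewrite -tnth_nth => /andP[+ _]; apply: le_trans.
    by have [/(_ i)[]] := offg _ cbg.
  congr (_ - _); rewrite /step_fun big_seq [RHS]big_seq; apply: eq_bigr => cb cbg.
  congr (_ * _); rewrite indicE; congr (_%:R); congr nat_of_bool.
  apply/forallP/idP => [h|]; rewrite inE.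
    move=> i; have /andP[h1 h2] := h i; rewrite -tnth_nth in h1 h2.
    by rewrite h1 ltW.
  move=> h i; have /andP[h1 h2] := h i; rewrite -tnth_nth h1 /= lt_def h2 andbT.
  by apply: contraNneq (tpts i) => <-; case: (gpts _ cbg i).
have mD' : cmseq n D'.
  have [rf imf _] := fL2.
  have mbox (b : n.-tuple (R * R)) :
      measurable_fun (@orthant R n) (\1_(box b) : n.-tuple mR -> mR).
    apply: measurable_funTS; apply: measurable_indic.
    rewrite (_ : box b = \bigcap_(i in [set: 'I_n])
        (fun t => tnth t i) @^-1` `[(tnth b i).1, (tnth b i).2]%classic).
      apply: fin_bigcap_measurable => [|i _]; first exact: finite_finset.
      have := @measurable_tnth _ mR n i measurableT _ (measurable_itv `[(tnth b i).1, (tnth b i).2]).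
      by rewrite setTI.
    apply/seteqP; split => t /= h i; first by move=> _; rewrite /= in_itv /=; exact: h.
    by have := h i I; rewrite /= in_itv.
  have ms (c : R[i] -> R) : measurable_fun (@orthant R n)
      (fun t => \sum_(cb <- g) c cb.1 * (\1_(box cb.2) t : R) : mR).
    by apply: measurable_sum => cb; apply: measurable_funM => //; exact: mbox.
  apply: cmseq_extend.
    have := measurable_funB (ms (@complex.Re R)) rf.
    apply: eq_measurable_fun => t _; rewrite raddfB /= /step_fun raddf_sum /=.
    congr (_ - _); apply: eq_bigr => cb _; rewrite !indicE.
    by case: (cb.1) => x y; case: (t \in _); rewrite /= ?mulr1 ?mulr0 ?subr0 ?mul0r ?subrr.
  have := measurable_funB (ms (@complex.Im R)) imf.
  apply: eq_measurable_fun => t _; rewrite raddfB /= /step_fun raddf_sum /=.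
  congr (_ - _); apply: eq_bigr => cb _; rewrite !indicE.
  by case: (cb.1) => x y; case: (t \in _); rewrite /= ?mulr1 ?mulr0 ?add0r ?addr0.
rewrite /norm2 /tint; apply: ae_eq_integral => //.
- exact: mseq_sqn (cmseqB mg mf).
- exact: mseq_sqn mD'.
- by apply: ae_mono (ae_avoid n pts) => t tp _; rewrite /sqn -/(D t) -/(D' t) DD.
Qed.

(** In the contraction of [f] with its adjoint the last variables come in reverse
    order; reversing them preserves the integral. *)
Lemma L2norm_nested_contraction n p (f : n.-tuple R -> R[i]) : L2 f -> (p <= n)%N ->
  (L2norm (nested_contraction p f (adjoint_fun f)) ^+ 2 =
   kernel2 (n - p) (ckernel p (extend f) (extend f)))%E.
Proof.
move=> fL2 pn; have mf := L2_cmseq_extend fL2.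
set a := (n - p)%N; have ap : (a + p = n)%N by rewrite subnK.
have maf : cmseq (a + p) (extend f) by rewrite ap.
pose K := ckernel p (extend f) (extend f).
have mK : cmkernel a K by exact: cmkernel_ckernel.
pose K' u v := K u (rev v).
have allrev (s : seq R) : all (>= 0) (rev s) = all (>= 0) s by exact: all_rev.
rewrite /L2norm Lnorm2_sqr.
transitivity (tint (n + n - p.*2) (fun t => sqn (K' (take a t)) (drop a t))).
  apply: eq_integral => t _; rewrite patchE /sqn.
  have all_td : all (>= 0) (tval t) = all (>= 0) (take a t) && all (>= 0) (drop a t).
    by rewrite -all_cat cat_take_drop.
  have st : size (tval t) = (a + a)%N by rewrite size_tuple /a -addnn; lia.
  case: ifP => [ot|/negbT not]; last first.
    rewrite /K' /K /ckernel (_ : cint _ _ = 0).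
      by rewrite Normc.normc0 expr0n abse0 expe2 mule0.
    rewrite -[RHS](_ : cint p (fun=> 0) = 0); last first.
      by rewrite /cint /= /Rintegral !integral0.
    congr cint; apply/funext => s; rewrite /extend !all_cat allrev.
    have : ~~ all (>= 0) (tval t).
      by apply: contra not => /orthantP ot; rewrite inE.
    rewrite all_td negb_and => /orP[] /negbTE ->; first by rewrite mul0r.
    by rewrite conjc0 mulr0.
  transitivity ((normc (nested_contraction p f (adjoint_fun f) t) ^+ 2)%:E).
    by rewrite /= ger0_norm ?normc_ge0// EFin_expe.
  congr ((normc _ ^+ 2)%:E).
  move: ot; rewrite inE => /orthantP; rewrite all_td => /andP[pt1 pt2].
  rewrite /nested_contraction /orthant_integral /K' /K /ckernel /cint.
  have key (s : p.-tuple R) :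
      (extend f (take a t ++ s) * conjc (extend f (rev (drop a t) ++ s))) =
      if s \in @orthant R p then
        f [tuple nth 0 (take (n - p) t ++ s) i | i < n] *
        adjoint_fun f [tuple nth 0 (rev s ++ drop (n - p) t) j | j < n]
      else 0.
    rewrite /extend !all_cat allrev pt1 pt2 /=.
    case: (orthantP s) => os; last by rewrite memNset// mul0r.
    rewrite mem_set//; congr (_ * _); rewrite /adjoint_fun; congr (conjc (f _)).
    apply: val_inj; rewrite [LHS]tval_mktuple_nth; last first.
      by rewrite size_cat size_rev size_drop st size_tuple; lia.
    rewrite -[RHS]/(rev (tval [tuple nth 0 (rev s ++ drop a t) j | j < n])).
    rewrite tval_mktuple_nth ?rev_cat ?revK//.
    by rewrite size_cat size_rev size_drop st size_tuple; lia.
  apply/eqP; rewrite eq_complex /=; apply/andP; split; apply/eqP.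
    rewrite /Rintegral integral_mkcond; congr fine; apply: eq_integral => s _.
    by rewrite patchE key; case: ifP.
  rewrite /Rintegral integral_mkcond; congr fine; apply: eq_integral => s _.
  by rewrite patchE key; case: ifP.
have -> : (n + n - p.*2 = a + a)%N by rewrite /a -addnn; lia.
have mK2 : cmseq (a + a) (fun t => K' (take a t) (drop a t)).
  have := @cmseq_sel _ (a + a) (iota 0 a ++ rev (iota a a)) (fun t => K (take a t) (drop a t)).
  rewrite size_cat size_rev !size_iota => /(_ mK); apply: eq_cmseq => s ss.
  rewrite map_cat map_rev !map_nth_iota; try (rewrite ss; lia).
  have sta : size (take a s) = a by rewrite size_takel// ss leq_addr.
  rewrite drop0 take_size_cat// drop_size_cat// [take a (drop a s)]take_oversize//.
  by rewrite size_drop ss addnK.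
transitivity (kernel2 a K'); first exact: (esym (kernel2E (K := K') mK2)).
apply: eq_tint => u ua; apply: (@tint_rev _ a (sqn (K u)) (sqn_ge0 _)).
exact: mseq_sqn (cmkernel_section ua mK).
Qed.

Lemma mseq0 d (U : measurableType d) (G : seq R -> U) : mseq 0 G.
Proof.
move=> _ Y mY; rewrite setTI; have [Y0|Y0] := pselect (Y (G [::])).
  by rewrite (_ : _ @^-1` _ = setT)//; apply/seteqP; split => // t _ /=; rewrite tuple0.
by rewrite (_ : _ @^-1` _ = set0)//; apply/seteqP; split => // t /=; rewrite tuple0.
Qed.

Lemma cint0 (G : seq R -> R[i]) : cint 0 G = G [::].
Proof.
rewrite /cint /Rintegral.
have Jfin (h : seq R -> R) : fine (\int[lebesgue_tuple R 0]_t (h (tval t))%:E) = h [::].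
  exact: (congr1 fine (tint0 (mseq0 (fun s => (h s)%:E)))).
rewrite (Jfin (fun s => complex.Re (G s))) (Jfin (fun s => complex.Im (G s))).
by case: (G _).
Qed.

Lemma kernel2_ckernel0 n (F : seq R -> R[i]) : cmseq n F ->
  kernel2 n (ckernel 0 F F) = (norm2 n F * norm2 n F)%E.
Proof.
move=> mF; have mS := mseq_sqn mF.
have KE u v : sqn (ckernel 0 F F u) v = (sqn F u * sqn F v)%E.
  rewrite /sqn /ckernel cint0 !cats0 -EFinM -exprMn; congr ((_ ^+ 2)%:E).
  rewrite (_ : normc (F v) = normc (conjc (F v))); last by case: (F v) => x y /=; rewrite sqrrN.
  by rewrite Normc.normcM.
rewrite /kernel2 (@eq_tint _ n _ (fun u => norm2 n F * sqn F u)%E).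
  by rewrite tintZl ?norm2_ge0//; exact: sqn_ge0.
move=> u _; rewrite (@eq_tint _ n _ (fun v => sqn F u * sqn F v)%E) => [|v _]; last exact: KE.
by rewrite tintZl ?sqn_ge0 1?muleC//; exact: sqn_ge0.
Qed.

Lemma kernel2_ckernelT n (F : seq R -> R[i]) : cmseq n F -> (norm2 n F < +oo)%E ->
  kernel2 0 (ckernel n F F) = (norm2 n F * norm2 n F)%E.
Proof.
move=> mF Foo; have fF : norm2 n F \is a fin_num by rewrite ge0_fin_numE// norm2_ge0.
have KE : ckernel n F F [::] [::] = (fine (norm2 n F))%:C.
  rewrite /ckernel /cint /=; congr (_ +i* _).
    rewrite /Rintegral; congr fine; apply: eq_integral => t _.
    by rewrite /sqn -sqr_normcC.
  rewrite /Rintegral -[RHS](congr1 fine (integral0 (lebesgue_tuple R n) setT)).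
  congr fine; apply: eq_integral => t _; by rewrite -sqr_normcC.
rewrite /kernel2 !tint0; [|exact: mseq0..]; rewrite /sqn KE /= expr0n addr0 sqrtr_sqr.
rewrite ger0_norm ?fine_ge0 ?norm2_ge0//.
by rewrite expr2 EFinM fineK.
Qed.

End orthant_extension.
(** * The fourth moment of a Wigner integral *)

Section real_limits.
Context {R : realType}.

(** The two hypotheses are what [sqr_normcD_le] says of the squared norms [u k] and
    [l] of two vectors whose difference has squared norm [d k]. *)
Lemma cvg_quasi (u d : nat -> R) (l : R) :
  0 <= l -> (forall k, 0 <= d k) -> d @ \oo --> (0 : R) ->
  (forall k e, 0 < e -> u k <= (1 + e) * l + (1 + e^-1) * d k) ->
  (forall k e, 0 < e -> l <= (1 + e) * u k + (1 + e^-1) * d k) ->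
  u @ \oo --> l.
Proof.
move=> l0 d0 /cvgrPdist_lt dc ul lu; apply/cvgrPdist_le => eta eta0.
pose e := eta / (2 * (l + 1)).
have l1 : 0 < l + 1 by rewrite ltr_wpDl.
have e0 : 0 < e by rewrite divr_gt0// mulr_gt0.
have ei0 : 0 < e^-1 by rewrite invr_gt0.
have el : e * l <= eta / 2.
  have -> : e * l = eta / 2 * (l / (l + 1)) by rewrite /e; field; rewrite gt_eqF.
  have eta20 : 0 <= eta / 2 by rewrite divr_ge0// ltW.
  by rewrite ler_piMr// ler_pdivrMr// mul1r lerDl.
have c0 : 0 < 1 + e^-1 by rewrite addr_gt0.
apply: filterS (dc _ (divr_gt0 (divr_gt0 eta0 (ltr0Sn _ 1)) c0)) => k.
rewrite sub0r normrN ger0_norm// ltr_pdivlMr// mulrC => dk.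
have h1 := ul k e e0; have h2 := lu k e e0.
have h3 : l - u k <= e * l + e^-1 * d k.
  have : (1 + e) * (l - e * l - e^-1 * d k) <= (1 + e) * u k.
    have -> : (1 + e) * (l - e * l - e^-1 * d k) = l - e ^+ 2 * l - (1 + e^-1) * d k.
      by field; rewrite gt_eqF.
    by have := mulr_ge0 (sqr_ge0 e) l0; lra.
  by rewrite ler_pM2l ?addr_gt0//; lra.
have := d0 k; rewrite ler_norml => dk0.
apply/andP; split; lra.
Qed.

(** The difference of the two sides is [e] times the squared norm of
    [a - e^-1 *: b]. *)
Lemma tnorm2D_quasi (A : wstarProbabilitySpace R) (a b : A) (e : R) : 0 < e ->
  tnorm2 (a + b) <= (1 + e) * tnorm2 a + (1 + e^-1) * tnorm2 b.
Proof.
move=> e0; have := tnorm2_ge0 (a + (- e^-1)%:C *: b).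
rewrite tnorm2D tdotZr -(ler_pM2l e0) mulr0.
have -> : tnorm2 ((- e^-1)%:C *: b) = e^-1 ^+ 2 * tnorm2 b.
  by rewrite /tnorm2 -/(tdot _ _) tdotZl tdotZr mulrA mulrNN expr2.
rewrite tnorm2D => h; rewrite -subr_ge0; apply: le_trans h _.
by rewrite le_eqVlt; apply/orP; left; apply/eqP; field; rewrite gt_eqF.
Qed.

End real_limits.

Section wigner.
Context {R : realType} (A : wstarProbabilitySpace R) (S : R -> A).
Hypothesis S_fbm : free_brownian_motion S.
Context {n : nat}.
Implicit Types (g h : seq (R[i] * n.-tuple (R * R))).

Definition off_diagonal_step g := forall cb, cb \in g -> off_diagonal cb.2.

Definition endpoints g : seq R :=
  flatten [seq [seq p.1 | p <- tval cb.2] ++ [seq p.2 | p <- tval cb.2] | cb <- g].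

Lemma endpointsP g cb i : cb \in g ->
  (tnth cb.2 i).1 \in endpoints g /\ (tnth cb.2 i).2 \in endpoints g.
Proof.
move=> cbg; split; apply/flattenP.
  exists ([seq p.1 | p <- tval cb.2] ++ [seq p.2 | p <- tval cb.2]); first exact: map_f.
  by rewrite mem_cat map_f// mem_tnth.
exists ([seq p.1 | p <- tval cb.2] ++ [seq p.2 | p <- tval cb.2]); first exact: map_f.
by rewrite mem_cat orbC map_f// mem_tnth.
Qed.

Lemma endpoints_ge0 g : off_diagonal_step g -> {in endpoints g, forall x, 0 <= x}.
Proof.
move=> offg x /flattenP[_ /mapP[cb cbg ->]].
rewrite mem_cat => /orP[] /mapP[p /tnthP[i ->] ->]; have [/(_ i)[h1 h2] _] := offg _ cbg => //.
by rewrite (le_trans h1)// ltW.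
Qed.

Lemma common_grid g h : off_diagonal_step g -> off_diagonal_step h ->
  exists tau N, [/\ 0 <= tau 0%N, forall i, (i < N)%N -> tau i < tau i.+1,
    on_grid tau N g & on_grid tau N h].
Proof.
move=> offg offh; have pts0 : {in endpoints g ++ endpoints h, forall x, 0 <= x}.
  by move=> x; rewrite mem_cat => /orP[]; exact: endpoints_ge0.
have [tau [N [tau0 tau_lt onN]]] := grid_exists pts0.
exists tau, N; split => // cb cbg i; have [e1 e2] := endpointsP i cbg.
  by split; apply: onN; rewrite mem_cat ?e1 ?e2.
by split; apply: onN; rewrite mem_cat ?e1 ?e2 orbT.
Qed.

Lemma cmseq_step m g : off_diagonal_step g -> cmseq m (half_open_step g).
Proof.
move=> offg; have [tau [N [_ tau_lt gg _]]] := common_grid offg offg.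
exact: (cmseq_half_open_step tau_lt m gg).
Qed.

Lemma tnorm2_step g h : off_diagonal_step g -> off_diagonal_step h ->
  ((tnorm2 (step_integral S g * star (step_integral S h)))%:E =
   \sum_(p < n.+1) kernel2 (n - p) (ckernel p (half_open_step g) (half_open_step h)))%E.
Proof.
move=> offg offh; have [tau [N [tau0 tau_lt gg gh]]] := common_grid offg offh.
exact: (tnorm2_step_integral tau_lt S_fbm tau0 gg gh offg offh).
Qed.

Lemma kernel2_step_le p g h : off_diagonal_step g -> off_diagonal_step h -> (p <= n)%N ->
  (kernel2 (n - p) (ckernel p (half_open_step g) (half_open_step h)) <=
   2%:E * (norm2 n (half_open_step g) * norm2 n (half_open_step h)))%E.
Proof.
move=> offg offh pn; have := @kernel2_ckernel_le R (n - p) p (half_open_step g) (half_open_step h).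
by rewrite subnK//; apply; exact: cmseq_step.
Qed.

(** The square of this norm is the term [p = 0] of a sum that is finite. *)
Lemma norm2_step_fin g : off_diagonal_step g -> norm2 n (half_open_step g) \is a fin_num.
Proof.
move=> offg; have mg := cmseq_step n offg.
rewrite ge0_fin_numE ?norm2_ge0// ltey; apply/eqP => noo.
have := tnorm2_step offg offg; rewrite big_ord_recl /= subn0 kernel2_ckernel0// noo mulyy.
by rewrite addye// gt_eqF// (@lt_le_trans _ _ 0%E)// sume_ge0 // => p _; exact: kernel2_ge0.
Qed.

Lemma tnorm2_step_le g h : off_diagonal_step g -> off_diagonal_step h ->
  tnorm2 (step_integral S g * star (step_integral S h)) <=
  2 * n.+1%:R * (fine (norm2 n (half_open_step g)) * fine (norm2 n (half_open_step h))).
Proof.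
move=> offg offh; rewrite -lee_fin tnorm2_step//.
set x := fine _; set y := fine _.
apply: (@le_trans _ _ (\sum_(p < n.+1) (2 * (x * y))%:E)%E).
  apply: lee_sum => p _; rewrite !EFinM !fineK ?norm2_step_fin//.
  by apply: kernel2_step_le => //; exact: leq_ord.
by rewrite sumEFin sumr_const card_ord lee_fin -[leLHS]mulr_natr mulrAC.
Qed.

Definition scale_step (c : R[i]) g := [seq (c * cb.1, cb.2) | cb <- g].

Lemma off_diagonal_sub g h : off_diagonal_step g -> off_diagonal_step h ->
  off_diagonal_step (g ++ scale_step (-1) h).
Proof.
by move=> offg offh cb; rewrite mem_cat => /orP[/offg//|/mapP[cb' /offh ? ->]].
Qed.

Lemma step_integral_sub g h :
  step_integral S (g ++ scale_step (-1) h) = step_integral S g - step_integral S h.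
Proof.
rewrite /step_integral big_cat big_map -sumrN; congr (_ + _).
by apply: eq_bigr => cb _; rewrite -scalerA scaleN1r.
Qed.

Lemma half_open_step_sub g h s :
  half_open_step (g ++ scale_step (-1) h) s = half_open_step g s - half_open_step h s.
Proof.
rewrite /half_open_step big_cat big_map -sumrN; congr (_ + _).
by apply: eq_bigr => cb _; rewrite /= mulN1r mulNr.
Qed.

(** The difference of the two products is [I(g) * star I(g - h) + I(g - h) * star I(h)],
    where [I] stands for [step_integral S]. *)
Lemma tnorm2_mul_star_diff g h : off_diagonal_step g -> off_diagonal_step h ->
  tnorm2 (step_integral S g * star (step_integral S g)
          - step_integral S h * star (step_integral S h)) <=
  4 * n.+1%:R * (fine (norm2 n (half_open_step g)) + fine (norm2 n (half_open_step h)))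
  * fine (norm2 n (fun s => half_open_step g s - half_open_step h s)).
Proof.
move=> offg offh; have offgh := off_diagonal_sub offg offh.
have -> : step_integral S g * star (step_integral S g)
    - step_integral S h * star (step_integral S h) =
    step_integral S g * star (step_integral S (g ++ scale_step (-1) h))
    + step_integral S (g ++ scale_step (-1) h) * star (step_integral S h).
  by rewrite step_integral_sub starB mulrBr mulrBl addrA subrK.
apply: le_trans (tnorm2D_le _ _) _.
have h1 := tnorm2_step_le offg offgh; have h2 := tnorm2_step_le offgh offh.
have E : norm2 n (half_open_step (g ++ scale_step (-1) h)) =
    norm2 n (fun s => half_open_step g s - half_open_step h s).
  by apply: eq_tint => s _; rewrite /sqn half_open_step_sub.
by rewrite E in h1 h2; lra.
Qed.

End wigner.
(** For the step functions [g k] that approximate [f] this is [tnorm2_step], and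
    both sides converge: the left one by [tnorm2_cvg_mul_star], the right one by
    the continuity of contractions. *)
Lemma wigner_fourth_moment (R : realType) (A : wstarProbabilitySpace R)
    (S : R -> A) (S_fbm : free_brownian_motion S) (n : nat)
    (f : n.-tuple R -> R[i]) (X : A) : L2 f -> is_wigner_integral S f X ->
  ((tnorm2 (X * star X))%:E =
   \sum_(p < n.+1) kernel2 (n - p) (ckernel p (extend f) (extend f)))%E.
Proof.
move=> fL2 [g [offg gf YX]]; pose F := extend f; have mF := L2_cmseq_extend fL2.
pose G k := half_open_step (g k); have mG k : cmseq n (G k) := cmseq_step n (offg k).
pose Y k := step_integral S (g k).
have Foo : (norm2 n F < +oo)%E.
  case: fL2 => _ _; rewrite /F -sqr_L2norm expe2.
  by move=> h; rewrite lte_mul_pinfty// ?Lnorm_ge0// ge0_fin_numE ?Lnorm_ge0.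
have Ffin : norm2 n F \is a fin_num by rewrite ge0_fin_numE ?norm2_ge0.
have Gfin k : norm2 n (G k) \is a fin_num := norm2_step_fin S_fbm (offg k).
pose d k := norm2 n (fun s => G k s - F s).
have dE k : d k = (L2norm (fun x => step_fun (g k) x - f x)%R ^+ 2)%E.
  exact: (L2_step (pts := endpoints (g k)) (offg k) (fun cb cbg i => endpointsP i cbg) (mG k) fL2).
have d0 : d @ \oo --> 0%E.
  rewrite (funext dE); apply/(ereal_cvg0_sqr (u := fun k => L2norm _)) => // k.
  exact: Lnorm_ge0.
have dfin k : d k \is a fin_num.
  have := norm2_le ltr01 (cmseqB (mG k) mF) (mG k).
  rewrite ge0_fin_numE ?norm2_ge0// => /le_lt_trans; apply.
  have -> : norm2 n (fun s => G k s - F s - G k s) = norm2 n F.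
    apply: eq_tint => s _; rewrite /sqn addrAC subrr add0r.
    by case: (F s) => x y /=; rewrite !sqrrN.
  by rewrite -(fineK (Gfin k)) -(fineK Ffin) -!EFinM -EFinD ltry.
have fd0 : (fun k => fine (d k)) @ \oo --> (0 : R) by have /fine_cvgP[] := d0.
have fd_ge0 k : 0 <= fine (d k) by rewrite fine_ge0// norm2_ge0.
pose nF := fine (norm2 n F); pose nG k := fine (norm2 n (G k)).
have nF0 : 0 <= nF by rewrite fine_ge0// norm2_ge0.
have nG0 k : 0 <= nG k by rewrite fine_ge0// norm2_ge0.
have nG_le k : nG k <= 2 * nF + 2 * fine (d k).
  have := norm2_le ltr01 (mG k) mF; rewrite -/(d k) invr1.
  by rewrite -(fineK (Gfin k)) -(fineK Ffin) -(fineK (dfin k)) -!EFinM -EFinD lee_fin.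
have [N0 _ dN0] : \forall k \near \oo, fine (d k) < 1.
  have /cvgrPdist_lt/(_ 1 ltr01) := fd0; apply: filterS => k.
  by rewrite sub0r normrN ger0_norm.
have cauchy e : 0 < e -> exists M, forall j k, (M <= j)%N -> (M <= k)%N ->
    tnorm2 (Y j * star (Y j) - Y k * star (Y k)) <= e.
  (* [4 * nF + 4] bounds [nG j + nG k] once [d j] and [d k] are below [1] *)
  move=> e0; pose c := 4 * n.+1%:R * (4 * nF + 4) * 4 : R.
  have c0 : 0 < c by rewrite !mulr_gt0// ltr_wpDl// mulr_ge0.
  have /cvgrPdist_lt/(_ _ (divr_gt0 e0 c0))[M _ dM] := fd0.
  exists (maxn N0 M) => j k; rewrite !geq_max => /andP[Nj Mj] /andP[Nk Mk].
  apply: le_trans (tnorm2_mul_star_diff S_fbm (offg j) (offg k)) _.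
  have dj := dN0 j Nj; have dk := dN0 k Nk; rewrite /= in dj dk.
  have := dM j Mj; have := dM k Mk; rewrite /= !sub0r !normrN !ger0_norm//.
  rewrite !ltr_pdivlMr// => ek ej.
  have Gjk : fine (norm2 n (fun s => G j s - G k s)) <= 2 * fine (d j) + 2 * fine (d k).
    have mGF := cmseqB (mG k) mF.
    have := norm2_le ltr01 (cmseqB (mG j) (mG k)) (cmseqB (mG j) mF).
    rewrite -/(d j) invr1.
    have -> : norm2 n (fun s => G j s - G k s - (G j s - F s)) = d k.
      apply: eq_tint => s _; rewrite /sqn (_ : _ - _ - _ = - (G k s - F s)); last by ring.
      by case: (G k s - F s) => x y /=; rewrite !sqrrN.
    rewrite -(fineK (dfin j)) -(fineK (dfin k)) -!EFinM -EFinD.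
    case: (norm2 n _) (norm2_ge0 n (fun s => G j s - G k s)) => [r| |]//=.
  have h1 := nG_le j; have h2 := nG_le k.
  have p1 : 0 <= 4 * n.+1%:R :> R by rewrite mulr_ge0.
  apply: (@le_trans _ _ (4 * n.+1%:R * (4 * nF + 4) * (2 * fine (d j) + 2 * fine (d k)))).
    apply: ler_pM.
    - by apply: mulr_ge0 => //; exact: addr_ge0 (nG0 j) (nG0 k).
    - by rewrite fine_ge0// norm2_ge0.
    - by rewrite ler_wpM2l//; move: h1 h2; rewrite /nG /G; lra.
    - exact: Gjk.
  by move: ek ej; rewrite /c; lra.
have YX0 : (fun k => tnorm2 (Y k - X)) @ \oo --> (0 : R).
  have /cvg_normcP := YX; apply: cvg_trans; apply: near_eq_cvg.
  apply: nearW => k; rewrite subr0 trace_tnorm2 /= expr0n addr0 sqrtr_sqr.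
  by rewrite ger0_norm// tnorm2_ge0.
have WX := tnorm2_cvg_mul_star YX0 cauchy.
have lim1 : (fun k => tnorm2 (Y k * star (Y k))) @ \oo --> tnorm2 (X * star X).
  apply: (cvg_quasi (tnorm2_ge0 _) (fun k => tnorm2_ge0 _) WX) => k e e0.
    by rewrite -{1}[Y k * _](subrK (X * star X)) addrC; exact: tnorm2D_quasi.
  rewrite -{1}[X * _](subrK (Y k * star (Y k))) addrC -(tnorm2N (Y k * _ - _)) opprB.
  exact: tnorm2D_quasi.
have pE (p : 'I_n.+1) : (n - p + p)%N = n by rewrite subnK// leq_ord.
pose qF (p : 'I_n.+1) := kernel2 (n - p) (ckernel p F F).
pose qG (p : 'I_n.+1) k := kernel2 (n - p) (ckernel p (G k) (G k)).
have finK (p : 'I_n.+1) (H : seq R -> R[i]) : cmseq n H -> norm2 n H \is a fin_num ->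
    kernel2 (n - p) (ckernel p H H) \is a fin_num.
  move=> mH Hfin; rewrite ge0_fin_numE ?kernel2_ge0//.
  have := @kernel2_ckernel_le _ (n - p) p H H; rewrite pE => /(_ mH mH) /le_lt_trans; apply.
  by rewrite -(fineK Hfin) -!EFinM ltry.
have lim2 p : (fun k => fine (qG p k)) @ \oo --> fine (qF p).
  pose D k := kernel2 (n - p) (fun u v => ckernel p (G k) (G k) u v - ckernel p F F u v).
  have mK (H : seq R -> R[i]) : cmseq n H -> cmkernel (n - p) (ckernel p H H).
    by move=> mH; apply: cmkernel_ckernel; rewrite pE.
  have Dle k : (D k <= (4 * (nG k + nF) * fine (d k))%:E)%E.
    have Goo : (norm2 n (G k) < +oo)%E by rewrite -ge0_fin_numE ?norm2_ge0.
    have := @kernel2_diff_le _ (n - p) p (G k) F; rewrite pE => /(_ (mG k) mF Goo Foo).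
    rewrite -/(d k) -(fineK (Gfin k)) -(fineK Ffin) -(fineK (dfin k)) -EFinD -!EFinM.
    exact.
  have Dfin k : D k \is a fin_num.
    by rewrite ge0_fin_numE ?kernel2_ge0// (le_lt_trans (Dle k))// ltry.
  have D0 : (fun k => fine (D k)) @ \oo --> (0 : R).
    have bd0 : (fun k => 4 * (2 * nF + 2 * fine (d k) + nF) * fine (d k)) @ \oo --> (0 : R).
      rewrite [X in _ --> X](_ : 0 = 4 * (2 * nF + 2 * 0 + nF) * 0); last by rewrite mulr0.
      apply: cvgM => //; apply: cvgMr; apply: cvgD; last exact: cvg_cst.
      by apply: cvgD; [exact: cvg_cst|exact: cvgMr].
    apply: (squeeze_cvgr _ (cvg_cst 0) bd0); apply: nearW => k.
    rewrite fine_ge0 ?kernel2_ge0//= -lee_fin fineK//; apply: le_trans (Dle k) _.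
    by rewrite lee_fin ler_wpM2r// ler_wpM2l// lerD2r.
  have qGfin k := finK p _ (mG k) (Gfin k); have qFfin := finK p _ mF Ffin.
  apply: (cvg_quasi _ _ D0) => [|k|k e e0|k e e0].
  - by rewrite fine_ge0// kernel2_ge0.
  - by rewrite fine_ge0// kernel2_ge0.
  - have := kernel2_le e0 (mK _ (mG k)) (mK _ mF); rewrite -/(D k).
    by rewrite -(fineK qFfin) -(fineK (qGfin k)) -(fineK (Dfin k)) -!EFinM -EFinD lee_fin.
  have := kernel2_le e0 (mK _ mF) (mK _ (mG k)).
  have -> : kernel2 (n - p) (fun u v => ckernel p F F u v - ckernel p (G k) (G k) u v) = D k.
    apply: eq_tint => u _; apply: eq_tint => v _; rewrite /sqn -opprB.
    by case: (_ - _) => x y /=; rewrite !sqrrN.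
  by rewrite -(fineK qFfin) -(fineK (qGfin k)) -(fineK (Dfin k)) -!EFinM -EFinD lee_fin.
have lim3 : (fun k => tnorm2 (Y k * star (Y k))) @ \oo --> \sum_p fine (qF p).
  have -> : (fun k => tnorm2 (Y k * star (Y k))) = fun k => \sum_p fine (qG p k).
    apply/funext => k; apply: EFin_inj; rewrite (tnorm2_step S_fbm (offg k) (offg k)) -sumEFin.
    by apply: eq_bigr => p _; rewrite fineK//; exact: finK.
  apply: cvg_big => [|p _]; [exact: add_continuous|exact: lim2].
have -> : tnorm2 (X * star X) = \sum_p fine (qF p).
  by rewrite -(cvg_lim _ lim1)// -(cvg_lim _ lim3).
by rewrite -sumEFin; apply: eq_bigr => p _; rewrite fineK//; exact: finK.
Qed.

Lemma ereal_cvg0_sum (R : realType) (m : nat) (q : 'I_m -> nat -> \bar R) :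
  (forall i k, (0 <= q i k)%E) ->
  (fun k => \sum_i q i k)%E @ \oo --> 0%E <-> forall i, q i @ \oo --> 0%E.
Proof.
move=> q0; have s0 k : (0 <= \sum_i q i k)%E by exact: sume_ge0.
split=> [/(ereal_cvg0P s0) h i|h].
  apply/(ereal_cvg0P (q0 i)) => e e0; apply: filterS (h e e0) => k.
  by apply: le_lt_trans; rewrite (bigD1 i)//= leeDl// sume_ge0.
elim: m q q0 s0 h => [|m IH] q q0 s0 h.
  by under eq_fun do rewrite big_ord0; exact: cvg_cst.
under eq_fun do rewrite big_ord_recl.
have IHm : (fun k => \sum_i q (lift ord0 i) k)%E @ \oo --> 0%E.
  by apply: IH => // k; exact: sume_ge0.
have dd : ((0%E : \bar R) +? 0)%E by [].
have := cvgeD dd (h ord0) IHm; rewrite (adde0 0%E); exact.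
Qed.

Theorem theorem1p6 (R : realType) (A : wstarProbabilitySpace R)
    (S : R -> A) (hS : free_brownian_motion S)
    (n : nat) (n_gt0 : (0 < n)%N)
    (f : nat -> n.-tuple R -> R[i])
    (f_L2 : forall k, L2 (f k))
    (f_norm1 : forall k, L2norm (f k) = 1%E)
    (I : nat -> A) (I_f : forall k, is_wigner_integral S (f k) (I k)) :
  ((fun k => trace A ((I k * star (I k)) ^+ 2) : R[i]^o) @ \oo
     --> (2 : R[i]^o))
  <->
  (forall p : nat, (1 <= p <= n - 1)%N ->
     (fun k => L2norm (nested_contraction p (f k) (adjoint_fun (f k)))) @ \oo --> 0%E).
Proof.
case: n n_gt0 f f_L2 f_norm1 I_f => // m _ f f_L2 f_norm1 I_f.
pose q p k := kernel2 (m.+1 - p) (ckernel p (extend (f k)) (extend (f k))).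
pose T k := tnorm2 (I k * star (I k)).
have norm1 k : norm2 m.+1 (extend (f k)) = 1%E.
  by rewrite -sqr_L2norm f_norm1 expe2 mule1.
have TE k : (T k)%:E = (2%:E + \sum_(i < m) q i.+1 k)%E.
  rewrite /T (wigner_fourth_moment hS (f_L2 k) (I_f k)) big_ord_recl big_ord_recr /=.
  rewrite subn0 subnn kernel2_ckernel0; last exact: L2_cmseq_extend.
  rewrite kernel2_ckernelT ?norm1 ?ltry//; last exact: L2_cmseq_extend.
  by rewrite mule1 addeA addeAC -EFinD.
have q0 p k : (0 <= q p k)%E by exact: kernel2_ge0.
have traceE k : trace A ((I k * star (I k)) ^+ 2) = (T k)%:C.
  by rewrite /T -trace_tnorm2 starM starK expr2.
have sumE k : (\sum_(i < m) q i.+1 k = (T k - 2)%:E)%E.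
  by rewrite EFinB TE [(2%:E + _)%E]addeC addeK.
have qL p : (1 <= p <= m.+1 - 1)%N ->
    (fun k => L2norm (nested_contraction p (f k) (adjoint_fun (f k)))) @ \oo --> 0%E
    <-> q p @ \oo --> 0%E.
  move=> /andP[_ pm]; have pm1 : (p <= m.+1)%N by lia.
  have -> : q p = (fun k => L2norm (nested_contraction p (f k) (adjoint_fun (f k))) ^+ 2)%E.
    by apply/funext => k; rewrite L2norm_nested_contraction.
  by apply: ereal_cvg0_sqr => k; exact: Lnorm_ge0.
have sumP := @ereal_cvg0_sum R m (fun i => q i.+1) (fun i k => q0 i.+1 k).
have traceP : ((fun k => trace A ((I k * star (I k)) ^+ 2) : R[i]^o) @ \oo --> (2 : R[i]^o))
    <-> (fun k => \sum_(i < m) q i.+1 k)%E @ \oo --> 0%E.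
  rewrite cvg_normcP.
  have -> : (fun k => Normc.normc (trace A ((I k * star (I k)) ^+ 2) - 2)) = (fun k => T k - 2).
    apply/funext => k; rewrite traceE (_ : (T k)%:C - 2 = (T k - 2)%:C).
      rewrite /= expr0n addr0 sqrtr_sqr ger0_norm//.
      by rewrite -lee_fin -sumE sume_ge0.
    by rewrite rmorphB rmorph_nat.
  rewrite (funext sumE); split => [h|/fine_cvgP[]//].
  by apply/fine_cvgP; split; [exact: nearW|exact: h].
rewrite traceP sumP; split=> [h p pm|h i].
  apply/qL => //; move: pm => /andP[p1 pm].
  have pm' : (p.-1 < m)%N by lia.
  by have := h (Ordinal pm'); rewrite /= prednK.
by apply/qL; [|apply: h]; have := ltn_ord i; lia.
Qed.
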